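(* Let $q,r_1,\dots,r_q$ be fixed nonnegative integers with $r_1+2r_2+\cdots+qr_q=r$, and let $\delta_1,\delta_2,\dots$ be integers, finitely many nonzero, with $\delta_1+2\delta_2+3\delta_3+\cdots=1$. The asymptotic probability, as the number $n$ of vertices tends to infinity, that a random graph or multigraph of configuration $[r_1,r_2,\dots,r_q]$, having no acyclic components, will change to configuration $[r_1+\delta_1,r_2+\delta_2,\dots,r_q+\delta_q,\delta_{q+1},\dots]$ when a random edge is added, is as follows. Put $D=(3r+\frac12)(3r+\frac52)$. (i) If the only nonzero $\delta$ is $\delta_1=1$: $\dfrac{5/4}{D}$. (ii) If the nonzero $\delta$'s are $\delta_j=-1$, $\delta_{j+1}=1$: $\dfrac{9j(j+1)r_j}{D}$. (iii) If the nonzero $\delta$'s are $\delta_j=-2$, $\delta_{2j+1}=1$: $\dfrac{9j^2r_j(r_j-1)}{D}$. (iv) If the nonzero $\delta$'s are $\delta_j=-1$, $\delta_k=-1$, $\delta_{j+k+1}=1$ with $j<k$: $\dfrac{18\,jk\,r_jr_k}{D}$. In all other cases the probability is $0$. These estimates are correct to within $O(n^{-1/2})$ when there are $n$ vertices.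
   Context: A graph or multigraph (self-loops and multiple edges allowed) has configuration $[r_1,r_2,\dots,r_q]$ if for each $j\ge1$ it has exactly $r_j$ connected components with exactly $j$ more edges than vertices ($r_j=0$ for $j>q$); trailing zeros are ignored. It may have any number of unicyclic components (equally many edges and vertices); ''no acyclic components'' means no component is a tree (in particular no isolated vertices). For a multigraph $M$ on labeled vertices $1,\dots,n$ with $m_{xy}=m_{yx}$ edges between $x$ and $y$, the compensation factor is $\kappa(M)=1\big/\prod_{x=1}^n\bigl(2^{m_{xx}}\prod_{y=x}^n m_{xy}!\bigr)$. A random multigraph of the given configuration with no acyclic components is one chosen among all such multigraphs on $n$ labeled vertices with probability proportional to $\kappa(M)$; a random edge is added by choosing an ordered pair $\langle x,y\rangle$ uniformly from the $n^2$ pairs of vertices. A random graph of the given configuration with no acyclic components is uniformly distributed among all such simple graphs on $n$ labeled vertices; a random edge is added by choosing a uniformly random edge between distinct vertices not already present. *)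

(* Defs.v *)
From HB Require Import structures.
From mathcomp Require Import all_boot all_order all_algebra.
From mathcomp Require Import all_classical all_reals all_analysis.
Import Order.TTheory GRing.Theory Num.Theory numFieldNormedType.Exports.

Set Implicit Arguments.
Unset Strict Implicit.
Unset Printing Implicit Defensive.

Local Open Scope classical_set_scope.
Local Open Scope ring_scope.

(** A multigraph on the labeled vertices ['I_n] is a symmetric matrix
    [M : 'M[nat]_n], where [M x y] is the number of edges between [x] and [y]
    and [M x x] is the number of self-loops at [x] (each counted once). *)

Definition adj n (M : 'M[nat]_n) : rel 'I_n := [rel x y | (0 < M x y)%N].

Definition components n (M : 'M[nat]_n) : {set {set 'I_n}} :=
  equivalence_partition (connect (adj M)) [set: 'I_n]%SET.

Definition edges_in n (M : 'M[nat]_n) (C : {set 'I_n}) : nat :=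
  (\sum_(x in C) \sum_(y in C | x <= y) M x y)%N.

Definition ncomp n (M : 'M[nat]_n) (j : nat) : nat :=
  #|[pred C in components M | edges_in M C == (#|C| + j)%N]|.

(** Configurations are functions [c : nat -> int] of which only the values
    [c j] with [1 <= j] matter.  They are integer-valued because a target
    [r + delta] may have negative entries; no multigraph has such a
    configuration. *)
Definition has_config n (M : 'M[nat]_n) (c : nat -> int) : Prop :=
  forall j : nat, (0 < j)%N -> (ncomp M j)%:Z = c j.

(** The vertex sequence of a cycle.  A cycle of length 1 is a self-loop, and
    one of length 2 needs two parallel edges. *)
Definition is_cycle n (M : 'M[nat]_n) (s : seq 'I_n) : bool :=
  [&& (0 < size s)%N, uniq s
    & cycle [rel x y | (if size s == 2 then 1 < M x y else 0 < M x y)%N] s].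

Definition no_acyclic_component n (M : 'M[nat]_n) : Prop :=
  forall C : {set 'I_n}, C \in components M ->
    exists2 s : seq 'I_n, is_cycle M s & {subset s <= C}.

Definition simple_graph n (M : 'M[nat]_n) : Prop :=
  (forall x, M x x = 0%N) /\ (forall x y, (M x y <= 1)%N).

Definition multigraphs n (c : nat -> int) : set 'M[nat]_n :=
  [set M | [/\ M^T = M, has_config M c & no_acyclic_component M]].
Arguments multigraphs : clear implicits.

Definition graphs n (c : nat -> int) : set 'M[nat]_n :=
  multigraphs n c `&` @simple_graph n.
Arguments graphs : clear implicits.

Definition add_edge n (M : 'M[nat]_n) (x y : 'I_n) : 'M[nat]_n :=
  \matrix_(i, j)
    (M i j + (((i == x) && (j == y)) || ((i == y) && (j == x))))%N.

Definition kappa (R : realType) n (M : 'M[nat]_n) : R :=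
  (\prod_(x < n) (2 ^ M x x * \prod_(y < n | x <= y) (M x y)`!))%N%:R^-1.

(** Probability that [M] gets configuration [c] when an edge given by a
    uniformly random ordered pair of vertices is added. *)
Definition multigraph_step (R : realType) n (M : 'M[nat]_n) (c : nat -> int) :
    R :=
  #|[pred p : 'I_n * 'I_n | `[< has_config (add_edge M p.1 p.2) c >]]|%:R
  / (n ^ 2)%:R.

(** An absent edge is represented by the pair of its ends in increasing
    order. *)
Definition absent n (M : 'M[nat]_n) : pred ('I_n * 'I_n) :=
  [pred p : 'I_n * 'I_n | (p.1 < p.2)%N && (M p.1 p.2 == 0%N)].

Definition graph_step (R : realType) n (M : 'M[nat]_n) (c : nat -> int) : R :=
  #|[pred p : 'I_n * 'I_n |
      absent M p && `[< has_config (add_edge M p.1 p.2) c >]]|%:R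
  / #|absent M|%:R.

(** The sums below are over finite sets: when [c] has finite support, a
    multigraph on [n] vertices of configuration [c] without acyclic components
    has exactly [n + c 1 + 2 * c 2 + ...] edges.  When there is none, the
    quotients are [0]; for nonnegative [c] this happens for finitely many [n]
    only. *)

Definition multigraph_transition (R : realType) (c c' : nat -> int) (n : nat) :
    R :=
  (\sum_(M \in multigraphs n c) kappa R M * multigraph_step R M c')
  / (\sum_(M \in multigraphs n c) kappa R M).

Definition graph_transition (R : realType) (c c' : nat -> int) (n : nat) : R :=
  (\sum_(M \in graphs n c) graph_step R M c')
  / (\sum_(M \in graphs n c) (1 : R)).

Definition asymptotic_probability (R : realType) (P : nat -> R) (p : R) :
    Prop :=
  P @ \oo --> p /\
  (fun n => P n - p : R^o) =O_\oo (fun n => (Num.sqrt n%:R)^-1 : R^o).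

(** Equality of integer sequences indexed by [1, 2, ...]. *)
Definition eq_pos (d d' : nat -> int) : Prop :=
  forall j : nat, (0 < j)%N -> d j = d' j.

Definition case1 (delta : nat -> int) : Prop :=
  eq_pos delta [eta (fun=> 0) with 1%N |-> 1].

Definition case2 (delta : nat -> int) (j : nat) : Prop :=
  (0 < j)%N /\ eq_pos delta [eta (fun=> 0) with j |-> -1, j.+1 |-> 1].

Definition case3 (delta : nat -> int) (j : nat) : Prop :=
  (0 < j)%N /\
  eq_pos delta [eta (fun=> 0) with j |-> - 2%:Z, (2 * j).+1 |-> 1].

Definition case4 (delta : nat -> int) (j k : nat) : Prop :=
  (0 < j < k)%N /\
  eq_pos delta [eta (fun=> 0) with j |-> -1, k |-> -1, (j + k).+1 |-> 1].

(* Main.v *)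
(** Write W_j for the exponential generating function of the connected
    structures with j more edges than vertices, theta = z d/dz, T = theta W_(-1)
    and H = 1/(1 - T), so that theta H^b = b (H^(b+2) - H^(b+1)).  Removing an
    edge from a connected structure yields
      2 ((1 - T) theta W_(j+1) + (j+1) W_(j+1))
        = theta^2 W_j + sum_(0 <= i <= j) theta W_i theta W_(j-i),
    up to terms of lower order for simple graphs.  By comparison of
    coefficients, W_j = b_j H^(3j) + O(H^(3j-1)) with b_j > 0 for j >= 1, and
    theta W_0 = H^2 / 2 + O(H).  The structures of configuration r without
    acyclic components have the series Z_r = F prod_j W_j^(r_j) / r_j!, where
    theta F = F theta W_0.  Counting the pairs (x, y) according to the components
    of x and y gives series such as theta W_j theta W_k Z_(r - e_j - e_k), and
    the number of all pairs gives theta^2 Z_r.  All of them are F times a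
    multiple of H^(3r+4) with an error F O(H^(3r+3)), so the transition
    probability tends to the ratio of the leading coefficients; for
    theta^2 Z_r this is proportional to 9r^2 + 9r + 5/4 = D.  No singularity
    analysis is needed for the error term: since H - 2 s H^2 + 2 s^2 H^3 has
    nonnegative coefficients, taking s = n^(-1/2) and
    n [z^n] F H^b <= C [z^n] F H^(b+2) gives
    [z^n] F H^(b+1) = O(n^(-1/2)) [z^n] F H^(b+2). *)

Require Import Defs.
From HB Require Import structures.
From mathcomp Require Import all_boot all_order all_algebra.
From mathcomp Require Import all_classical all_reals all_analysis.
From mathcomp Require Import ring lra zify.
Import Order.TTheory GRing.Theory Num.Theory numFieldNormedType.Exports.
Set Implicit Arguments.
Unset Strict Implicit.
Unset Printing Implicit Defensive.
Local Open Scope ring_scope.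

(** * Formal power series *)

(** The numbers b_j cancel from the ratio: theta W_a contributes 3 a b_a, lowering r_a by one in Z_r
    contributes r_a / b_a, and 3 a r_a remains. For the logarithmic W_0, theta W_0 takes this part,
    with coefficient 1/2.

    Components have to be cut off and put back, which is awkward for matrices weighted by [kappa].
    Counting is therefore done on sequences of ordered pairs, where choosing the vertices and the
    edges of a component means choosing two subsets; the weight [kappa] reappears as the size of a
    fibre. A boolean carries both models through one computation, and the pairs forbidden to a
    simple graph are only O(n) among n^2.

    Each series is handled through an equation for its theta derivative, obtained by pointing at a
    vertex and cutting off its component. Coefficients of such equations can be compared degree by
    degree, and since T has nonnegative coefficients and no constant term, inequalities propagate
    from low degrees to high ones. The same equations also identify Z_r with its product form. *)

Definition fps (R : Type) := nat -> R.

Section FpsRing.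
Variable R : comNzRingType.
HB.instance Definition _ := GRing.Zmodule.copy (fps R) (nat -> R).

Lemma fpsD (f g : fps R) n : (f + g) n = f n + g n. Proof. by []. Qed.
Definition fps_mul (f g : fps R) : fps R :=
  fun n => \sum_(i < n.+1) f i * g (n - i)%N.
Definition fps_one : fps R := fun n => (n == 0%N)%:R.

Definition fps_trunc N (f : fps R) : {poly R} := \poly_(i < N) f i.

(** Low coefficients only see truncations, so associativity and commutativity are inherited from
    polynomials. *)
Lemma fps_mul_trunc N (f g : fps R) n : (n < N)%N ->
  fps_mul f g n = (fps_trunc N f * fps_trunc N g)`_n.
Proof.
move=> nN; rewrite coefM; apply: eq_bigr => i _.
by rewrite !coef_poly !ifT //; have := ltn_ord i; lia.
Qed.

Fact fps_mulA : associative fps_mul.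
Proof.
move=> f g h; apply/funext => n.
transitivity ((fps_trunc n.+1 f * (fps_trunc n.+1 g * fps_trunc n.+1 h))`_n).
  rewrite coefM; apply: eq_bigr => i _.
  by rewrite (@fps_mul_trunc n.+1) ?ltnS ?leq_subr // coef_poly ltn_ord.
rewrite mulrA coefM; apply: eq_bigr => i _.
rewrite (@fps_mul_trunc n.+1) // coef_poly ifT //.
by have := ltn_ord i; lia.
Qed.

Fact fps_mulC : commutative fps_mul.
Proof.
move=> f g; apply/funext => n.
by rewrite !(@fps_mul_trunc n.+1) // mulrC.
Qed.

Fact fps_mul1 : left_id fps_one fps_mul.
Proof.
move=> f; apply/funext => n; rewrite /fps_mul big_ord_recl /fps_one /= mul1r subn0.
by rewrite big1 ?addr0 // => i _; rewrite mul0r.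
Qed.

Fact fps_mulDl : left_distributive fps_mul +%R.
Proof.
move=> f g h; apply/funext => n; rewrite fpsD /fps_mul -big_split.
by apply: eq_bigr => i _; rewrite mulrDl.
Qed.

Fact fps_one_neq0 : fps_one != 0.
Proof.
apply/eqP => /(congr1 (fun f : fps R => f 0%N)) /eqP.
by rewrite /fps_one eqxx oner_eq0.
Qed.

HB.instance Definition _ := GRing.Zmodule_isComNzRing.Build (fps R)
  fps_mulA fps_mulC fps_mul1 fps_mulDl fps_one_neq0.

Lemma fpsM (f g : fps R) n : (f * g) n = \sum_(i < n.+1) f i * g (n - i)%N.
Proof. by []. Qed.
Lemma fpsN (f : fps R) n : (- f) n = - f n. Proof. by []. Qed.
Lemma fpsB (f g : fps R) n : (f - g) n = f n - g n. Proof. by []. Qed.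
Lemma fps0 n : (0 : fps R) n = 0. Proof. by []. Qed.
Lemma fps1 n : (1 : fps R) n = (n == 0%N)%:R. Proof. by []. Qed.
Lemma fps_sum I (r : seq I) (P : pred I) (F : I -> fps R) n :
  (\sum_(i <- r | P i) F i) n = \sum_(i <- r | P i) F i n.
Proof. by elim/big_rec2: _ => // i y z _ <-. Qed.

Definition fpsC (c : R) : fps R := fun n => if n == 0%N then c else 0.

Lemma fpsCM c (f : fps R) n : (fpsC c * f) n = c * f n.
Proof.
rewrite fpsM big_ord_recl /fpsC /= subn0 big1 ?addr0 // => i _.
by rewrite mul0r.
Qed.

Lemma fpsC_is_zmod_morphism : zmod_morphism fpsC.
Proof. by move=> c d; apply/funext => -[|n]; rewrite fpsB /fpsC //= subr0. Qed.
Lemma fpsC_is_monoid_morphism : monoid_morphism fpsC.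
Proof.
split; first by apply/funext => -[|n]. 
by move=> c d; apply/funext => -[|n]; rewrite fpsCM /fpsC //= mulr0.
Qed.
HB.instance Definition _ := GRing.isZmodMorphism.Build R (fps R) fpsC fpsC_is_zmod_morphism.
HB.instance Definition _ := GRing.isMonoidMorphism.Build R (fps R) fpsC fpsC_is_monoid_morphism.

Definition theta (f : fps R) : fps R := fun n => n%:R * f n.

Lemma theta_is_zmod_morphism : zmod_morphism theta.
Proof. by move=> f g; apply/funext => n; rewrite /theta fpsB mulrBr. Qed.
HB.instance Definition _ := GRing.isZmodMorphism.Build (fps R) (fps R) theta
  theta_is_zmod_morphism.

Lemma thetaB f g : theta (f - g) = theta f - theta g.
Proof. exact: raddfB. Qed.
Lemma thetaD f g : theta (f + g) = theta f + theta g.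
Proof. exact: raddfD. Qed.

Lemma thetaM f g : theta (f * g) = theta f * g + f * theta g.
Proof.
apply/funext => n; rewrite fpsD /theta !fpsM mulr_sumr -big_split /=.
apply: eq_bigr => i _.
have -> : n%:R = i%:R + (n - i)%:R :> R.
  by rewrite -natrD subnKC // -ltnS.
by ring.
Qed.

Lemma thetaC c : theta (fpsC c) = 0.
Proof. by apply/funext => -[|n]; rewrite /theta /fpsC /= ?mul0r ?mulr0. Qed.

Lemma thetaCM c f : theta (fpsC c * f) = fpsC c * theta f.
Proof. by rewrite thetaM thetaC mul0r add0r. Qed.

Lemma theta1 : theta 1 = 0.
Proof. by have := thetaC 1; rewrite rmorph1. Qed.

Lemma thetaX f k : theta (f ^+ k.+1) = k.+1%:R * f ^+ k * theta f.
Proof.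
elim: k => [|k IH]; first by rewrite expr1 expr0 !mul1r.
rewrite exprS thetaM IH !exprS -[k.+2%:R]natr1; ring.
Qed.

End FpsRing.

(** * Coefficientwise comparison and the series 1/(1 - T) *)

Section Growth.
Variable R : realType.
Implicit Types f g : fps R.

Definition dominated f g := forall n, `|f n| <= g n.

Lemma dominatedM f1 g1 f2 g2 : dominated f1 g1 -> dominated f2 g2 ->
  dominated (f1 * f2) (g1 * g2).
Proof.
move=> h1 h2 n; rewrite !fpsM; apply: le_trans (ler_norm_sum _ _ _) _.
by apply: ler_sum => i _; rewrite normrM ler_pM.
Qed.

Definition nonneg f := forall n, 0 <= f n.

Lemma nonnegM f g : nonneg f -> nonneg g -> nonneg (f * g).
Proof. by move=> hf hg n; rewrite fpsM; apply: sumr_ge0 => i _; rewrite mulr_ge0. Qed.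

Lemma nonneg1 : nonneg 1.
Proof. by move=> n; rewrite fps1 ler0n. Qed.

Lemma nonnegX f k : nonneg f -> nonneg (f ^+ k).
Proof.
by move=> hf; elim: k => [|k IH]; rewrite ?expr0 ?exprS; [exact: nonneg1|exact: nonnegM].
Qed.

Lemma ler_fpsM f g h : nonneg h -> (forall n, f n <= g n) ->
  forall n, (h * f) n <= (h * g) n.
Proof.
move=> hh fg n; rewrite !fpsM; apply: ler_sum => i _.
by rewrite ler_wpM2l.
Qed.

Variable T : fps R.
Hypothesis T0 : T 0%N = 0.
Hypothesis Tge0 : nonneg T.

Lemma fpsX_eq0 k n : (n < k)%N -> (T ^+ k) n = 0.
Proof.
elim: k n => // k IH n nk; rewrite exprS fpsM big1 // => -[[|i] /= hi] _.
  by rewrite T0 mul0r.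
by rewrite IH ?mulr0 //; lia.
Qed.

(** This is 1/(1 - T); the sum may stop at n because T has no constant term, so that T^k starts in
    degree k. *)
Definition geom : fps R := fun n => \sum_(k < n.+1) (T ^+ k) n.
Local Notation H := geom.

Lemma geomE N n : (n < N)%N -> H n = \sum_(k < N) (T ^+ k) n.
Proof.
move=> nN; rewrite /geom -!(big_mkord xpredT (fun k => (T ^+ k) n)).
rewrite [RHS](@big_cat_nat _ _ _ n.+1) //= [X in _ + X]big_nat [X in _ + X]big1 ?addr0 //.
by move=> i /andP[h _]; rewrite fpsX_eq0.
Qed.

Lemma geomP : (1 - T) * H = 1.
Proof.
apply/funext => n.
transitivity (((1 - T) * (\sum_(k < n.+1) T ^+ k)) n).
  rewrite !fpsM; apply: eq_bigr => i _; congr (_ * _).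
  by rewrite fps_sum (@geomE n.+1) // ltnS leq_subr.
have := subrX1 T n.+1.
move=> /(congr1 (fun f => - f)); rewrite opprB -mulNr opprB => <-.
by rewrite fpsB fpsX_eq0 // subr0.
Qed.

Lemma geom_ge0 : nonneg H.
Proof. by move=> n; apply: sumr_ge0 => k _; apply: nonnegX. Qed.

(** Serves twice: it makes the coefficients of H^b increase with b, and as [geom_mulT] it trades a
    factor T for a difference of powers of H. *)
Lemma geomS b : H ^+ b.+1 = H ^+ b + T * H ^+ b.+1.
Proof.
rewrite !exprS; transitivity (((1 - T) * H) * H ^+ b + T * (H * H ^+ b)).
  by ring.
by rewrite geomP mul1r.
Qed.

Lemma geom_le_exp b c n : (b <= c)%N -> (H ^+ b) n <= (H ^+ c) n.
Proof.
elim: c => [|c IH]; first by rewrite leqn0 => /eqP->.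
rewrite leq_eqVlt => /orP[/eqP->//|]; rewrite ltnS => /IH h.
apply: le_trans h _; rewrite [X in _ <= X n]geomS fpsD lerDl.
by apply: nonnegM => //; apply: nonnegX; exact: geom_ge0.
Qed.

End Growth.

(** * Leading terms in powers of 1/(1 - T) *)

Section Lead.
Variable R : realType.
Variable T : fps R.
Hypothesis T0 : T 0%N = 0.
Hypothesis Tge0 : nonneg T.
Hypothesis thetaT : theta T = T * geom T.
Local Notation H := (geom T).
Implicit Types f g : fps R.

Local Definition H_ge0 : nonneg H := geom_ge0 Tge0.
Local Definition HX_ge0 b : nonneg (H ^+ b) := nonnegX b H_ge0.

Lemma geom_mulT b : T * H ^+ b.+1 = H ^+ b.+1 - H ^+ b.
Proof. by have := geomS T0 b => h; rewrite {2}h addrC addKr. Qed.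

(** Applying theta to (1 - T) H = 1 gives (1 - T) theta H = T H^2; multiply by H. *)
Lemma theta_geom : theta H = H ^+ 3 - H ^+ 2.
Proof.
have hT := geomP T0; have := congr1 (@theta R) hT.
rewrite thetaM thetaB theta1 sub0r thetaT => h.
transitivity (H * (1 - T) * theta H); first by rewrite [H * _]mulrC hT mul1r.
rewrite -geom_mulT.
transitivity (H * (- (T * H) * H + (1 - T) * theta H) + T * H ^+ 3); first by ring.
by rewrite h mulr0 add0r.
Qed.

Lemma theta_geomX b : theta (H ^+ b) = b%:R * (H ^+ b.+2 - H ^+ b.+1).
Proof.
case: b => [|b]; first by rewrite expr0 theta1 mul0r.
by rewrite thetaX theta_geom !exprS; ring.
Qed.

(** The bound holds for every coefficient, not just eventually; this is what makes it stable under
    products and under multiplication by a nonnegative series. *)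
Definition geomO b f := exists C : R, forall n, `|f n| <= C * (H ^+ b) n.

Lemma geomO_ge0 b f : geomO b f -> exists2 C : R, 0 <= C & forall n, `|f n| <= C * (H ^+ b) n.
Proof.
move=> [C hC]; exists `|C| => // n; apply: le_trans (hC n) _.
by rewrite ler_wpM2r ?ler_norm //; apply: HX_ge0.
Qed.

Lemma geomO0 b : geomO b 0.
Proof. by exists 0 => n; rewrite mul0r fps0 normr0. Qed.

Lemma geomOX b : geomO b (H ^+ b).
Proof. by exists 1 => n; rewrite mul1r ger0_norm //; apply: HX_ge0. Qed.

Lemma geomOD b f g : geomO b f -> geomO b g -> geomO b (f + g).
Proof.
move=> [C hC] [D hD]; exists (C + D) => n; rewrite fpsD mulrDl.
by apply: le_trans (ler_normD _ _) _; rewrite lerD.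
Qed.

Lemma geomON b f : geomO b f -> geomO b (- f).
Proof. by move=> [C hC]; exists C => n; rewrite fpsN normrN. Qed.

Lemma geomOB b f g : geomO b f -> geomO b g -> geomO b (f - g).
Proof. by move=> hf hg; apply: geomOD => //; apply: geomON. Qed.

Lemma geomOM a b f g : geomO a f -> geomO b g -> geomO (a + b) (f * g).
Proof.
move=> [C hC] [D hD]; exists (C * D) => n.
have h1 : dominated f (fpsC C * H ^+ a) by move=> m; rewrite fpsCM.
have h2 : dominated g (fpsC D * H ^+ b) by move=> m; rewrite fpsCM.
have := dominatedM h1 h2 n.
have -> : fpsC C * H ^+ a * (fpsC D * H ^+ b) = fpsC (C * D) * H ^+ (a + b).
  by rewrite exprD rmorphM; ring.
by rewrite fpsCM.
Qed.

Lemma geomOCM b c f : geomO b f -> geomO b (fpsC c * f).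
Proof.
move=> [C hC]; exists (`|c| * C) => n; rewrite fpsCM normrM -mulrA.
by rewrite ler_wpM2l.
Qed.

Lemma geomO_weak a b f : (a <= b)%N -> geomO a f -> geomO b f.
Proof.
move=> ab /geomO_ge0[C C0 hC]; exists C => n; apply: le_trans (hC n) _.
by rewrite ler_wpM2l // geom_le_exp.
Qed.

(** In theta H^b = b (H^(b+2) - H^(b+1)) the negative term is dropped: one theta costs two powers of
    H. *)
Lemma geomO_theta b f : geomO b f -> geomO b.+2 (theta f).
Proof.
move=> /geomO_ge0[C C0 hC]; exists (C * b%:R) => n; rewrite /theta normrM normr_nat.
apply: (@le_trans _ _ (C * (theta (H ^+ b)) n)).
  by rewrite /theta mulrCA ler_wpM2l.
rewrite -mulrA ler_wpM2l // theta_geomX -(rmorph_nat (@fpsC R)) fpsCM.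
by rewrite ler_wpM2l // fpsB gerBl; apply: HX_ge0.
Qed.

(* [lead b c f] is [f = c (1 - T)^-b + O((1 - T)^(1 - b))], coefficientwise;
   for [b = 0] there is no error term. *)
Definition lead b (c : R) f :=
  if b is b'.+1 then geomO b' (f - fpsC c * H ^+ b) else f = fpsC c.

Lemma lead_geomO b c f : lead b c f -> geomO b f.
Proof.
have h := geomOCM c (geomOX b); case: b h => [|b] h.
  by move=> ->; move: h; rewrite expr0 mulr1.
move=> h'; rewrite -[f](subrK (fpsC c * H ^+ b.+1)).
by apply: geomOD => //; apply: geomO_weak h'.
Qed.

Lemma geomO_lead b f : geomO b f -> lead b.+1 0 f.
Proof. by move=> h; rewrite /lead rmorph0 mul0r subr0. Qed.

Lemma leadX b : lead b 1 (H ^+ b).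
Proof.
case: b => [|b] /=; first by rewrite rmorph1 expr0.
by rewrite rmorph1 mul1r subrr; exact: geomO0.
Qed.

Lemma leadD b c d f g : lead b c f -> lead b d g -> lead b (c + d) (f + g).
Proof.
case: b => [|b] /=; first by move=> -> ->; rewrite rmorphD.
move=> hf hg; have := geomOD hf hg; congr (geomO _ _).
by rewrite rmorphD; ring.
Qed.

Lemma leadM a b c d f g : lead a c f -> lead b d g -> lead (a + b) (c * d) (f * g).
Proof.
move=> hf hg; have of_ := lead_geomO hf; have og := lead_geomO hg.
case: a b hf hg of_ og => [|a] [|b].
- by move=> /= -> ->; rewrite -rmorphM.
- move=> /= -> h _ _; have := geomOCM c h; congr (geomO _ _).
  by rewrite rmorphM /=; ring.
- move=> /= h -> _ _; rewrite addn0; have := geomOCM d h; congr (geomO _ _).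
  by rewrite rmorphM addn0 /=; ring.
move=> hf hg of_ og.
(* Telescoping: f g - c d H^(a+b) = (f - c H^a) g + c H^a (g - d H^b), each term one power of H
   short. *)
suff -> : lead (a.+1 + b.+1) (c * d) (f * g) = geomO (a + b.+1)
  ((f - fpsC c * H ^+ a.+1) * g + (fpsC c * H ^+ a.+1) * (g - fpsC d * H ^+ b.+1)).
  apply: geomOD; first by apply: geomOM.
  by rewrite addnS -addSn; apply: geomOM => //; apply: geomOCM; exact: geomOX.
rewrite addSn /= -addSn exprD rmorphM /=; congr (geomO _ _). ring.
Qed.

Lemma leadCM b c d f : lead b c f -> lead b (d * c) (fpsC d * f).
Proof. by move=> h; have : lead 0 d (fpsC d) by []; move=> /leadM/(_ h). Qed.

Lemma lead_theta b c f : lead b c f -> lead b.+2 (b%:R * c) (theta f).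
Proof.
case: b => [|b].
  by move=> /= ->; rewrite thetaC mul0r rmorph0 mul0r subr0; exact: geomO0.
move=> /= /geomO_theta h.
have -> : theta f - fpsC (b.+1%:R * c) * H ^+ b.+3 =
  theta (f - fpsC c * H ^+ b.+1) - fpsC (b.+1%:R * c) * H ^+ b.+2.
  rewrite thetaB thetaCM theta_geomX rmorphM /= rmorph_nat; ring.
by apply: geomOB => //; apply: geomOCM; exact: geomOX.
Qed.

Lemma lead_sum b I (r : seq I) (P : pred I) (c : I -> R) (F : I -> fps R) :
  (forall i, P i -> lead b.+1 (c i) (F i)) ->
  lead b.+1 (\sum_(i <- r | P i) c i) (\sum_(i <- r | P i) F i).
Proof.
move=> h; apply: (big_ind2 (fun f c => lead b.+1 c f)) => //.
  by apply: geomO_lead; exact: geomO0.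
by move=> x1 x2 y1 y2; exact: leadD.
Qed.

Lemma lead_err b c f g : lead b.+1 c f -> geomO b g -> lead b.+1 c (f + g).
Proof. by move=> hf /geomO_lead /(leadD hf); rewrite addr0. Qed.

(** Since T has no constant term, the n-th coefficient of (1 - T) theta g + j g is (n + j) g_n minus
    a nonnegative combination of earlier g_k. Nonnegativity therefore propagates by induction. *)
Lemma solve_nonneg (j : nat) g : (0 < j)%N ->
  nonneg ((1 - T) * theta g + j%:R * g) -> nonneg g.
Proof.
move=> j0 hg n; elim/ltn_ind: n => n IH.
have := hg n; rewrite mulrBl mul1r fpsD fpsB -(rmorph_nat (@fpsC R)) fpsCM.
rewrite fpsM big_ord_recl T0 mul0r add0r => h.
have : 0 <= (n + j)%:R * g n.
  rewrite natrD mulrDl; apply: le_trans h _; rewrite lerD2r gerBl.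
  apply: sumr_ge0 => i _; rewrite mulr_ge0 //.
  rewrite /theta mulr_ge0 //; apply: IH; rewrite lift0.
  by have := ltn_ord i; lia.
by rewrite pmulr_rge0 // ltr0n; lia.
Qed.

(** Comparison argument: the operator sends H^d to j H^(d+1) + (d - j) T H^(d+1), so for j <= d it
    sends E = (C / j) H^d to a series dominating C H^(d+1). Hence E + g and E - g have nonnegative
    images, and are nonnegative themselves. *)
Lemma solve_geomO (j d : nat) g : (0 < j <= d)%N ->
  geomO d.+1 ((1 - T) * theta g + j%:R * g) -> geomO d g.
Proof.
move=> /andP[j0 jd]; set q := (_ * _ + _) => /geomO_ge0[C C0 hC]; exists (C / j%:R).
pose E := fpsC (C / j%:R) * H ^+ d.
have j0' : j%:R != 0 :> R by rewrite pnatr_eq0; lia.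
have EE n : C * (H ^+ d.+1) n <= ((1 - T) * theta E + j%:R * E) n.
  have -> : (1 - T) * theta E + j%:R * E = fpsC (C / j%:R) *
      (j%:R * H ^+ d.+1 + (d - j)%:R * (T * H ^+ d.+1)).
    have e : T * H ^+ d.+1 = H ^+ d.+1 - H ^+ d.
      exact: geom_mulT.
    have e1 : T * H ^+ d.+2 = H ^+ d.+2 - H ^+ d.+1.
      exact: geom_mulT.
    have e2 : (1 - T) * (H ^+ d.+2 - H ^+ d.+1) = T * H ^+ d.+1.
      rewrite mulrBr mulrBl mul1r e1 mulrBl mul1r e; ring.
    rewrite /E thetaCM theta_geomX natrB // mulrCA [(1 - T) * _]mulrCA e2 e.
    ring.
  rewrite fpsCM fpsD -!(rmorph_nat (@fpsC R)) !fpsCM mulrDr mulrA divfK //.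
  rewrite lerDl !mulr_ge0 ?invr_ge0 //.
  by apply: nonnegM => //; exact: HX_ge0.
have key s : (s == 1) || (s == -1) -> nonneg (E + fpsC s * g).
  move=> hs; apply: (@solve_nonneg j) => // n.
  have -> : (1 - T) * theta (E + fpsC s * g) + j%:R * (E + fpsC s * g) =
    ((1 - T) * theta E + j%:R * E) + fpsC s * q.
    by rewrite /q thetaD !thetaCM; ring.
  rewrite fpsD fpsCM; have := hC n; have := EE n.
  rewrite ler_norml => hE /andP[].
  by case/orP: hs => /eqP->; lra.
move=> n; have := key 1; have := key (-1); rewrite !eqxx orbT.
move=> /(_ isT)/(_ n) + /(_ isT)/(_ n); rewrite /E !fpsD !fpsCM => h1 h2.
by rewrite ler_norml; apply/andP; split; lra.
Qed.

Lemma lead_solve (j d : nat) c g : (0 < j <= d)%N ->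
  lead d.+2 c ((1 - T) * theta g + j%:R * g) -> lead d.+1 (c / d.+1%:R) g.
Proof.
move=> jd /= h; apply: (solve_geomO jd).
(* The operator sends c / (d + 1) H^(d+1) to c H^(d+2) + c (j / (d + 1) - 1) H^(d+1); the second
   term goes into the error. *)
have := geomOB h (geomOCM (c * (j%:R / d.+1%:R - 1)) (geomOX d.+1)); congr (geomO _ _).
have d0 : d.+1%:R != 0 :> R by rewrite pnatr_eq0.
have e1 : T * H ^+ d.+2 = H ^+ d.+2 - H ^+ d.+1.
  exact: geom_mulT.
have e2 : T * H ^+ d.+3 = H ^+ d.+3 - H ^+ d.+2.
  exact: geom_mulT.
have e3 : (1 - T) * (H ^+ d.+3 - H ^+ d.+2) = H ^+ d.+2 - H ^+ d.+1.
  by rewrite mulrBr mulrBl mul1r e2 mulrBl mul1r e1; ring.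
have e4 : fpsC (c / d.+1%:R) * d.+1%:R = fpsC c.
  by rewrite -(rmorph_nat (@fpsC R)) -rmorphM /= divfK.
have e5 : (1 - T) * theta (fpsC (c / d.+1%:R) * H ^+ d.+1) =
    fpsC c * (H ^+ d.+2 - H ^+ d.+1).
  by rewrite thetaCM theta_geomX -e3 -e4; ring.
rewrite thetaB [(1 - T) * (_ - _)]mulrBr e5.
rewrite rmorphM rmorphB /= rmorphM rmorph1 rmorphM /= rmorph_nat; ring.
Qed.

End Lead.

(** * From leading terms to ratios of coefficients *)

Section Smoothing.
Variable R : realType.
Variable T : fps R.
Hypothesis T0 : T 0%N = 0.
Hypothesis Tge0 : nonneg T.
Hypothesis thetaT : theta T = T * geom T.
Local Notation H := (geom T).
Implicit Types f g : fps R.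

Definition comp_fps (a : nat -> R) : fps R :=
  fun n => \sum_(k < n.+1) a k * (T ^+ k) n.

Lemma comp_fpsE N n a : (n < N)%N ->
  comp_fps a n = (\sum_(k < N) fpsC (a k) * T ^+ k) n.
Proof.
move=> nN; rewrite fps_sum; under [RHS]eq_bigr do rewrite fpsCM.
rewrite /comp_fps -!(big_mkord xpredT (fun k => a k * (T ^+ k) n)).
rewrite [RHS](@big_cat_nat _ _ _ n.+1) //= [X in _ + X]big_nat [X in _ + X]big1 ?addr0 //.
by move=> i /andP[h _]; rewrite fpsX_eq0 ?mulr0.
Qed.

(** Multiplying by 1/(1 - T) takes partial sums of the coefficients in T; iterated, this gives the
    expansions of H, H^2 and H^3 in powers of T. *)
Lemma comp_fps_geom (a b : nat -> R) :
  b 0%N = a 0%N -> (forall k, b k.+1 = b k + a k.+1) ->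
  comp_fps b = H * comp_fps a.
Proof.
move=> b0 bS; suff h : (1 - T) * comp_fps b = comp_fps a.
  by rewrite -h mulrA [H * _]mulrC geomP // mul1r.
apply/funext => n.
have E N : (1 - T) * (\sum_(k < N.+1) fpsC (b k) * T ^+ k) =
    \sum_(k < N.+1) fpsC (a k) * T ^+ k - fpsC (b N) * T ^+ N.+1.
  elim: N => [|N IH]; first by rewrite !big_ord1 b0 !expr0 expr1; ring.
  by rewrite big_ord_recr /= mulrDr IH [in RHS]big_ord_recr /= bS rmorphD !exprS /=; ring.
transitivity (((1 - T) * (\sum_(k < n.+1) fpsC (b k) * T ^+ k)) n).
  rewrite !fpsM; apply: eq_bigr => i _; congr (_ * _).
  by rewrite (@comp_fpsE n.+1) // ltnS leq_subr.
by rewrite E fpsB fpsCM fpsX_eq0 // mulr0 subr0 -comp_fpsE.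
Qed.

(* The k-th coefficient in [T] is [(1 - s (k + 1))^2 + s^2 (k + 1)]. *)
Lemma amgm_geom (s : R) : nonneg (H - fpsC (2 * s) * H ^+ 2 + fpsC (2 * s ^+ 2) * H ^+ 3).
Proof.
pose a1 (k : nat) : R := 1; pose a2 (k : nat) : R := k.+1%:R.
pose a3 (k : nat) : R := k.+1%:R * k.+2%:R / 2.
have c1 : comp_fps a1 = H.
  by apply/funext => n; apply: eq_bigr => k _; rewrite mul1r.
have c2 : comp_fps a2 = H ^+ 2.
  by rewrite (@comp_fps_geom a1) ?c1 // => k; rewrite /a2 /a1 -[in LHS]natr1.
have c3 : comp_fps a3 = H ^+ 3.
  rewrite (@comp_fps_geom a2) ?c2 ?exprS //; first by rewrite /a3 /a2; field.
  by move=> k; rewrite /a3 /a2 -[k.+3%:R]natr1 -[k.+2%:R]natr1; field.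
move=> n; rewrite -c3 -c2 -{1}c1 fpsD fpsB !fpsCM /comp_fps !mulr_sumr.
rewrite -sumrB -big_split /=; apply: sumr_ge0 => k _.
have h : 0 <= (T ^+ k) n by apply: nonnegX.
have -> : a1 k * (T ^+ k) n - 2 * s * (a2 k * (T ^+ k) n) +
    2 * s ^+ 2 * (a3 k * (T ^+ k) n) =
  ((1 - s * a2 k) ^+ 2 + s ^+ 2 * a2 k) * (T ^+ k) n.
  by rewrite /a1 /a3 /a2 -[k.+2%:R]natr1; field.
by rewrite mulr_ge0 // addr_ge0 ?sqr_ge0 // mulr_ge0 ?sqr_ge0 // ler0n.
Qed.

(** [G] will be the series F of sets of unicyclic components and [U] will be theta W_0. *)
Variables G U : fps R.
Hypothesis Gge0 : nonneg G.
Hypothesis G0 : G 0%N = 1.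
Hypothesis thetaG : theta G = U * G.
Hypothesis U2 : geomO T 2 U.
Local Notation S b n := ((G * H ^+ b) n).

Let HX_ge0 b : nonneg (H ^+ b). Proof. by apply: nonnegX; exact: geom_ge0. Qed.

Lemma GH_theta b : exists2 C : R, 0 <= C & forall n, n%:R * S b n <= C * S b.+2 n.
Proof.
have [C C0 hC] := geomO_ge0 Tge0 U2; exists (C + b%:R); first by rewrite addr_ge0.
move=> n; have -> : n%:R * S b n = theta (G * H ^+ b) n by [].
rewrite thetaM thetaG theta_geomX // fpsD mulrDl.
have -> : U * G * H ^+ b = (G * H ^+ b) * U by ring.
apply: lerD.
  apply: le_trans (_ : ((G * H ^+ b) * (fpsC C * H ^+ 2)) n <= _).
    apply: ler_fpsM; first exact: nonnegM.
    by move=> m; rewrite fpsCM; apply: le_trans (hC m); exact: ler_norm.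
  have -> : G * H ^+ b * (fpsC C * H ^+ 2) = fpsC C * (G * H ^+ b.+2).
    by rewrite !exprS; ring.
  by rewrite fpsCM.
have -> : G * (b%:R * (H ^+ b.+2 - H ^+ b.+1)) =
  fpsC b%:R * (G * H ^+ b.+2) - fpsC b%:R * (G * H ^+ b.+1) by rewrite rmorph_nat; ring.
rewrite fpsB !fpsCM gerBl mulr_ge0 ?ler0n //; exact: nonnegM.
Qed.

Lemma GH_smooth b : exists2 C : R, 0 <= C &
  forall n, (0 < n)%N -> S b.+2 n <= C / Num.sqrt n%:R * S b.+3 n.
Proof.
have [C C0 hC] := GH_theta b.+1; exists (C / 2 + 1); first by rewrite addr_ge0 // divr_ge0.
move=> n n0; pose q : R := Num.sqrt n%:R.
have q0 : 0 < q by rewrite sqrtr_gt0 ltr0n.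
have qq : n%:R = q ^+ 2 by rewrite sqr_sqrtr // ler0n.
(* With x, y, z as named below this reads 2 y / q <= x + 2 z / q^2, and x <= C z / q^2 by
   [GH_theta]. Multiplying by q / 2 gives the constant C / 2 + 1. *)
have := @nonnegM R _ _ (nonnegM Gge0 (HX_ge0 b)) (amgm_geom q^-1) n.
have -> : G * H ^+ b * (H - fpsC (2 / q) * H ^+ 2 + fpsC (2 * q^-1 ^+ 2) * H ^+ 3) =
  G * H ^+ b.+1 - fpsC (2 / q) * (G * H ^+ b.+2) + fpsC (2 * q^-1 ^+ 2) * (G * H ^+ b.+3).
  by rewrite !exprS; ring.
rewrite fpsD fpsB !fpsCM -/q; have := hC n; rewrite qq.
set x := S b.+1 n; set y := S b.+2 n; set z := S b.+3 n => h1 h2.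
have h3 : x <= C * z / q ^+ 2.
  by rewrite ler_pdivlMr ?exprn_gt0 // mulrC.
have h4 : 2 / q * y <= C * z / q ^+ 2 + 2 * q^-1 ^+ 2 * z by lra.
have -> : (C / 2 + 1) / q * z = (q / 2) * (C * z / q ^+ 2 + 2 * q^-1 ^+ 2 * z).
  by field; lra.
have -> : y = (q / 2) * (2 / q * y) by field; lra.
by rewrite ler_wpM2l // divr_ge0 // ltW.
Qed.

Hypothesis Tgt0 : forall n, (0 < n)%N -> 0 < T n.

Lemma GH_gt0 b n : (0 < b)%N -> 0 < S b n.
Proof.
case: b => // b _.
have H0 : forall k, (H ^+ k) 0%N = 1.
  elim=> [|k IH]; first by rewrite expr0 fps1.
  by rewrite exprS fpsM big_ord1 subn0 IH mulr1 /geom big_ord1 expr0 fps1.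
have Hgt : 0 < H n.
  case: n => [|n]; first by have := H0 1%N; rewrite expr1 => ->.
  rewrite /geom big_ord_recl expr0 fps1 /= add0r big_ord_recl /bump /= expr1 ltr_pwDl ?Tgt0 //.
  by apply: sumr_ge0 => i _; apply: nonnegX.
rewrite fpsM big_ord_recl G0 mul1r subn0 ltr_pwDl //.
  by apply: lt_le_trans Hgt _; rewrite -{1}[H]expr1; exact: geom_le_exp.
by apply: sumr_ge0 => i _; rewrite mulr_ge0 //; apply: HX_ge0.
Qed.

(** The error is one power of H short, which [GH_smooth] converts into a factor n^(-1/2). *)
Lemma lead_coef_error b c f : lead T b.+3 c f ->
  exists2 C : R, 0 <= C & forall n, (0 < n)%N ->
    `|(G * f) n - c * S b.+3 n| <= C / Num.sqrt n%:R * S b.+3 n.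
Proof.
move=> /(geomO_ge0 Tge0)[C C0 hC]; have [D D0 hD] := GH_smooth b.
exists (C * D); first by rewrite mulr_ge0.
move=> n n0.
have -> : (G * f) n - c * S b.+3 n = (G * (f - fpsC c * H ^+ b.+3)) n.
  have -> : G * (f - fpsC c * H ^+ b.+3) = G * f - fpsC c * (G * H ^+ b.+3) by ring.
  by rewrite fpsB fpsCM.
apply: le_trans (_ : C * S b.+2 n <= _).
  have h2 : dominated (f - fpsC c * H ^+ b.+3) (fpsC C * H ^+ b.+2) by move=> m; rewrite fpsCM.
  have h1 : dominated G G by move=> m; rewrite ger0_norm.
  have := dominatedM h1 h2 n.
  have -> : G * (fpsC C * H ^+ b.+2) = fpsC C * (G * H ^+ b.+2) by ring.
  by rewrite fpsCM.
by rewrite -!mulrA ler_wpM2l // mulrA hD.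
Qed.

Lemma lead_ratio b c d f g : 0 < d -> lead T b.+3 c f -> lead T b.+3 d g ->
  exists2 C : R, 0 <= C & exists N, forall n, (N <= n)%N ->
    0 < (G * g) n /\ `|(G * f) n / (G * g) n - c / d| <= C / Num.sqrt n%:R.
Proof.
move=> d0 /lead_coef_error[C C0 hC] /lead_coef_error[D D0 hD].
have K0 : 0 <= (C + `|c| / d * D) * (2 / d).
  apply: mulr_ge0; last by rewrite divr_ge0 // ltW.
  by rewrite addr_ge0 // mulr_ge0 // divr_ge0 // ltW.
exists ((C + `|c| / d * D) * (2 / d)) => //.
(* From here on sqrt n >= 2 D / d, so the denominator keeps at least half of its leading term. *)
exists (Num.truncn ((2 * D / d) ^+ 2)).+2 => n hn.
have n0 : (0 < n)%N by lia.
pose q : R := Num.sqrt n%:R.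
have q0 : 0 < q by rewrite sqrtr_gt0 ltr0n.
have qD : 2 * D / d <= q.
  rewrite -[leLHS]ger0_norm ?divr_ge0 ?mulr_ge0 ?(ltW d0) //.
  rewrite -sqrtr_sqr ler_sqrt ?ler0n //.
  have h := truncnS_gt ((2 * D / d) ^+ 2); apply: le_trans (ltW h) _.
  by rewrite ler_nat; apply: leq_trans hn; exact: leqnSn.
pose s := S b.+3 n; pose x := (G * f) n; pose y := (G * g) n.
have hx : `|x - c * s| <= C / q * s := hC n n0.
have hy : `|y - d * s| <= D / q * s := hD n n0.
have s0 : 0 < s by apply: GH_gt0.
rewrite -/x -/y -/q.
have e1 : D / q <= d / 2.
  rewrite ler_pdivrMr //; move: qD; rewrite ler_pdivrMr // => h; lra.
have hy2 : d / 2 * s <= y.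
  have : D / q * s <= d / 2 * s by rewrite ler_wpM2r // ltW.
  move: hy; rewrite ler_norml => /andP[]; lra.
have y0 : 0 < y by apply: lt_le_trans hy2; rewrite mulr_gt0 // divr_gt0.
split=> //.
have -> : x / y - c / d = ((x - c * s) - c / d * (y - d * s)) / y.
  by field; lra.
rewrite normrM normfV (gtr0_norm y0) ler_pdivrMr //.
apply: le_trans (_ : (C / q * s + `|c| / d * (D / q * s)) <= _).
  apply: le_trans (ler_normB _ _) _; apply: lerD => //.
  rewrite normrM normrM normfV (gtr0_norm d0).
  by rewrite ler_wpM2l // divr_ge0 // ltW.
have -> : C / q * s + `|c| / d * (D / q * s) = (C + `|c| / d * D) * (2 / d) / q * (d / 2 * s).
  by field; lra.
by rewrite ler_wpM2l // divr_ge0 // ltW.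
Qed.

End Smoothing.

(** * Edge sequences and their components *)

Section Components.
Variables (n : nat) (M : 'M[nat]_n).
Hypothesis Msym : forall x y, M x y = M y x.
Implicit Types x y u v : 'I_n.

Definition component x : {set 'I_n} := [set y | connect (adj M) x y].

Lemma adj_sym : symmetric (adj M).
Proof. by move=> x y; rewrite /adj /= Msym. Qed.

Lemma adj_connect_sym : connect_sym (adj M).
Proof. by apply: sym_connect_sym; exact: adj_sym. Qed.

Lemma component_refl x : x \in component x.
Proof. by rewrite inE connect0. Qed.

Lemma component_eq x y : y \in component x -> component y = component x.
Proof.
rewrite inE => xy; apply/setP => z; rewrite !inE.
by rewrite (same_connect adj_connect_sym xy).
Qed.

Lemma component_sym x y : (y \in component x) = (x \in component y).
Proof. by rewrite !inE adj_connect_sym. Qed.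

Lemma component_eqE x y : (component x == component y) = (x \in component y).
Proof.
apply/eqP/idP => [<-|/component_eq //]; exact: component_refl.
Qed.

Lemma componentsE : components M = [set component x | x : 'I_n].
Proof.
have e x : component x = [set y in [set: 'I_n] | connect (adj M) x y].
  by apply/setP => y; rewrite !inE.
by apply/setP => C; apply/imsetP/imsetP => -[x _ ->]; exists x; rewrite ?e.
Qed.

Lemma mem_components x : component x \in components M.
Proof. by rewrite componentsE imset_f. Qed.

Lemma componentsP C : reflect (exists x, C = component x) (C \in components M).
Proof.
rewrite componentsE; apply: (iffP imsetP) => [[x _ ->]|[x ->]]; first by exists x.
by exists x.
Qed.

Lemma components_mem C x : C \in components M -> x \in C -> C = component x.
Proof. by move=> /componentsP[y ->] /component_eq. Qed.

Lemma adj_component x y : (0 < M x y)%N -> y \in component x.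
Proof. by move=> h; rewrite inE connect1. Qed.

End Components.

Section AddEdge.
Variables (n : nat) (M : 'M[nat]_n).
Hypothesis Msym : forall x y, M x y = M y x.
Implicit Types x y u v : 'I_n.

Lemma add_edge_sym x y u v : add_edge M x y u v = add_edge M x y v u.
Proof. by rewrite !mxE Msym orbC [(v == y) && _]andbC [(v == x) && _]andbC. Qed.

Lemma add_edgeC x y : add_edge M x y = add_edge M y x.
Proof. by apply/matrixP => u v; rewrite !mxE orbC. Qed.

Lemma adj_add x y u v : adj (add_edge M x y) u v =
  [|| adj M u v, (u == x) && (v == y) | (u == y) && (v == x)].
Proof. by rewrite /adj /= mxE addn_gt0 lt0b. Qed.

Let B x y := component M x :|: component M y.

Lemma connect_add_sub x y u v :
  connect (adj M) u v -> connect (adj (add_edge M x y)) u v.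
Proof.
apply: connect_sub => a b h; apply: connect1; rewrite adj_add.
by move: h => ->.
Qed.

(** [B x y] is closed under the new adjacency, and all of it is reachable from x. *)
Lemma component_add_in x y u : u \in B x y -> component (add_edge M x y) u = B x y.
Proof.
move=> uB.
have cl : fingraph.closed (adj (add_edge M x y)) (mem (B x y)).
  apply: intro_closed.
    exact: adj_connect_sym (add_edge_sym x y).
  move=> a b; rewrite adj_add => /or3P[ab|/andP[/eqP-> /eqP->]|/andP[/eqP-> /eqP->]].
  - rewrite !inE => /orP[] h; apply/orP; [left|right];
      by apply: connect_trans h _; apply: connect1.
  - by move=> _; rewrite !inE connect0 orbT.
  - by move=> _; rewrite !inE connect0.
have xy : connect (adj (add_edge M x y)) x y.
  by apply: connect1; rewrite adj_add !eqxx orbT.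
have sy := adj_connect_sym (add_edge_sym x y).
have inx v : v \in B x y -> connect (adj (add_edge M x y)) x v.
  rewrite !inE => /orP[/connect_add_sub//|/connect_add_sub h].
  by apply: connect_trans xy (h _ _).
apply/setP => v; rewrite inE; apply/idP/idP => [h|vB].
  have e : (u \in B x y) = (v \in B x y) := closed_connect cl h.
  by rewrite -e.
by apply: connect_trans (inx _ vB); rewrite sy; apply: inx.
Qed.

Lemma component_add_out x y u : u \notin B x y -> component (add_edge M x y) u = component M u.
Proof.
move=> uB; apply/setP => v; rewrite !inE; apply/idP/idP; last exact: connect_add_sub.
have cl : fingraph.closed (adj (add_edge M x y)) (mem (component M u)).
  apply: intro_closed.
    exact: adj_connect_sym (add_edge_sym x y).
  move=> a b; rewrite adj_add => /or3P[ab|/andP[/eqP-> /eqP->]|/andP[/eqP-> /eqP->]] h.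
  - by move: h; rewrite !inE => h; apply: connect_trans h _; apply: connect1.
  - by move: uB; rewrite inE negb_or -(component_sym Msym) h.
  - by move: uB; rewrite inE negb_or andbC -(component_sym Msym) h.
move=> h; have e : (u \in component M u) = (v \in component M u) := closed_connect cl h.
by move: e; rewrite !inE connect0 => <-.
Qed.

(** One formula for both cases: if x and y already share a component, [B x y] is that component,
    deleted and put back. *)
Lemma components_add x y :
  components (add_edge M x y) = B x y |: (components M :\ component M x :\ component M y).
Proof.
apply/setP => C; rewrite !inE; apply/idP/idP.
  case/componentsP => u ->; have [uB|uB] := boolP (u \in B x y).
    by rewrite component_add_in // eqxx.
  rewrite component_add_out // mem_components !(component_eqE Msym) andbT.
  by move: uB; rewrite inE negb_or => /andP[-> ->]; rewrite orbT.
case/orP => [/eqP->|/and3P[Cy Cx /componentsP[u Cu]]].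
  apply/componentsP; exists x; rewrite component_add_in //.
  by rewrite inE component_refl.
apply/componentsP; exists u; rewrite component_add_out //.
by rewrite inE negb_or -!(component_eqE Msym) -Cu Cx Cy.
Qed.

End AddEdge.

Section EdgeSequences.
Variables (m n : nat).

(* A multigraph with m edges is represented by the sequences of ordered pairs
   that list its edges; [M] has [2 ^ m * m`! * kappa M] of them (card_fibre), so
   that uniform sequences produce both random models. *)
Definition edge_seq := {ffun 'I_m -> 'I_n * 'I_n}.
Implicit Types f : edge_seq.

Definition joins (p : 'I_n * 'I_n) i j := (p == (i, j)) || (p == (j, i)).

Definition mgraph f : 'M[nat]_n := \matrix_(i, j) (\sum_e joins (f e) i j)%N.

Lemma hitC p i j : joins p i j = joins p j i.
Proof. by rewrite /joins orbC. Qed.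

Lemma mgraph_sym f x y : mgraph f x y = mgraph f y x.
Proof. by rewrite !mxE; apply: eq_bigr => e _; rewrite hitC. Qed.

Lemma mgraph_gt0 f x y : (0 < mgraph f x y)%N = [exists e, joins (f e) x y].
Proof.
rewrite mxE lt0n sum_nat_eq0 negb_forall; apply: eq_existsb => e.
by rewrite eqb0 negbK.
Qed.

Definition edges_inside f (C : {set 'I_n}) := #|[set e | (f e).1 \in C & (f e).2 \in C]|.

(** Only one orientation of an edge falls in the triangle x <= y, and a loop meets it once; hence
    the reduction to p.1 <= p.2. *)
Lemma sum_hit (C : {set 'I_n}) p :
  (\sum_(x in C) \sum_(y in C | x <= y) joins p x y = (p.1 \in C) && (p.2 \in C))%N.
Proof.
wlog le12 : p / (p.1 <= p.2)%N => [hw|].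
  have [le12|lt21] := leqP p.1 p.2; first exact: hw.
  have := hw (p.2, p.1) (ltnW lt21); rewrite andbC /= => <-.
  apply: eq_bigr => x _; apply: eq_bigr => y _; congr nat_of_bool.
  by case: p {lt21} => a b; rewrite /joins /= orbC !xpair_eqE [(a == y) && _]andbC [(a == x)
    && _]andbC.
case: p le12 => a b /= ab.
have [aC|aC] := boolP (a \in C); last first.
  rewrite big1 // => x xC; rewrite big1 // => y /andP[yC _].
  apply/eqP; rewrite eqb0 /joins !xpair_eqE negb_or !negb_and.
  have ax : a != x by apply: contraNneq aC => ->.
  by have ay : a != y by [apply: contraNneq aC => ->]; rewrite ax ay.
have [bC|bC] := boolP (b \in C); last first.
  rewrite big1 // => x xC; rewrite big1 // => y /andP[yC _].
  apply/eqP; rewrite eqb0 /joins !xpair_eqE negb_or !negb_and.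
  have bx : b != x by apply: contraNneq bC => ->.
  by have bY : b != y by [apply: contraNneq bC => ->]; rewrite bx bY !orbT.
rewrite (bigD1 a) //= (bigD1 b) /=; last by rewrite bC.
rewrite /joins eqxx big1 ?add0n ?addn0; last first.
  move=> y /andP[/andP[yC ay] yb]; apply/eqP; rewrite eqb0 !xpair_eqE eqxx /=.
  rewrite eq_sym (negbTE yb) /=; apply: contra yb => /andP[/eqP <- /eqP ->].
  by [].
rewrite big1 ?addn0 // => x /andP[xC xa]; rewrite big1 // => y /andP[yC xy].
apply/eqP; rewrite eqb0 !xpair_eqE eq_sym (negbTE xa) /=.
apply: contra xa => /andP[/eqP ay /eqP bx]; apply/eqP/val_inj/eqP => /=.
by rewrite eqn_leq -{1}bx {1}ay; move: ab xy; rewrite bx ay => -> ->.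
Qed.

Lemma edges_in_mgraph f C : edges_in (mgraph f) C = edges_inside f C.
Proof.
rewrite /edges_in /edges_inside -sum1_card.
transitivity (\sum_(x in C) \sum_(y in C | (x <= y)%N) \sum_e joins (f e) x y)%N.
  by apply: eq_bigr => x _; apply: eq_bigr => y _; rewrite mxE.
under eq_bigr do rewrite exchange_big.
rewrite exchange_big /= [RHS]big_mkcond; apply: eq_bigr => e _.
by rewrite sum_hit inE; case: (_ && _).
Qed.

End EdgeSequences.

Definition pemb n (S : {set 'I_n}) (p : 'I_#|S| * 'I_#|S|) : 'I_n * 'I_n :=
  (enum_val p.1, enum_val p.2).

Lemma pemb_inj n (S : {set 'I_n}) : injective (@pemb n S).
Proof. by move=> [a b] [c d] [/enum_val_inj-> /enum_val_inj->]. Qed.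

Lemma enum_valE n (S : {set 'I_n}) x : x \in S -> exists i : 'I_#|S|, x = enum_val i.
Proof. by move=> xS; exists (enum_rank_in xS x); rewrite enum_rankK_in. Qed.

(** * Splitting an edge sequence along a union of components *)

Section Restriction.
Variables (m n : nat) (f : edge_seq m n) (S : {set 'I_n}) (A : {set 'I_m}).
Variable f1 : edge_seq #|A| #|S|.
Hypothesis f_in : forall i, f (enum_val i) = pemb (f1 i).
Hypothesis f_out : forall e, e \notin A -> (f e).1 \notin S /\ (f e).2 \notin S.
Local Notation emb := (@enum_val _ (mem S)).
Local Notation M := (mgraph f).
Local Notation M1 := (mgraph f1).

Lemma restr_hit e x y : joins (f e) x y -> x \in S -> (e \in A) && (y \in S).
Proof.
have [eA|/f_out [u1 u2]] := boolP (e \in A).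
  have [i ->] := enum_valE eA; rewrite f_in => h _.
  by case/orP: h => /eqP[]; [move=> _ <-|move=> <- _]; apply: enum_valP.
by rewrite /joins; case/orP => /eqP fe; move: u1 u2; rewrite fe /= => /negbTE h1 /negbTE h2;
  rewrite ?h1 ?h2.
Qed.

Lemma restr_closed x y : (0 < M x y)%N -> x \in S -> y \in S.
Proof. by rewrite mgraph_gt0 => /existsP[e /restr_hit h] /h /andP[]. Qed.

Lemma mgraph_restr x y : M (enum_val x) (enum_val y) = M1 x y.
Proof.
rewrite !mxE (bigID (mem A)) /= [X in (_ + X)%N]big1 ?addn0; last first.
  move=> e eA; apply/eqP; rewrite eqb0; apply: contra eA => /restr_hit.
  by move=> /(_ (enum_valP x)) /andP[].
rewrite big_enum_val; apply: eq_bigr => i _; congr nat_of_bool.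
rewrite /joins f_in; have e a b : (enum_val a, enum_val b) = @pemb n S (a, b) by [].
by rewrite !e !(inj_eq (@pemb_inj _ _)).
Qed.

(** A path that starts in S cannot leave it, because no edge joins S to its complement. *)
Lemma component_restr x : component M (enum_val x) = emb @: component M1 x.
Proof.
apply/setP => y; apply/idP/imsetP => [|[z + ->]]; rewrite !inE.
  move=> /connectP[p]; elim/last_ind: p y => [|p z IH] y /=.
    by move=> _ ->; exists x => //; rewrite inE connect0.
  rewrite rcons_path last_rcons => /andP[px lz] ->.
  have [w + wE] := IH _ px erefl; rewrite inE => xw.
  move: lz; rewrite wE /= => h.
  have [z' z'E] := enum_valE (restr_closed h (enum_valP w)).
  exists z'; rewrite // inE; apply: connect_trans xw _; apply: connect1.
  by rewrite /adj /= -mgraph_restr -z'E.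
move=> /connectP[p]; elim/last_ind: p z => [|p w IH] z /=.
  by move=> _ ->.
rewrite rcons_path last_rcons => /andP[px lw] ->.
apply: connect_trans (IH _ px erefl) _; apply: connect1.
by rewrite /adj /= mgraph_restr.
Qed.

Lemma edges_inside_restr (C : {set 'I_#|S|}) : edges_inside f (emb @: C) = edges_inside f1 C.
Proof.
rewrite /edges_inside -(card_imset _ (@enum_val_inj _ (mem A))).
have me a : (enum_val a \in emb @: C) = (a \in C).
  by rewrite mem_imset //; exact: enum_val_inj.
apply: eq_card => e; rewrite inE; apply/idP/imsetP => [|[i + ->]]; last first.
  by rewrite inE f_in /= !me.
have [eA|/f_out [/negP u1 _]] := boolP (e \in A); last first.
  by case/andP => /imsetP[z _ zE]; case: u1; rewrite zE; exact: enum_valP.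
have [i ->] := enum_valE eA; rewrite f_in /= !me => h.
by exists i => //; rewrite inE.
Qed.

Lemma components_restr C :
  (C \in (fun D : {set _} => emb @: D) @: components M1) =
    (C \in components M) && (C \subset S).
Proof.
apply/imsetP/andP => [[D /componentsP[x ->] ->]|[/componentsP[x ->] xS]].
  rewrite -component_restr mem_components; split=> //.
  by rewrite component_restr; apply/fintype.subsetP => y /imsetP[z _ ->]; exact: enum_valP.
have [z zE] := enum_valE (fintype.subsetP xS _ (component_refl M x)).
by exists (component M1 z); rewrite ?mem_components // zE component_restr.
Qed.

Lemma card_restr (P : {set 'I_n} -> bool) :
  #|[set C in components M | (C \subset S) && P C]| =
  #|[set D in components M1 | P (emb @: D)]|.
Proof.
rewrite -(card_imset _ (imset_inj (@enum_val_inj _ (mem S)))).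
apply: eq_card => C; rewrite !inE andbA -components_restr.
apply/andP/imsetP => [[/imsetP[D hD ->] PD]|[D + ->]].
  by exists D; rewrite // inE hD.
by rewrite inE => /andP[hD PD]; split=> //; apply: imset_f.
Qed.

End Restriction.

Section Glue.
Variables (m n : nat) (S : {set 'I_n}) (A : {set 'I_m}).

Let notinC (e : 'I_m) : e \notin A -> e \in ~: A.
Proof. by rewrite inE. Qed.

(** [enum_rank_in] wants a proof of membership, hence the match on a decision instead of a boolean
    test. *)
Definition glue_seq (f1 : edge_seq #|A| #|S|) (f2 : edge_seq #|~: A| #|~: S|) :
  edge_seq m n := [ffun e =>
  match decP (@idP (e \in A)) with
  | left h => pemb (f1 (enum_rank_in h e))
  | right h => pemb (f2 (enum_rank_in (notinC (introN idP h)) e))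
  end].

Lemma glueL (f1 : edge_seq #|A| #|S|) (f2 : edge_seq #|~: A| #|~: S|) i :
  glue_seq f1 f2 (enum_val i) = pemb (f1 i).
Proof.
rewrite ffunE; case: decP => h; last by case: h; exact: enum_valP.
by rewrite (_ : enum_rank_in _ _ = i) //; exact: enum_valK_in.
Qed.

Lemma glueR (f1 : edge_seq #|A| #|S|) (f2 : edge_seq #|~: A| #|~: S|) i :
  glue_seq f1 f2 (enum_val i) = pemb (f2 i).
Proof.
rewrite ffunE; case: decP => h; first by have := enum_valP i; rewrite inE h.
by rewrite (_ : enum_rank_in _ _ = i) //; exact: enum_valK_in.
Qed.

Definition respects (f : edge_seq m n) := [forall e,
  if e \in A then ((f e).1 \in S) && ((f e).2 \in S)
  else ((f e).1 \notin S) && ((f e).2 \notin S)].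

Lemma glue_respects (f1 : edge_seq #|A| #|S|) (f2 : edge_seq #|~: A| #|~: S|) :
  respects (glue_seq f1 f2).
Proof.
apply/forallP => e; case: ifPn => eA.
  by have [i ->] := enum_valE eA; rewrite glueL /= !enum_valP.
have [i ->] := enum_valE (notinC eA); rewrite glueR /=.
by have := enum_valP (f2 i).1; have := enum_valP (f2 i).2; rewrite !inE => -> ->.
Qed.

Lemma glue_outL (f1 : edge_seq #|A| #|S|) (f2 : edge_seq #|~: A| #|~: S|) e : e \notin A ->
  (glue_seq f1 f2 e).1 \notin S /\ (glue_seq f1 f2 e).2 \notin S.
Proof.
move=> eA; have := glue_respects f1 f2 => /forallP/(_ e).
by rewrite (negbTE eA) => /andP.
Qed.

Lemma glue_outR (f1 : edge_seq #|A| #|S|) (f2 : edge_seq #|~: A| #|~: S|) e : e \notin ~: A ->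
  (glue_seq f1 f2 e).1 \notin ~: S /\ (glue_seq f1 f2 e).2 \notin ~: S.
Proof.
rewrite inE negbK => eA; have := glue_respects f1 f2 => /forallP/(_ e).
by rewrite eA !inE !negbK => /andP.
Qed.

Lemma glue_inj (f1 : edge_seq #|A| #|S|) (f2 : edge_seq #|~: A| #|~: S|) f1' f2' :
  glue_seq f1 f2 = glue_seq f1' f2' -> f1 = f1' /\ f2 = f2'.
Proof.
move=> h; split; apply/ffunP => i.
  have := congr1 (fun g : edge_seq m n => g (enum_val i)) h.
  by rewrite !glueL => /pemb_inj.
have := congr1 (fun g : edge_seq m n => g (enum_val i)) h.
by rewrite !glueR => /pemb_inj.
Qed.

Lemma glue_surj f : respects f -> exists f1 f2, f = glue_seq f1 f2.
Proof.
move=> /forallP r.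
have h1 (i : 'I_#|A|) : exists p : 'I_#|S| * 'I_#|S|, f (enum_val i) = pemb p.
  have := r (enum_val i); rewrite enum_valP => /andP[/enum_valE [a ha] /enum_valE [b hb]].
  by exists (a, b); rewrite /pemb /= -ha -hb -surjective_pairing.
have h2 (i : 'I_#|~: A|) : exists p : 'I_#|~: S| * 'I_#|~: S|, f (enum_val i) = pemb p.
  have := r (enum_val i); have := enum_valP i; rewrite inE => /negbTE -> /=.
  rewrite -!finset.in_setC => /andP[/enum_valE [a ha] /enum_valE [b hb]].
  by exists (a, b); rewrite /pemb /= -ha -hb -surjective_pairing.
have [g1 hg1] := choice h1; have [g2 hg2] := choice h2.
exists (finfun g1), (finfun g2); apply/ffunP => e.
have [eA|eA] := boolP (e \in A).
  by have [i ->] := enum_valE eA; rewrite glueL ffunE hg1.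
by have [i ->] := enum_valE (notinC eA); rewrite glueR ffunE hg2.
Qed.

Lemma sum_glue (R : nmodType) (F : edge_seq m n -> R) :
  \sum_(f | respects f) F f = \sum_f1 \sum_f2 F (glue_seq f1 f2).
Proof.
rewrite pair_big /=.
transitivity (\sum_(f in (fun p => glue_seq p.1 p.2) @: predT) F f).
  apply: eq_bigl => f; apply/idP/imsetP => [/glue_surj [f1 [f2 ->]]|[[f1 f2] _ ->]].
    by exists (f1, f2).
  exact: glue_respects.
rewrite big_imset //=.
by move=> [f1 f2] [g1 g2] _ _ /= /glue_inj [-> ->].
Qed.

End Glue.

(** * Excess classes and the pointing decomposition *)

Section Predicates.
Variables (m n : nat).
Implicit Types f : edge_seq m n.

Definition connected_seq f := (0 < n)%N && [forall x, forall y, connect (adj (mgraph f)) x y].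

Definition simpleb f :=
  [forall x, mgraph f x x == 0%N] && [forall x, forall y, (mgraph f x y <= 1)%N].

(* [s] selects the model: [true] for simple graphs, [false] for multigraphs. *)
Definition admissible (s : bool) f := s ==> simpleb f.

(** Edge counts behave well under gluing, cycles do not so readily; [no_acyclicE] identifies this
    with [no_acyclic_component]. *)
Definition no_tree f := [forall C in components (mgraph f), (#|C| <= edges_inside f C)%N].

Definition in_class (c : nat -> nat) f :=
  no_tree f && `[< forall j, (0 < j)%N -> ncomp (mgraph f) j = c j >].

Definition has_excess f x j :=
  edges_inside f (component (mgraph f) x) == (#|component (mgraph f) x| + j)%N.

Lemma connected_seqP f : reflect (exists x, component (mgraph f) x =
  [set: 'I_n]%SET) (connected_seq f).
Proof.
apply: (iffP andP) => [[n0 /'forall_forallP h]|[x hx]].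
  by exists (Ordinal n0); apply/setP => y; rewrite !inE h.
split; first by apply: leq_ltn_trans (ltn_ord x).
apply/'forall_forallP => y z.
have hy : component (mgraph f) y = [set: 'I_n]%SET.
  by rewrite -hx; apply: (component_eq (mgraph_sym f)); rewrite hx inE.
by have : z \in component (mgraph f) y by [rewrite hy inE]; rewrite inE.
Qed.

Lemma connected_component f x : connected_seq f -> component (mgraph f) x = [set: 'I_n]%SET.
Proof.
move=> /connected_seqP[y hy]; rewrite -hy; apply: (component_eq (mgraph_sym f)).
by rewrite hy inE.
Qed.

Lemma connected_components f : connected_seq f -> components (mgraph f) = [set [set: 'I_n]%SET].
Proof.
move=> cf; apply/setP => C; rewrite inE; apply/componentsP/eqP.
  by move=> [x ->]; rewrite connected_component.
by move=> ->; case/connected_seqP: (cf) => x hx; exists x.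
Qed.

Lemma edges_inside_setT f : edges_inside f [set: 'I_n]%SET = m.
Proof.
rewrite /edges_inside -[RHS]card_ord; apply: eq_card => e; by rewrite !inE.
Qed.

Lemma ncompE f j :
  ncomp (mgraph f) j = #|[set C in components (mgraph f) | edges_inside f C == (#|C| + j)%N]|.
Proof.
by rewrite /ncomp; apply: eq_card => C; rewrite !inE edges_in_mgraph.
Qed.

(** Phrased as a vanishing count so that [card_glue] applies. *)
Lemma no_treeE f :
  no_tree f = (#|[set C in components (mgraph f) | ~~ (#|C| <= edges_inside f C)%N]| == 0%N).
Proof.
rewrite cards_eq0; apply/'forall_implyP/eqP => [h|/setP h C hC].
  by apply/setP => C; rewrite !inE; apply/negP => /andP[/h ->].
by have := h C; rewrite !inE hC => /negbFE.
Qed.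

End Predicates.

Section GluePredicates.
Variables (m n : nat) (S : {set 'I_n}) (A : {set 'I_m}).
Variables (f1 : edge_seq #|A| #|S|) (f2 : edge_seq #|~: A| #|~: S|).
Local Notation f := (glue_seq f1 f2).

Lemma component_glueL x : component (mgraph f) (enum_val x) =
  (@enum_val _ (mem S)) @: component (mgraph f1) x.
Proof. exact: component_restr (glueL f1 f2) (@glue_outL _ _ _ _ f1 f2) x. Qed.

Lemma component_glueR x : component (mgraph f) (enum_val x) =
  (@enum_val _ (mem (~: S))) @: component (mgraph f2) x.
Proof. exact: component_restr (glueR f1 f2) (@glue_outR _ _ _ _ f1 f2) x. Qed.

Lemma edges_inside_glueL (C : {set _}) :
  edges_inside f ((@enum_val _ (mem S)) @: C) = edges_inside f1 C.
Proof. exact: edges_inside_restr (glueL f1 f2) (@glue_outL _ _ _ _ f1 f2) C. Qed.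

Lemma edges_inside_glueR (C : {set _}) :
  edges_inside f ((@enum_val _ (mem (~: S))) @: C) = edges_inside f2 C.
Proof. exact: edges_inside_restr (glueR f1 f2) (@glue_outR _ _ _ _ f1 f2) C. Qed.

Lemma connected_glue x : x \in S -> (component (mgraph f) x == S) = connected_seq f1.
Proof.
move=> /enum_valE[y ->]; rewrite component_glueL.
have SE : (@enum_val _ (mem S)) @: [set: 'I_#|S|]%SET = S.
  apply/setP => z; apply/imsetP/idP => [[w _ ->]|/enum_valE[w ->]]; first exact: enum_valP.
  by exists w.
rewrite -[X in _ == X]SE (inj_eq (imset_inj (@enum_val_inj _ (mem S)))).
apply/eqP/idP => [h|cf]; first by apply/connected_seqP; exists y.
exact: connected_component.
Qed.

Lemma glue_cross x y : x \in S -> y \notin S -> mgraph f x y = 0%N.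
Proof.
move=> xS; apply: contraNeq; rewrite -lt0n => h.
exact: (restr_closed (glueL f1 f2) (@glue_outL _ _ _ _ f1 f2) h xS).
Qed.

Lemma mgraph_glueL x y : mgraph f (enum_val x) (enum_val y) = mgraph f1 x y.
Proof. exact: (mgraph_restr (glueL f1 f2) (@glue_outL _ _ _ _ f1 f2)). Qed.

Lemma mgraph_glueR x y : mgraph f (enum_val x) (enum_val y) = mgraph f2 x y.
Proof. exact: (mgraph_restr (glueR f1 f2) (@glue_outR _ _ _ _ f1 f2)). Qed.

Lemma setCE (x : 'I_n) : x \notin S -> exists y : 'I_#|~: S|, x = enum_val y.
Proof. by rewrite -finset.in_setC => /enum_valE. Qed.

Lemma simpleb_glue : simpleb f = simpleb f1 && simpleb f2.
Proof.
apply/andP/andP => [[/forallP h1 /'forall_forallP h2]|].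
  split; apply/andP; split; apply/forallP => x.
  - by rewrite -mgraph_glueL.
  - by apply/forallP => y; rewrite -mgraph_glueL.
  - by rewrite -mgraph_glueR.
  - by apply/forallP => y; rewrite -mgraph_glueR.
move=> [/andP[/forallP a1 /'forall_forallP a2] /andP[/forallP b1 /'forall_forallP b2]].
split; apply/forallP => x.
  have [/enum_valE[y ->]|/setCE[y ->]] := boolP (x \in S).
    by rewrite mgraph_glueL.
  by rewrite mgraph_glueR.
apply/forallP => y.
have [xS|xS] := boolP (x \in S); have [yS|yS] := boolP (y \in S).
- have [x' ->] := enum_valE xS; have [y' ->] := enum_valE yS.
  by rewrite mgraph_glueL.
- by rewrite glue_cross.
- by rewrite mgraph_sym glue_cross.
have [x' ->] := setCE xS; have [y' ->] := setCE yS.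
by rewrite mgraph_glueR.
Qed.

Lemma admissible_glue s : admissible s f = admissible s f1 && admissible s f2.
Proof. by rewrite /admissible simpleb_glue; case: s. Qed.

Lemma components_glue C : C \in components (mgraph f) -> (C \subset S) = ~~ (C \subset ~: S).
Proof.
move=> /componentsP[x ->]; have xx := component_refl (mgraph f) x.
have [xS|xS] := boolP (x \in S).
  have -> : component (mgraph f) x \subset S.
    have [y ->] := enum_valE xS; rewrite component_glueL.
    by apply/fintype.subsetP => z /imsetP[w _ ->]; exact: enum_valP.
  by apply/esym/negP => /fintype.subsetP/(_ _ xx); rewrite inE xS.
have -> : component (mgraph f) x \subset ~: S.
  have [y ->] := setCE xS; rewrite component_glueR.
  by apply/fintype.subsetP => z /imsetP[w _ ->]; exact: enum_valP.
by apply/negP => /fintype.subsetP/(_ _ xx); apply/negP.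
Qed.

Lemma card_glue (P : {set 'I_n} -> bool) :
  #|[set C in components (mgraph f) | P C]| =
  (#|[set D in components (mgraph f1) | P ((@enum_val _ (mem S)) @: D)]| +
   #|[set D in components (mgraph f2) | P ((@enum_val _ (mem (~: S))) @: D)]|)%N.
Proof.
rewrite -(card_restr (glueL f1 f2) (@glue_outL _ _ _ _ f1 f2)).
rewrite -(card_restr (glueR f1 f2) (@glue_outR _ _ _ _ f1 f2)).
rewrite -(cardsID [set C : {set 'I_n} | C \subset S]); congr (_ + _)%N; apply: eq_card => C;
  rewrite !inE.
  by case: (C \in _); case: (P C); case: (C \subset S).
have [hC|//] := boolP (C \in components (mgraph f)); last by rewrite andbF.
by rewrite components_glue // negbK /=.
Qed.

Lemma ncomp_glue j : ncomp (mgraph f) j = (ncomp (mgraph f1) j + ncomp (mgraph f2) j)%N.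
Proof.
rewrite !ncompE card_glue; congr (_ + _)%N; apply: eq_card => C; rewrite !inE.
  by rewrite edges_inside_glueL card_imset //; exact: enum_val_inj.
by rewrite edges_inside_glueR card_imset //; exact: enum_val_inj.
Qed.

Lemma no_tree_glue : no_tree f = no_tree f1 && no_tree f2.
Proof.
rewrite !no_treeE card_glue addn_eq0; congr (_ && _); congr (_ == _); apply: eq_card => C;
  rewrite !inE.
  by rewrite edges_inside_glueL card_imset //; exact: enum_val_inj.
by rewrite edges_inside_glueR card_imset //; exact: enum_val_inj.
Qed.

Lemma has_excess_glueR y j : has_excess f (enum_val y) j = has_excess f2 y j.
Proof. by rewrite /has_excess component_glueR edges_inside_glueR card_imset //;
  exact: enum_val_inj. Qed.

Lemma has_excess_glueL y j : has_excess f (enum_val y) j = has_excess f1 y j.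
Proof. by rewrite /has_excess component_glueL edges_inside_glueL card_imset //;
  exact: enum_val_inj. Qed.

Lemma has_excess_connected y j : connected_seq f1 -> has_excess f1 y j = (#|A| == #|S| + j)%N.
Proof. by move=> cf; rewrite /has_excess connected_component // edges_inside_setT cardsT
  card_ord. Qed.

(** Index 0 stands for a unicyclic component. Configurations do not record these, so cutting one off
    changes nothing and is always allowed by [can_dec]. *)
Definition dec_config (c : nat -> nat) i j := if (0 < i)%N && (j == i) then (c j).-1 else c j.
Definition can_dec (c : nat -> nat) i := (i == 0%N) || (0 < c i)%N.

Lemma in_class_glue c i : connected_seq f1 -> #|A| = (#|S| + i)%N ->
  in_class c f = can_dec c i && in_class (dec_config c i) f2.
Proof.
move=> cf ai; rewrite /in_class no_tree_glue.
have -> : no_tree f1.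
  apply/'forall_implyP => C; rewrite connected_components // inE => /eqP->.
  by rewrite edges_inside_setT cardsT card_ord ai leq_addr.
have n1 j : ncomp (mgraph f1) j = (i == j).
  rewrite ncompE connected_components //.
  transitivity #|[set C in [set [set: 'I_#|S|]%SET] | i == j]|.
    apply: eq_card => C; rewrite !inE; have [->|//] := eqVneq C [set: 'I_#|S|]%SET.
    by rewrite edges_inside_setT cardsT card_ord ai eqn_add2l.
  have [_|_] := eqVneq i j.
    by rewrite -[RHS](cards1 [set: 'I_#|S|]%SET); apply: eq_card => C; rewrite !inE andbT.
  by apply: eq_card0 => C; rewrite !inE andbF.
rewrite /= [can_dec c i && _]andbCA; congr (_ && _); rewrite /can_dec /dec_config.
apply/asboolP/andP => [h|[h1 /asboolP h2] j j0].
  split; first by have [//|i0] := posnP i; have := h _ i0; rewrite ncomp_glue n1 eqxx => <-.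
  apply/asboolP => j j0; have := h j j0; rewrite ncomp_glue n1 => <-.
  have [ji|ji] := eqVneq j i; last by rewrite andbF.
  by subst i; rewrite j0.
rewrite ncomp_glue n1 h2 //; have [ji|ji] := eqVneq j i; last first.
  by rewrite andbF.
by subst i; move: h1; rewrite j0 (gtn_eqF j0) /=; case: (c j).
Qed.

End GluePredicates.

Lemma mem_component_edge m n (f : edge_seq m n) x e :
  ((f e).1 \in component (mgraph f) x) = ((f e).2 \in component (mgraph f) x).
Proof.
have h : (0 < mgraph f (f e).1 (f e).2)%N.
  by rewrite mgraph_gt0; apply/existsP; exists e; rewrite /joins -surjective_pairing eqxx.
by rewrite !(component_sym (mgraph_sym f) x) (component_eq (mgraph_sym f) (adj_component h)).
Qed.

Lemma respects_component m n (f : edge_seq m n) x :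
  respects (component (mgraph f) x) [set e | (f e).1 \in component (mgraph f) x] f.
Proof.
apply/forallP => e; rewrite inE -mem_component_edge.
by case: (_ \in component _ _).
Qed.

(* [S] is the component of [x] and [A] the set of edges inside it. *)
Lemma pointing (R : nmodType) m n (F : edge_seq m n -> 'I_n -> R) :
  \sum_f \sum_x F f x =
  \sum_(S : {set 'I_n}) \sum_(A : {set 'I_m})
    \sum_(f1 : edge_seq #|A| #|S| | connected_seq f1) \sum_(f2 : edge_seq #|~: A| #|~: S|)
      \sum_(x in S) F (glue_seq f1 f2) x.
Proof.
transitivity (\sum_(S : {set 'I_n}) \sum_(A : {set 'I_m}) \sum_(f | respects S A f)
   \sum_(x in S | component (mgraph f) x == S) F f x); last first.
  apply: eq_bigr => S _; apply: eq_bigr => A _; rewrite sum_glue.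
  rewrite [RHS]big_mkcond; apply: eq_bigr => f1 _.
  case: ifPn => cf1; last first.
    rewrite big1 // => f2 _; rewrite big1 // => x /andP[xS].
    by rewrite connected_glue // (negbTE cf1).
  apply: eq_bigr => f2 _; apply: eq_bigl => x.
  by case: (boolP (x \in S)) => //= xS; rewrite connected_glue.
transitivity (\sum_(S : {set 'I_n}) \sum_f \sum_(x in S | component (mgraph f) x == S) F f x).
  rewrite [RHS]exchange_big /=; apply: eq_bigr => f _.
  rewrite [RHS](exchange_big_dep xpredT) //=; apply: eq_bigr => x _.
  rewrite (big_pred1 (component (mgraph f) x)) // => S /=.
  by rewrite eq_sym; have [<-|] := eqVneq (component (mgraph f) x) S;
    rewrite ?andbF // component_refl.
apply: eq_bigr => S _.
transitivity (\sum_f \sum_(A : {set 'I_m}) if respects S A f then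
    \sum_(x in S | component (mgraph f) x == S) F f x else 0); last first.
  by rewrite exchange_big /=; apply: eq_bigr => A _; rewrite [RHS]big_mkcond.
apply: eq_bigr => f _.
have [x0 /andP[x0S /eqP hx0]|no] :=
  pickP (fun x => (x \in S) && (component (mgraph f) x == S)); last first.
  by rewrite big_pred0 // big1 // => A _; rewrite if_same.
(* Given f and S the edge set is forced: the edges whose first end lies in S. *)
pose A0 := [set e | (f e).1 \in S].
rewrite (bigD1 A0) //= [X in _ + X]big1 ?addr0.
  suff -> : respects S A0 f by [].
  by rewrite /A0 -hx0; exact: respects_component.
move=> A AA0; case: ifP => // /forallP rA; case/eqP: AA0.
apply/setP => e; rewrite !inE; have := rA e.
by case: (e \in A) => /andP[]; [|move=> /negbTE].
Qed.

(** * Counting connected edge sequences *)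

Section Normalised.
Variables (R : realType) (s : bool).

(* Dividing by [2 ^ m * m`! * n`!] turns labelled products into Cauchy products. *)
Definition normalise m n (x : R) : R := x / (2 ^ m * m`! * n`!)%:R.

Definition conn_count m n : R := \sum_(f : edge_seq m n) (connected_seq f && admissible s f)%:R.

Definition conn_weight m n : R := normalise m n (conn_count m n).

Lemma normalise_sum m n I (r : seq I) (P : pred I) (F : I -> R) :
  normalise m n (\sum_(i <- r | P i) F i) = \sum_(i <- r | P i) normalise m n (F i).
Proof. exact: mulr_suml. Qed.

Lemma normaliseM m n c x : normalise m n (c * x) = c * normalise m n x.
Proof. by rewrite /normalise mulrA. Qed.

Lemma normaliseD m n x y : normalise m n (x + y) = normalise m n x + normalise m n y.
Proof. exact: mulrDl. Qed.

Lemma normalise_den_neq0 m n : (2 ^ m * m`! * n`!)%:R != 0 :> R.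
Proof. by rewrite pnatr_eq0 !muln_eq0 !negb_or expn_eq0 -!lt0n !fact_gt0. Qed.

Lemma sum_subsets n (g : nat -> R) :
  \sum_(S : {set 'I_n}) g #|S| = \sum_(a < n.+1) 'C(n, a)%:R * g a.
Proof.
rewrite (partition_big (fun S : {set 'I_n} => inord #|S| : 'I_n.+1) xpredT) //=.
apply: eq_bigr => a _.
have cardS (S : {set 'I_n}) : (#|S| < n.+1)%N by rewrite ltnS -[leqRHS]card_ord max_card.
transitivity (\sum_(S : {set 'I_n} | #|S| == a) g a).
  apply: eq_big => S; first by rewrite -val_eqE /= inordK.
  by move=> /eqP <-; rewrite inordK.
have -> : 'C(n, a) = 'C(#|'I_n|, a) by rewrite card_ord.
rewrite sumr_const -card_draws cardsE mulr_natl.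
by congr (_ *+ _); apply: eq_card => S.
Qed.

(** The binomials distribute the vertex and edge labels over the two parts and are absorbed by the
    factorials, as for exponential generating functions in two variables. *)
Lemma normalise_split m n i a (x y : R) : (i <= m)%N -> (a <= n)%N ->
  normalise m n ('C(n, a)%:R * ('C(m, i)%:R * (x * y))) =
    normalise i a x * normalise (m - i) (n - a) y.
Proof.
move=> im an; rewrite /normalise.
have -> : (2 ^ m * m`! * n`!)%:R = 'C(n, a)%:R * 'C(m, i)%:R *
   ((2 ^ i * i`! * a`!)%:R * (2 ^ (m - i) * (m - i)`! * (n - a)`!)%:R) :> R.
  rewrite -!natrM; congr _%:R.
  by rewrite -(bin_fact im) -(bin_fact an) -{1}(subnKC im) expnD; ring.
have b1 : 'C(n, a)%:R != 0 :> R by rewrite pnatr_eq0 -lt0n bin_gt0.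
have b2 : 'C(m, i)%:R != 0 :> R by rewrite pnatr_eq0 -lt0n bin_gt0.
move: b1 b2 (normalise_den_neq0 i a) (normalise_den_neq0 (m - i) (n - a)).
move: ('C(n, a)%:R) ('C(m, i)%:R) ((2 ^ i * i`! * a`!)%:R : R).
move: ((2 ^ (m - i) * (m - i)`! * (n - a)`!)%:R : R) => v b c u b0 c0 u0 v0.
by field; rewrite b0 c0 u0 v0.
Qed.

(** When the weight factors over the component of x and the rest, the sum depends on the cut only
    through the two sizes and becomes a convolution in both of them. The factor a counts the choices
    of x in its component. *)
Lemma pointing_normalise m n (W : edge_seq m n -> 'I_n -> R) (phi : nat -> nat -> R)
    (Phi : forall m n, edge_seq m n -> R) :
  (forall (S : {set 'I_n}) (A : {set 'I_m})
      (f1 : edge_seq #|A| #|S|) (f2 : edge_seq #|~: A| #|~: S|) x,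
      connected_seq f1 -> x \in S ->
      W (glue_seq f1 f2) x = phi #|S| #|A| * (admissible s f1)%:R * Phi _ _ f2) ->
  normalise m n (\sum_f \sum_x W f x) =
  \sum_(a < n.+1) \sum_(i < m.+1) a%:R * phi a i * conn_weight i a *
     normalise (m - i) (n - a) (\sum_(f2 : edge_seq (m - i) (n - a)) Phi _ _ f2).
Proof.
move=> hW; rewrite pointing.
pose g a i : R := a%:R * phi a i * (conn_count i a * \sum_(f2 :
  edge_seq (m - i) (n - a)) Phi _ _ f2).
transitivity (normalise m n (\sum_(S : {set 'I_n}) \sum_(A : {set 'I_m}) g #|S| #|A|)).
  congr normalise; apply: eq_bigr => S _; apply: eq_bigr => A _.
  have eS : #|~: S| = (n - #|S|)%N by rewrite cardsCs finset.setCK card_ord.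
  have eA : #|~: A| = (m - #|A|)%N by rewrite cardsCs finset.setCK card_ord.
  rewrite /g -eS -eA /conn_count mulr_suml mulr_sumr big_mkcond /=; apply: eq_bigr => f1 _.
  case: ifPn => [c1|_]; last by rewrite mul0r mulr0.
  rewrite !mulr_sumr; apply: eq_bigr => f2 _.
  under eq_bigr do rewrite (hW _ _ _ _ _ c1) //.
  by rewrite sumr_const -mulr_natl /=; ring.
rewrite (@sum_subsets n (fun a => \sum_(A : {set 'I_m}) g a #|A|)) normalise_sum.
apply: eq_bigr => a _; rewrite (@sum_subsets m (g a)) normaliseM normalise_sum mulr_sumr.
apply: eq_bigr => i _; rewrite /g /conn_weight -[RHS]mulrA -normalise_split ?leq_ord //.
by rewrite -!normaliseM; congr normalise; ring.
Qed.

End Normalised.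

(** * Removing an edge from a connected structure *)

Section Extension.
Variables (m n : nat).
Implicit Types (f : edge_seq m n) (p : 'I_n * 'I_n).

Definition edge_cons f p : edge_seq m.+1 n :=
  [ffun i => if unlift ord0 i is Some j then f j else p].

Lemma edge_cons0 f p : edge_cons f p ord0 = p.
Proof. by rewrite ffunE unlift_none. Qed.

Lemma edge_cons_lift f p i : edge_cons f p (lift ord0 i) = f i.
Proof. by rewrite ffunE liftK. Qed.

Lemma mgraph_edge_cons f p : mgraph (edge_cons f p) = add_edge (mgraph f) p.1 p.2.
Proof.
apply/matrixP => i j; rewrite !mxE big_ord_recl edge_cons0 addnC; congr (_ + _)%N.
  by apply: eq_bigr => e _; rewrite edge_cons_lift.
case: p => a b; rewrite /joins !xpair_eqE /=.
by rewrite ![a == _]eq_sym ![b == _]eq_sym [(i == b) && _]andbC.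
Qed.

Lemma sum_edge_cons (R : nmodType) (F : edge_seq m.+1 n -> R) :
  \sum_g F g = \sum_f \sum_p F (edge_cons f p).
Proof.
rewrite pair_big /=.
rewrite (reindex (fun q => edge_cons q.1 q.2)) //=.
exists (fun g => ([ffun j => g (lift ord0 j)], g ord0)) => [[f p] _|g _] /=.
  by rewrite edge_cons0; congr pair; apply/ffunP => j; rewrite ffunE edge_cons_lift.
apply/ffunP => i; rewrite ffunE; case: unliftP => [j ->|->] //=.
by rewrite ffunE.
Qed.

Lemma connected_edge_cons f x y :
  connected_seq (edge_cons f (x, y)) =
    (component (mgraph f) x :|: component (mgraph f) y == [set: 'I_n]%SET).
Proof.
have xB : x \in component (mgraph f) x :|: component (mgraph f) y by rewrite inE component_refl.
have h := component_add_in (mgraph_sym f) xB.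
apply/idP/eqP => [cf|hT]; first by have := @connected_component _ _ _ x cf;
  rewrite mgraph_edge_cons h.
by apply/connected_seqP; exists x; rewrite mgraph_edge_cons h.
Qed.

Lemma simpleb_edge_cons f x y :
  simpleb (edge_cons f (x, y)) = [&& simpleb f, x != y & mgraph f x y == 0%N].
Proof.
rewrite /simpleb mgraph_edge_cons /=; apply/andP/and3P.
  move=> [/forallP h1 /'forall_forallP h2].
  have nxy : x != y.
    by have := h1 x; rewrite mxE eqxx andbT /= orbb; case: (x == y); rewrite ?addn1.
  split=> //.
    apply/andP; split; apply/forallP => u.
      by have := h1 u; rewrite mxE addn_eq0 => /andP[].
    by apply/forallP => v; have := h2 u v; rewrite mxE; apply: leq_trans; exact: leq_addr.
  by have := h2 x y; rewrite mxE !eqxx /= addn1 ltnS leqn0.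
move=> [/andP[/forallP h1 /'forall_forallP h2] nxy /eqP m0].
split; apply/forallP => u.
  rewrite mxE (eqP (h1 u)) add0n eqb0 negb_or; apply/andP.
  by split; apply: contra nxy => /andP[/eqP <- /eqP <-].
apply/forallP => v; rewrite mxE; case: (boolP (_ || _)) => [|_]; last by rewrite addn0.
by case/orP => /andP[/eqP-> /eqP->]; rewrite ?[mgraph f y x]mgraph_sym m0.
Qed.

Lemma sum_mgraph_simple f : simpleb f -> (\sum_x \sum_y mgraph f x y = 2 * m)%N.
Proof.
move=> /andP[/forallP h1 _].
transitivity (\sum_x \sum_y \sum_e joins (f e) x y)%N.
  by apply: eq_bigr => x _; apply: eq_bigr => y _; rewrite mxE.
under eq_bigr do rewrite exchange_big /=.
rewrite exchange_big /=.
transitivity (\sum_(e < m) 2)%N; last by rewrite sum_nat_const card_ord mulnC.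
apply: eq_bigr => e _; case fe : (f e) => [a b].
have nab : a != b.
  apply/negP => /eqP ab; have := h1 a; rewrite mxE sum_nat_eq0 => /forallP/(_ e).
  by rewrite fe ab /joins eqxx.
transitivity (\sum_x \sum_y ((x == a) * (y == b) + (x == b) * (y == a)))%N.
  apply: eq_bigr => x _; apply: eq_bigr => y _; rewrite /joins !xpair_eqE.
  rewrite ![a == _]eq_sym ![b == _]eq_sym.
  have : ~~ ((x == a) && (x == b)).
    by apply: contra nab => /andP[/eqP <- /eqP <-].
  by case: (x == a); case: (x == b); case: (y == a); case: (y == b).
under eq_bigr do rewrite big_split /= -!big_distrr /=.
rewrite big_split /= -!big_distrl /=.
have e1 (c : 'I_n) : (\sum_x (x == c) = 1)%N.
  by rewrite (bigD1 c) //= eqxx big1 ?addn0 // => x /negbTE ->.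
by rewrite !e1.
Qed.

(** For simple graphs the n diagonal pairs and the 2 m ordered pairs of present edges are
    forbidden. *)
Lemma card_admissible_edge_cons s f : admissible s f ->
  (\sum_x \sum_y admissible s (edge_cons f (x, y)) + s * (n + 2 * m) = n ^ 2)%N.
Proof.
have nn : (\sum_(x < n) \sum_(y < n) 1 = n ^ 2)%N.
  by under eq_bigr do rewrite sum1_card card_ord; rewrite sum_nat_const card_ord.
case: s => [|_]; last by rewrite mul0n addn0 -nn.
rewrite /admissible /= => sf; rewrite mul1n -(sum_mgraph_simple sf).
have en : (\sum_(x < n) \sum_(y < n) (x == y) = n)%N.
  transitivity (\sum_(x < n) 1)%N; last by rewrite sum1_card card_ord.
  apply: eq_bigr => x _; rewrite (bigD1 x) //= eqxx big1 ?addn0 // => y.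
  by rewrite eq_sym => /negbTE ->.
transitivity (\sum_x \sum_y simpleb (edge_cons f (x, y)) +
    (\sum_(x < n) \sum_(y < n) (x == y) + \sum_x \sum_y mgraph f x y))%N; first by rewrite en.
rewrite -!big_split /= -nn; apply: eq_bigr => x _.
rewrite -!big_split; apply: eq_bigr => y _; rewrite simpleb_edge_cons sf /=.
case/andP: sf => /forallP h1 /'forall_forallP h2.
have [->|_] := eqVneq x y; first by rewrite (eqP (h1 y)).
by have := h2 x y; case: (mgraph f x y) => [|[]].
Qed.

End Extension.

Section Recurrence.
Variables (R : realType) (s : bool).
Local Notation conn_weight := (@conn_weight R s).

(** Delete the first edge of the sequence: what remains is connected, or consists of two connected
    parts. The factor 2 (m + 1) is the ratio of the two normalisations. *)
Lemma conn_weight_rec m n : 2 * m.+1%:R * conn_weight m.+1 n =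
  ((n ^ 2)%:R - s%:R * (n + 2 * m)%:R) * conn_weight m n +
  \sum_(a < n.+1) \sum_(i < m.+1) (a%:R * conn_weight i a) * ((n - a)%:R *
    conn_weight (m - i) (n - a)).
Proof.
have -> : 2 * m.+1%:R * conn_weight m.+1 n = normalise m n (conn_count R s m.+1 n).
  rewrite /conn_weight /normalise factS expnS !natrM.
  have := @normalise_den_neq0 R m n; rewrite !natrM.
  move: (2 ^ m)%:R (m`!%:R) (n`!%:R) => u v w;
    rewrite !mulf_eq0 !negb_or -andbA => /and3P[u0 v0 w0].
  have m0 : m.+1%:R != 0 :> R by rewrite pnatr_eq0.
  by move: (m.+1%:R : R) m0 => t m0; field; rewrite u0 v0 w0 m0.
rewrite /conn_count sum_edge_cons.
pose g (f : edge_seq m n) (x y : 'I_n) : R :=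
  (connected_seq (edge_cons f (x, y)) && admissible s (edge_cons f (x, y)))%:R.
(* Split by whether the deleted edge (x, y) had both ends in one component; if not, cutting off the
   component of x leaves a connected rest containing y. *)
transitivity (normalise m n (\sum_(f :
  edge_seq m n) \sum_x \sum_(y in component (mgraph f) x) g f x y) +
              normalise m n (\sum_(f : edge_seq m n) \sum_x \sum_(y | y \notin component
                (mgraph f) x) g f x y)).
  rewrite -normaliseD -big_split; congr normalise; apply: eq_bigr => f _.
  rewrite -big_split /=.
  transitivity (\sum_x \sum_y g f x y).
    by rewrite pair_bigA; apply: eq_bigr => -[x y].
  by apply: eq_bigr => x _; rewrite [LHS](bigID (mem (component (mgraph f) x))).
congr (_ + _).
  rewrite -normaliseM; congr normalise; rewrite mulr_sumr; apply: eq_bigr => f _.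
  have [cf|cf] /= := boolP (connected_seq f); last first.
    rewrite mulr0 big1 // => x _; rewrite big1 // => y yx.
    rewrite /g connected_edge_cons (component_eq (mgraph_sym f) yx) finset.setUid.
    case: eqP => // h; by case/connected_seqP: cf; exists x.
  have E x y : g f x y = (admissible s (edge_cons f (x, y)))%:R.
    by rewrite /g connected_edge_cons !connected_component // finset.setUid eqxx.
  have [okf|okf] := boolP (admissible s f); last first.
    rewrite mulr0 big1 // => x _; rewrite big1 // => y _; rewrite E.
    by move: okf; rewrite /admissible simpleb_edge_cons; case: (s) => //= /negbTE ->.
  rewrite mulr1; have := card_admissible_edge_cons okf => /(congr1 (fun k : nat => k%:R : R)).
  rewrite natrD natrM => <-; rewrite addrK natr_sum; apply: eq_bigr => x _.
  by rewrite natr_sum; apply: eq_big => y; rewrite ?connected_component ?inE.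
(* The weight of the second part contains its number of vertices, for the choice of y. *)
rewrite (@pointing_normalise R s m n _ (fun _ _ => 1) (fun m n f2 =>
  n%:R * (connected_seq f2 && admissible s f2)%:R)).
  apply: eq_bigr => a _; apply: eq_bigr => i _; rewrite mulr1; congr (_ * _).
  by rewrite -mulr_sumr normaliseM.
move=> S A f1 f2 x c1 xS.
have cx : component (mgraph (glue_seq f1 f2)) x = S by apply/eqP; rewrite connected_glue.
have E y : y \notin component (mgraph (glue_seq f1 f2)) x -> g (glue_seq f1 f2) x y =
    (admissible s f1)%:R * (connected_seq f2 && admissible s f2)%:R.
  rewrite cx => yS; rewrite /g connected_edge_cons cx.
  have -> : admissible s (edge_cons (glue_seq f1 f2) (x, y)) =
    admissible s f1 && admissible s f2.
    rewrite -admissible_glue /admissible simpleb_edge_cons glue_cross // eqxx andbT.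
    by have -> : x != y by [apply: contraNneq yS => <-]; rewrite andbT.
  have -> : (S :|: component (mgraph (glue_seq f1 f2)) y == [set: 'I_n]%SET) = connected_seq f2.
    have [z ->] := setCE yS; rewrite component_glueR.
    apply/eqP/idP => [h|c2].
      apply/connected_seqP; exists z; apply/setP => w; rewrite finset.in_setT.
      have : enum_val w \in [set: 'I_n]%SET by [].
      have := enum_valP w; rewrite -h !inE => /negbTE -> /=.
      by rewrite mem_imset ?inE //; exact: enum_val_inj.
    rewrite connected_component //; apply/setP => w; rewrite !inE.
    have [//|/setCE[w' ->]] := boolP (w \in S).
    by apply/imsetP; exists w'.
  by rewrite -natrM mulnb andbCA.
transitivity (\sum_(y in ~: S) (admissible s f1)%:R *
  (connected_seq f2 && admissible s f2)%:R : R).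
  by apply: eq_big => // y; rewrite cx inE.
by rewrite sumr_const -[LHS]mulr_natl; ring.
Qed.

Lemma conn_weight_n0 m : conn_weight m 0 = 0.
Proof. by rewrite /conn_weight /conn_count big1 /normalise ?mul0r. Qed.

Lemma conn_weight_0n n : conn_weight 0 n = (n == 1%N)%:R.
Proof.
case: n => [|[|n]]; first by rewrite conn_weight_n0.
  rewrite /conn_weight /conn_count.
  have h (f : edge_seq 0 1) : connected_seq f && admissible s f.
    apply/andP; split.
      by apply/andP; split=> //; apply/'forall_forallP => x y; rewrite !ord1 connect0.
    have m0 x y : mgraph f x y = 0%N by rewrite mxE big_ord0.
    apply/implyP => _; apply/andP; split; first by apply/forallP => x; rewrite m0.
    by apply/'forall_forallP => x y; rewrite m0.
  under eq_bigr do rewrite h.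
  by rewrite sumr_const card_ffun card_ord expn0 /normalise /= divr1.
rewrite /conn_weight /conn_count big1 ?/normalise ?mul0r // => f _.
suff /negbTE -> : ~~ connected_seq f by [].
apply/connected_seqP => -[x hx].
have h1 y : y = x.
  have : y \in component (mgraph f) x by rewrite hx inE.
  rewrite inE => /connectP[[|z p]] /=; first by [].
  by rewrite /adj /= mxE big_ord0.
by have := h1 ord_max; rewrite -(h1 ord0) => /(congr1 val).
Qed.

Lemma conn_weight_ge0 m n : 0 <= conn_weight m n.
Proof. by rewrite divr_ge0 // ?ler0n // sumr_ge0 // => f _; rewrite ler0n. Qed.

(** A connected graph has at least n - 1 edges; by induction each term on the right of the
    recurrence has a factor violating this. *)
Lemma conn_weight_eq0 m n : (m.+1 < n)%N -> conn_weight m n = 0.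
Proof.
elim/ltn_ind: m n => -[|m] IH n mn; first by rewrite conn_weight_0n; case: n mn => [|[|]].
have : 2 * m.+1%:R * conn_weight m.+1 n = 0; last first.
  have c0 : 2 * m.+1%:R != 0 :> R by rewrite mulf_neq0 // pnatr_eq0.
  by move=> h; apply: (mulfI c0); rewrite h mulr0.
rewrite conn_weight_rec IH ?mulr0 ?add0r ?big1 //; last by lia.
move=> a _; rewrite big1 // => i _.
have := ltn_ord a; have := ltn_ord i => hi ha.
have [h|h] := ltnP i.+1 a; first by rewrite IH // ?mulr0 ?mul0r.
by rewrite [conn_weight (m - i) _]IH ?mulr0 //; lia.
Qed.

(* [conn_series k] counts the connected structures with [k - 1] more edges than
   vertices: trees for [k = 0], unicyclic ones for [k = 1]. *)
Definition conn_series k : fps R := fun n => if n == 0%N then 0 else conn_weight (n + k).-1 n.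
Local Notation Y := conn_series.

Lemma conn_weight_conv m n K : (m + 2 = n + K)%N ->
  \sum_(a < n.+1) \sum_(i < m.+1) (a%:R * conn_weight i a) * ((n - a)%:R *
    conn_weight (m - i) (n - a)) =
  (\sum_(p < K.+1) theta (Y p) * theta (Y (K - p))) n.
Proof.
move=> mnK; rewrite fps_sum; under [RHS]eq_bigr do rewrite fpsM.
rewrite [RHS]exchange_big /=; apply: eq_bigr => -[a /= an] _.
have [->|a0] := posnP a.
  by rewrite !big1 // => i _; rewrite ?/theta ?mul0r ?mul0r.
have [na|na] := leqP n a.
  have -> : (n - a = 0)%N by apply/eqP; rewrite subn_eq0.
  by rewrite !big1 // => i _; rewrite ?/theta ?mul0r ?mulr0.
rewrite -(big_mkord xpredT (fun i =>
  (a%:R * conn_weight i a) * ((n - a)%:R * conn_weight (m - i) (n - a)))).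
(* Both factors vanish below the number of edges of a tree, so only a - 1 <= i < a + K remains, and
   p = i - (a - 1) is the index of [conn_series]. *)
rewrite (@big_cat_nat _ _ _ a.-1) //=; last by lia.
rewrite [X in X + _]big_nat [X in X + _]big1 ?add0r; last first.
  by move=> i hi; rewrite conn_weight_eq0 ?mulr0 ?mul0r //; lia.
rewrite (@big_cat_nat _ _ _ (a + K)) //=; [|by lia|by lia].
rewrite [X in _ + X]big_nat [X in _ + X]big1 ?addr0; last first.
  by move=> i hi; rewrite [conn_weight (m - i) _]conn_weight_eq0 ?mulr0 //; lia.
have -> : (a + K = K.+1 + a.-1)%N by lia.
rewrite -[X in \sum_(X <= _ < _) _]add0n big_addn addnK big_mkord.
apply: eq_bigr => -[p /= hp] _; rewrite /theta /conn_series.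
rewrite (gtn_eqF a0) subn_eq0 leqNgt na /=.
congr (_ * conn_weight _ _ * (_ * conn_weight _ _)); lia.
Qed.

Lemma conn_series0_rec : 2 * (theta (Y 0) - Y 0) = theta (Y 0) * theta (Y 0).
Proof.
apply/funext => n; rewrite -[2](rmorph_nat (@fpsC R)) fpsCM fpsB.
case: n => [|[|n]].
- by rewrite fpsM big_ord1 /theta /= !(mul0r, subr0, mulr0).
- have -> : theta (Y 0) 1%N - Y 0 1%N = 0 by rewrite /theta mul1r subrr.
  rewrite mulr0 fpsM !big_ord_recl big_ord0 /=.
  by rewrite /theta /bump /= !(mul0r, mulr0, addr0).
have := @conn_weight_rec n n.+2; rewrite [conn_weight n n.+2]conn_weight_eq0 // mulr0 add0r.
rewrite (@conn_weight_conv _ _ 0) ?addn0 ?addn2 // big_ord1 subnn => <-.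
by rewrite /theta /conn_series /= addn0 -[n.+2%:R]natr1; ring.
Qed.

(** A structure in [Y k.+1] has n + k edges, whence theta + k. After the removal m = n + k - 1, and
    the n + 2 m forbidden pairs become 3 theta + 2 k - 2. The end terms of the sum still contain
    [Y k.+1]. *)
Lemma conn_series_rec k : 2 * (theta (Y k.+1) + k%:R * Y k.+1) =
  theta (theta (Y k)) - s%:R * (3 * theta (Y k) + (2 * k%:R - 2) * Y k) +
  \sum_(p < k.+2) theta (Y p) * theta (Y (k.+1 - p)).
Proof.
apply/funext => n.
rewrite !(fpsD, fpsN) -[2](rmorph_nat (@fpsC R)) -[k%:R](rmorph_nat (@fpsC R)).
rewrite -[s%:R](rmorph_nat (@fpsC R)) -[3](rmorph_nat (@fpsC R)) -rmorphM -rmorphB /=.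
rewrite !(fpsCM, fpsD).
case: n => [|n].
  rewrite fps_sum big1 => [|p _]; last by rewrite fpsM big_ord1 /theta !mul0r.
  by rewrite /theta /conn_series /= !mul0r !(mulr0, addr0, subr0).
have := @conn_weight_rec (n + k) n.+1.
rewrite (@conn_weight_conv _ _ k.+1); last by lia.
move=> h; rewrite /theta [Y k.+1 n.+1]/conn_series [Y k n.+1]/conn_series /=.
rewrite addSn /= -addnS in h *; move: h.
rewrite addnS => h.
transitivity (2 * (n + k).+1%:R * conn_weight (n + k).+1 n.+1).
  by rewrite -[(n + k).+1]addSn natrD; ring.
rewrite h; congr (_ + _).
by rewrite natrX -addSn natrD natrM natrD; ring.
Qed.

Lemma conn_series_ge0 k : nonneg (Y k).
Proof. by move=> n; rewrite /conn_series; case: ifP => // _; exact: conn_weight_ge0. Qed.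

Lemma conn_series0_1 : Y 0 1%N = 1.
Proof. by rewrite /conn_series /= conn_weight_0n. Qed.

Lemma conn_series_at0 k : Y k 0%N = 0. Proof. by []. Qed.

End Recurrence.

(** * Generating functions of the classes *)

Section ClassSeries.
Variables (R : realType) (s : bool).
Local Notation Y := (conn_series R s).

(** The excess e ties the number of edges to that of vertices, leaving one variable; by
    [in_class_edges] a configuration determines e. *)
Definition weighted_series (Phi : forall m n, edge_seq m n -> R) e : fps R :=
  fun n => normalise (n + e) n (\sum_(f : edge_seq (n + e) n) Phi _ _ f).

Lemma eq_weighted_series Phi Phi' e : (forall m n (f : edge_seq m n), Phi m n f = Phi' m n f) ->
  weighted_series Phi e = weighted_series Phi' e.
Proof. by move=> h; apply/funext => n; congr normalise; apply: eq_bigr => f _. Qed.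

(** Fixing the excess i of the component cut off leaves one number of edges for each size a, so the
    double sum collapses to a Cauchy product. *)
Lemma pointing_weighted_series (W : forall m n, edge_seq m n -> 'I_n -> R) (h : nat -> R)
    (Phi : forall m n, edge_seq m n -> R) i e :
  (forall m n (S : {set 'I_n}) (A : {set 'I_m})
      (f1 : edge_seq #|A| #|S|) (f2 : edge_seq #|~: A| #|~: S|) x,
      connected_seq f1 -> x \in S -> W _ _ (glue_seq f1 f2) x =
        (#|A| == (#|S| + i)%N)%:R * h #|S| * (admissible s f1)%:R * Phi _ _ f2) ->
  weighted_series (fun m n f => \sum_x W m n f x) (i + e) =
  ((fun a => a%:R * h a * Y i.+1 a) : fps R) * weighted_series Phi e.
Proof.
move=> hW; apply/funext => n.
rewrite /weighted_series (@pointing_normalise R s _ _ _ (fun a l =>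
  (l == (a + i)%N)%:R * h a) Phi (hW _ _)).
rewrite fpsM; apply: eq_bigr => -[a /= an] _.
have hl : (a + i < (n + (i + e)).+1)%N by lia.
rewrite (bigD1 (Ordinal hl)) //= [X in _ + X]big1 ?addr0; last first.
  move=> l; rewrite -val_eqE /= => /negbTE ->.
  by rewrite mul0r mulr0 !mul0r.
rewrite eqxx mul1r.
have -> : (n + (i + e) - (a + i) = n - a + e)%N by lia.
congr (_ * _); case: a an hl => [|a] an hl; first by rewrite !mul0r.
by rewrite /conn_series /= addnS.
Qed.

Definition G c e : fps R := weighted_series (fun m n f =>
  (admissible s f && in_class c f)%:R) e.

Lemma G_ge0 c e : nonneg (G c e).
Proof. by move=> n; rewrite divr_ge0 ?ler0n // sumr_ge0 // => f _; rewrite ler0n. Qed.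

Section Stat.
Variable c : nat -> nat.

Lemma pointing1 i e :
  weighted_series (fun m n f =>
    \sum_x (admissible s f && in_class c f && has_excess f x i)%:R) (i + e) =
  (can_dec c i)%:R * (theta (Y i.+1) * G (dec_config c i) e).
Proof.
rewrite (@pointing_weighted_series _ (fun=> 1) (fun m n f =>
  (can_dec c i)%:R * (admissible s f && in_class (dec_config c i) f)%:R)).
  have -> : weighted_series (fun m n f =>
    (can_dec c i)%:R * (admissible s f && in_class (dec_config c i) f)%:R) e =
      fpsC (can_dec c i)%:R * G (dec_config c i) e.
    by apply/funext => n; rewrite fpsCM /weighted_series -mulr_sumr normaliseM.
  rewrite rmorph_nat mulrCA; congr (_ * (_ * _)); apply/funext => n.
  by rewrite mulr1.
move=> m n S A f1 f2 x c1 xS; have [y yE] := enum_valE xS.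
rewrite yE has_excess_glueL has_excess_connected // admissible_glue; case: eqP => [hA|_];
  last by rewrite andbF !mul0r.
rewrite (in_class_glue _ _ c1 hA) andbT.
by case: (admissible s f1); case: (admissible s f2); case: (can_dec c i);
  case: (in_class _ _); rewrite /= ?(mul0r, mul1r, mulr0).
Qed.

Lemma pointing_same i e :
  weighted_series (fun m n f =>
    \sum_x \sum_(y in component (mgraph f) x) (admissible s f && in_class c f && has_excess f
    x i)%:R) (i + e) =
  (can_dec c i)%:R * (theta (theta (Y i.+1)) * G (dec_config c i) e).
Proof.
rewrite (@pointing_weighted_series _ (fun a => a%:R) (fun m n f =>
  (can_dec c i)%:R * (admissible s f && in_class (dec_config c i) f)%:R)).
  have -> : weighted_series (fun m n f =>
    (can_dec c i)%:R * (admissible s f && in_class (dec_config c i) f)%:R) e =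
      fpsC (can_dec c i)%:R * G (dec_config c i) e.
    by apply/funext => n; rewrite fpsCM /weighted_series -mulr_sumr normaliseM.
  rewrite rmorph_nat mulrCA; congr (_ * (_ * _)); apply/funext => n.
  by rewrite /theta mulrA.
move=> m n S A f1 f2 x c1 xS; have [y yE] := enum_valE xS.
have cx : component (mgraph (glue_seq f1 f2)) x = S by apply/eqP; rewrite connected_glue.
rewrite sumr_const cx -[LHS]mulr_natl.
rewrite yE has_excess_glueL has_excess_connected // admissible_glue; case: eqP => [hA|_];
  last by rewrite andbF /= !(mul0r, mulr0).
rewrite (in_class_glue _ _ c1 hA) andbT.
by case: (admissible s f1); case: (admissible s f2); case: (can_dec c i);
  case: (in_class _ _); rewrite /= ?(mul0r, mul1r, mulr0, mulr1).
Qed.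

End Stat.

Lemma pointing_diff c i k e :
  weighted_series (fun m n f => \sum_x \sum_(y | y \notin component (mgraph f) x)
     (admissible s f && in_class c f && (has_excess f x i && has_excess f y k))%:R) (i + e) =
  (can_dec c i)%:R * (theta (Y i.+1) *
    weighted_series (fun m n f =>
      \sum_y (admissible s f && in_class (dec_config c i) f && has_excess f y k)%:R) e).
Proof.
rewrite (@pointing_weighted_series _ (fun=> 1) (fun m n f => (can_dec c i)%:R *
    \sum_x (admissible s f && in_class (dec_config c i) f && has_excess f x k)%:R)).
  have -> : weighted_series (fun m n f => (can_dec c i)%:R *
      \sum_x (admissible s f && in_class (dec_config c i) f && has_excess f x k)%:R) e =
      fpsC (can_dec c i)%:R * weighted_series (fun m n f =>
      \sum_x (admissible s f && in_class (dec_config c i) f && has_excess f x k)%:R) e.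
    by apply/funext => n; rewrite fpsCM /weighted_series -mulr_sumr normaliseM.
  rewrite rmorph_nat mulrCA; congr (_ * (_ * _)); apply/funext => n.
  by rewrite mulr1.
move=> m n S A f1 f2 x c1 xS; have [y yE] := enum_valE xS.
have cx : component (mgraph (glue_seq f1 f2)) x = S by apply/eqP; rewrite connected_glue.
rewrite cx admissible_glue.
transitivity (\sum_(z in ~: S) (admissible s f1 && admissible s f2 && in_class c (glue_seq f1
  f2) &&
  (has_excess (glue_seq f1 f2) x i && has_excess (glue_seq f1 f2) z k))%:R : R).
  by apply: eq_bigl => z; rewrite inE.
rewrite big_enum_val mulr1 !mulr_sumr; apply: eq_bigr => z _.
rewrite has_excess_glueR yE has_excess_glueL has_excess_connected //; case: eqP => [hA|_];
  last by rewrite andbF !mul0r.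
rewrite (in_class_glue _ _ c1 hA).
by case: (admissible s f1); case: (admissible s f2); case: (can_dec c i);
  case: (in_class _ _); rewrite /= ?(mul0r, mul1r, mulr0).
Qed.

Variable q : nat.
Implicit Types c : nat -> nat.

Definition total_excess c := (\sum_(1 <= j < q.+1) j * c j)%N.
Definition supported c := forall j, (q < j)%N -> c j = 0%N.

Lemma supported_dec c i : supported c -> supported (dec_config c i).
Proof. by move=> h j qj; rewrite /dec_config h // if_same. Qed.

Lemma total_excess_dec c i : (i <= q)%N -> can_dec c i ->
  total_excess c = (i + total_excess (dec_config c i))%N.
Proof.
rewrite /can_dec; have [->|i0 iq /= ci] := posnP i.
  by move=> _ _; apply: eq_bigr => j _; rewrite /dec_config.
rewrite /total_excess !(bigD1_seq i) ?mem_index_iota ?iota_uniq ?i0 //= /dec_config i0 eqxx /=.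
rewrite addnA; congr (_ + _)%N; first by rewrite -{1}(prednK ci) mulnS.
by apply: eq_bigr => j /negbTE ->.
Qed.

Lemma can_dec_le c i : supported c -> can_dec c i -> (i <= q)%N.
Proof. by move=> sc; rewrite leqNgt; apply: contraL => qi; rewrite /can_dec sc // orbF -lt0n;
  lia. Qed.

Definition class_series c := G c (total_excess c).

(** The excess of the component of x is nonnegative as there are no trees, and at most q by the
    support of c. *)
Lemma in_class_has_excess m n (f : edge_seq m n) c x : supported c -> in_class c f ->
  (\sum_(i < q.+1) (has_excess f x i)%:R = 1 :> R).
Proof.
move=> sc /andP[/'forall_implyP na /asboolP cf].
have le := na _ (mem_components (mgraph f) x).
pose j := (edges_inside f (component (mgraph f) x) - #|component (mgraph f) x|)%N.
have ej i : has_excess f x i = (i == j).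
  by rewrite /has_excess /j; apply/eqP/eqP; move: le; lia.
have jq : (j < q.+1)%N.
  rewrite ltnS leqNgt; apply/negP => qj.
  have := cf j; rewrite sc // ncompE => /(_ (leq_ltn_trans (leq0n q) qj)).
  move=> /eqP; rewrite cards_eq0 => /eqP/setP/(_ (component (mgraph f) x)).
  by rewrite !inE mem_components /=; have := ej j; rewrite eqxx /has_excess => ->.
rewrite (bigD1 (Ordinal jq)) //= ej eqxx big1 ?addr0 // => i.
by rewrite -val_eqE /= ej => /negbTE ->.
Qed.

Lemma has_excess_can_dec m n (f : edge_seq m n) c x i : in_class c f -> has_excess f x i ->
  can_dec c i.
Proof.
move=> /andP[_ /asboolP cf] ex; rewrite /can_dec.
have [//|i0] := posnP i; rewrite -cf // ncompE card_gt0; apply/set0Pn.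
by exists (component (mgraph f) x); rewrite inE mem_components.
Qed.

Lemma weighted_series_eq0 (Phi : forall m n, edge_seq m n -> R) e :
  (forall m n (f : edge_seq m n), Phi m n f = 0) -> weighted_series Phi e = 0.
Proof. by move=> h; apply/funext => n; rewrite /weighted_series big1 // /normalise mul0r. Qed.

Lemma stat_single c i : supported c ->
  weighted_series (fun m n f =>
    \sum_x (admissible s f && in_class c f && has_excess f x i)%:R) (total_excess c) =
  (can_dec c i)%:R * (theta (Y i.+1) * class_series (dec_config c i)).
Proof.
move=> sc; have [oc|oc] := boolP (can_dec c i).
  by rewrite {1}(total_excess_dec (can_dec_le sc oc) oc) pointing1 oc.
rewrite mul0r weighted_series_eq0 // => m n f; rewrite big1 // => x _; apply/eqP.
rewrite pnatr_eq0 eqb0; apply: contra oc => /andP[/andP[_ cf]].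
exact: has_excess_can_dec.
Qed.

Lemma stat_same c i : supported c ->
  weighted_series (fun m n f => \sum_x \sum_(y in component (mgraph f) x)
    (admissible s f && in_class c f && has_excess f x i)%:R) (total_excess c) =
  (can_dec c i)%:R * (theta (theta (Y i.+1)) * class_series (dec_config c i)).
Proof.
move=> sc; have [oc|oc] := boolP (can_dec c i).
  by rewrite {1}(total_excess_dec (can_dec_le sc oc) oc) pointing_same oc.
rewrite mul0r weighted_series_eq0 // => m n f; rewrite big1 // => x _; rewrite big1 // => y _.
apply/eqP; rewrite pnatr_eq0 eqb0; apply: contra oc => /andP[/andP[_ cf]].
exact: has_excess_can_dec.
Qed.

Lemma stat_diff c i k : supported c ->
  weighted_series (fun m n f => \sum_x \sum_(y | y \notin component (mgraph f) x)
    (admissible s f && in_class c f && (has_excess f x i && has_excess f y k))%:R)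
      (total_excess c) =
  (can_dec c i)%:R * (theta (Y i.+1) *
    ((can_dec (dec_config c i) k)%:R * (theta (Y k.+1) *
      class_series (dec_config (dec_config c i) k)))).
Proof.
move=> sc; have [oc|oc] := boolP (can_dec c i).
  rewrite {1}(total_excess_dec (can_dec_le sc oc) oc) pointing_diff oc stat_single //.
  exact: supported_dec.
rewrite mul0r weighted_series_eq0 // => m n f; rewrite big1 // => x _; rewrite big1 // => y _.
apply/eqP; rewrite pnatr_eq0 eqb0; apply: contra oc => /andP[/andP[_ cf]] /andP[ex _].
exact: has_excess_can_dec cf ex.
Qed.

(** theta marks a vertex, which is classified by the excess of its component. *)
Lemma theta_class_series c : supported c ->
  theta (class_series c) = \sum_(i < q.+1) (can_dec c i)%:R * (theta (Y i.+1) *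
    class_series (dec_config c i)).
Proof.
move=> sc.
transitivity (\sum_(i < q.+1)
   weighted_series (fun m n f =>
     \sum_x (admissible s f && in_class c f && has_excess f x i)%:R) (total_excess c)).
  apply/funext => n; rewrite fps_sum /weighted_series -normalise_sum exchange_big /theta
    /class_series /G /weighted_series -normaliseM.
  rewrite mulr_sumr; congr normalise; apply: eq_bigr => f _; rewrite exchange_big /=.
  have [/andP[_ cf]|_] := boolP (_ && _); last first.
    by rewrite mulr0 big1 // => x _; rewrite big1.
  rewrite mulr1; under eq_bigr do rewrite (in_class_has_excess _ sc cf).
  by rewrite sumr_const card_ord.
by apply: eq_bigr => i _; rewrite stat_single.
Qed.

Lemma class_series_0 c : supported c -> class_series c 0%N = (total_excess c == 0%N)%:R.
Proof.
move=> sc; rewrite /class_series /G /weighted_series add0n /normalise.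
case wc : (total_excess c) => [|w].
  have hf (f : edge_seq 0 0) : admissible s f && in_class c f.
    have nC C : (C \in components (mgraph f)) = false by apply/negP => /componentsP[[]].
    apply/andP; split; first by apply/implyP => _; apply/andP; split; apply/forallP => -[].
    apply/andP; split; first by apply/'forall_implyP => C; rewrite nC.
    apply/asboolP => j j0; rewrite ncompE eq_card0; last by move=> C; rewrite inE nC.
    have [jq|/sc //] := leqP j q.
    move: wc; rewrite /total_excess (bigD1_seq j) ?mem_index_iota ?iota_uniq ?j0 //=.
    by move=> /eqP; rewrite addn_eq0 muln_eq0 (gtn_eqF j0) /= => /andP[/eqP-> _].
  under eq_bigr do rewrite hf.
  by rewrite sumr_const card_ffun !card_ord expn0 /= divr1.
by rewrite big1 ?mul0r // => f _; case: (f ord0) => -[].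
Qed.

Definition c0 : nat -> nat := fun=> 0%N.
Definition unicyclic_series := class_series c0.

Lemma dec_config_c0 i : dec_config c0 i = c0.
Proof. by apply/funext => j; rewrite /dec_config if_same. Qed.

Lemma theta_unicyclic_series : theta unicyclic_series = theta (Y 1) * unicyclic_series.
Proof.
rewrite theta_class_series // big_ord_recl big1 => [|i _]; last by rewrite /can_dec /= mul0r.
by rewrite /can_dec /= mul1r addr0 dec_config_c0.
Qed.

Lemma unicyclic_series_0 : unicyclic_series 0%N = 1.
Proof. by rewrite /unicyclic_series class_series_0 // /total_excess big1 // => i _;
  rewrite muln0. Qed.

Definition comp_prod c : fps R := \prod_(1 <= j < q.+1) (fpsC (c j)`!%:R^-1 * Y j.+1 ^+ c j).

Lemma theta_prod (I : eqType) (r : seq I) (F : I -> fps R) : uniq r ->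
  theta (\prod_(i <- r) F i) = \sum_(i <- r) theta (F i) * \prod_(j <- r | j != i) F j.
Proof.
elim: r => [|x r IH] /=; first by rewrite !big_nil theta1.
move=> /andP[xr ur]; rewrite !big_cons eqxx /= thetaM IH //; congr (_ + _).
  congr (_ * _); rewrite big_seq [RHS]big_seq_cond; apply: eq_bigl => j.
  by have [->|] := eqVneq j x; rewrite ?(negbTE xr) ?andbT.
rewrite big_distrr /=; apply: eq_big_seq => i ir.
rewrite big_cons; have -> : x != i by apply: contraNneq xr => ->.
by ring.
Qed.

Lemma theta_comp_prod c : theta (comp_prod c) =
  \sum_(1 <= i < q.+1) (can_dec c i)%:R * (theta (Y i.+1) * comp_prod (dec_config c i)).
Proof.
rewrite /comp_prod theta_prod ?iota_uniq //; apply: eq_big_seq => i.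
rewrite mem_index_iota => /andP[i0 iq].
rewrite [in RHS](bigD1_seq i) ?mem_index_iota ?i0 ?iota_uniq //=.
rewrite /can_dec (gtn_eqF i0) /=.
have -> : \prod_(1 <= j < q.+1 | j != i) (fpsC (dec_config c i j)`!%:R^-1 *
  Y j.+1 ^+ dec_config c i j) =
   \prod_(1 <= j < q.+1 | j != i) (fpsC (c j)`!%:R^-1 * Y j.+1 ^+ c j).
  by apply: eq_bigr => j /negbTE ji; rewrite /dec_config ji andbF.
rewrite /dec_config i0 eqxx /= thetaCM.
case: (c i) => [|k]; first by rewrite expr0 theta1 mulr0 !mul0r.
rewrite thetaX mul1r -(rmorph_nat (@fpsC R)) /=.
have -> : fpsC (k.+1)`!%:R^-1 * (fpsC k.+1%:R * Y i.+1 ^+ k * theta (Y i.+1)) =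
   fpsC k`!%:R^-1 * (Y i.+1 ^+ k * theta (Y i.+1)).
  have <- : fpsC (k.+1)`!%:R^-1 * fpsC k.+1%:R = fpsC k`!%:R^-1 :> fps R.
    rewrite -[LHS]rmorphM /=; congr fpsC.
    by rewrite factS natrM invfM mulrAC mulVf ?mul1r // pnatr_eq0.
  by ring.
by ring.
Qed.

(** Both sides satisfy the same system of theta equations over all configurations. As theta W_i has
    no constant term, coefficient n is determined by smaller coefficients, possibly of other
    configurations; hence the induction on n with c generalised. *)
Lemma class_series_closed c : supported c -> class_series c = unicyclic_series * comp_prod c.
Proof.
move=> sc; apply/funext => n; elim/ltn_ind: n c sc => n IH c sc.
have [->|n0] := posnP n.
  rewrite fpsM big_ord1 subnn unicyclic_series_0 mul1r class_series_0 //.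
  have E r : (\prod_(j <- r) (fpsC (c j)`!%:R^-1 * Y j.+1 ^+ c j)) 0%N =
      ((\sum_(j <- r) c j)%N == 0%N)%:R :> R.
    elim: r => [|j r IHr]; first by rewrite !big_nil fps1.
    rewrite !big_cons fpsM big_ord1 subnn IHr fpsCM addn_eq0.
    case: (c j) => [|k]; first by rewrite fact0 invr1 expr0 fps1 !mul1r.
    by rewrite exprS fpsM big_ord1 conn_series_at0 mul0r mulr0 mul0r.
  have E2 r : all (leq 1) r ->
    ((\sum_(j <- r) j * c j)%N == 0%N) = ((\sum_(j <- r) c j)%N == 0%N).
    elim: r => [|j r IHr] /=; first by rewrite !big_nil.
    by move=> /andP[j0 /IHr]; rewrite !big_cons !addn_eq0 muln_eq0 (gtn_eqF j0) => ->.
  by rewrite /comp_prod E /total_excess E2 //; apply/allP => j;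
    rewrite mem_index_iota => /andP[].
apply: (mulfI (_ : n%:R != 0)); first by rewrite pnatr_eq0 -lt0n.
transitivity (theta (class_series c) n); first by [].
transitivity (theta (unicyclic_series * comp_prod c) n); last by [].
have -> : theta (unicyclic_series * comp_prod c) =
    \sum_(i < q.+1) (can_dec c i)%:R * (theta (Y i.+1) * (unicyclic_series *
      comp_prod (dec_config c i))).
  rewrite thetaM theta_unicyclic_series theta_comp_prod big_ord_recl /= mul1r.
  have -> : dec_config c 0 = c by apply/funext => j; rewrite /dec_config.
  congr (_ + _); first by ring.
  rewrite mulr_sumr -[in LHS]add1n big_add1 big_mkord; apply: eq_bigr => i _.
  by rewrite /bump /= ?add1n; ring.
rewrite theta_class_series // !fps_sum; apply: eq_bigr => i _.
rewrite -(rmorph_nat (@fpsC R)) !fpsCM; congr (_ * _).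
rewrite !fpsM !big_ord_recl {1 3}/theta !mul0r; congr (_ + _).
apply: eq_bigr => a _; congr (_ * _); rewrite lift0.
apply: IH; [by have := ltn_ord a; lia|exact: supported_dec].
Qed.

End ClassSeries.

(** * Acyclic components *)

Section Cycles.

Definition cyclic n (M : 'M[nat]_n) := exists s, is_cycle M s.

Lemma cyclic_le n (M M' : 'M[nat]_n) s :
  (forall x y, (M x y <= M' x y)%N) -> is_cycle M s -> is_cycle M' s.
Proof.
move=> le /and3P[s0 us cs]; apply/and3P; split=> //.
apply: sub_cycle cs => x y /=; case: ifP => _ h; exact: leq_trans h (le _ _).
Qed.

(** The new edge closes a path from x to y without repetitions. Short paths are separate: x = y
    gives a loop, and an old edge from x to y becomes a double one. *)
Lemma cyclic_add_in n (M : 'M[nat]_n) (x y : 'I_n) :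
  (forall x y, M x y = M y x) -> y \in component M x -> cyclic (add_edge M x y).
Proof.
move=> Msym; rewrite inE => /connectP[p0 px0 yE].
have [p px [up yl]] : exists2 p, path.path (adj M) x p & uniq (x :: p) /\ y = last x p.
  by case/shortenP: px0 yE => p px up _ yl; exists p.
have le u v : (M u v <= add_edge M x y u v)%N by rewrite mxE leq_addr.
have yx : (0 < add_edge M x y y x)%N by rewrite mxE !eqxx orbT addn1.
exists (x :: p); apply/and3P; split=> //.
case: p px up yl => [|z [|w p]] /= px up yl.
- by move: yx; rewrite yl => ->.
- subst z; move: px; rewrite andbT => xz.
  have h : (1 < add_edge M x y x y)%N by rewrite mxE !eqxx /= addn1 ltnS.
  by rewrite h andbT (add_edge_sym Msym).
rewrite rcons_path /= -yl yx andbT; case/and3P: px => xz zw pw.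
apply/and3P; split; [exact: leq_trans xz (le _ _)|exact: leq_trans zw (le _ _)|].
by apply: sub_path pw => u v h; exact: leq_trans h (le _ _).
Qed.

(** The new edge is a bridge: if the cycle ran through it, the rest of the cycle would connect its
    ends in M. *)
Lemma cyclic_add_out n (M : 'M[nat]_n) (x y : 'I_n) s :
  (forall x y, M x y = M y x) -> y \notin component M x ->
  is_cycle (add_edge M x y) s -> is_cycle M s.
Proof.
move=> Msym yx /and3P[s0 us cs]; apply/and3P; split=> //.
have xy : x != y by apply: contraNneq yx => <-; exact: component_refl.
have nadj u v : ((u == x) && (v == y)) || ((u == y) && (v == x)) -> v \notin component M u.
  by case/orP => /andP[/eqP-> /eqP->] //; rewrite component_sym.
apply: cycle_from_next => // a sa; have := next_cycle cs sa.
rewrite /= mxE; case: (boolP (_ || _)) => [hab|_]; last by rewrite addn0.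
have nab := nadj _ _ hab.
have nab0 : M a (next s a) = 0%N.
  by apply/eqP; rewrite -leqn0 leqNgt; apply: contra nab; exact: adj_component.
(* A cycle of length 2 asks for multiplicity at least 2, which the new edge alone does not
   provide. *)
rewrite nab0 addn1; case: ifP => // s2 _; exfalso.
have [k t rt] := rot_to sa.
have rs : size (a :: t) = size s by rewrite -rt size_rot.
have ur : uniq (a :: t) by rewrite -rt rot_uniq.
have nx : next s a = next (a :: t) a by rewrite -rt next_rot.
have cr : cycle [rel u v | (0 < add_edge M x y u v)%N] (a :: t).
  by rewrite -rt rot_cycle; move: cs; rewrite s2.
case: t rt rs ur nx cr => [|b [|c t]] rt rs ur nx cr.
- move: nab; rewrite nx /= eqxx; by rewrite component_refl.
- by move: s2; rewrite -rs.
move: nx; rewrite /= eqxx => nx; rewrite nx in hab nab nab0.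
move: ur => /= /and3P[]; rewrite !inE !negb_or => /and3P[nab' nac at_] /andP[nbc bt] ct.
suff : connect (adj M) b a by move=> h; move: nab; rewrite component_sym // inE h.
apply/connectP; exists (rcons (c :: t) a); last by rewrite last_rcons.
move: cr => /= /andP[_]; rewrite -/(path.path _ b (c :: rcons t a)) -rcons_cons rcons_path.
move=> /andP[p1 p2].
change (is_true (path.path (adj M) b (rcons (c :: t) a))).
rewrite rcons_path; apply/andP; split.
  (* This stretch of the cycle avoids a, an end of the new edge, so it consists of old edges. The
     last edge, back to a, is old because it does not start at b. *)
  apply: (@sub_in_path _ (predC1 a) [rel u v | (0 < add_edge M x y u v)%N] _ _ _ _ _ p1).
    move=> u v; rewrite !inE => ua va /=; rewrite /adj /= mxE.
    suff -> : (u == x) && (v == y) || (u == y) && (v == x) = false by rewrite addn0.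
    apply/negP; case/orP => /andP[/eqP ux /eqP vy]; subst u v.
      case/orP: hab => /andP[/eqP h1 /eqP h2]; first by rewrite h1 eqxx in ua.
      by rewrite h1 eqxx in va.
    case/orP: hab => /andP[/eqP h1 /eqP h2]; first by rewrite h1 eqxx in va.
    by rewrite h1 eqxx in ua.
  apply/allP => u; rewrite !inE => /or3P[/eqP->|/eqP->|ut]; rewrite 1?eq_sym //.
  by apply: contraNneq at_ => ->.
move: p2; rewrite /adj /= mxE.
have lb : last c t != b.
  have : last c t \in c :: t by exact: mem_last.
  by rewrite inE => /orP[/eqP->|lt]; [rewrite eq_sym|apply: contraNneq bt => <-].
suff -> : (last c t == x) && (a == y) || (last c t == y) && (a == x) = false by rewrite addn0.
apply/negP => h; case/negP: lb.
case/orP: hab => /andP[/eqP ax /eqP bY]; case/orP: h => /andP[/eqP l1 /eqP a1].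
- by move: xy; rewrite -ax a1 eqxx.
- by rewrite l1 bY.
- by rewrite l1 bY.
by move: xy; rewrite -a1 ax eqxx.
Qed.

Lemma ncomp_edge_cons m n (f : edge_seq m n) x y :
  (#|components (mgraph (edge_cons f (x, y)))| + (y \notin component (mgraph f) x) =
    #|components (mgraph f)|)%N.
Proof.
have Ms := mgraph_sym f; rewrite mgraph_edge_cons /= components_add //.
have notin : component (mgraph f) x :|: component (mgraph f) y \notin components (mgraph f)
  :\ component (mgraph f) x :\ component (mgraph f) y.
  rewrite !inE !negb_and !negbK; case: componentsP => [[z h]|_]; last by rewrite !orbT.
  have xz : x \in component (mgraph f) z by rewrite -h inE component_refl.
  by rewrite h -(component_eq Ms xz) eqxx orbT.
rewrite cardsU1 notin add1n.
rewrite (cardsD1 (component (mgraph f) x) (components (mgraph f))) mem_components.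
rewrite (cardsD1 (component (mgraph f) y) (_ :\ _)) !inE mem_components andbT (component_eqE
  Ms).
by rewrite [(y \in _)]inE /= add1n addSn addnC.
Qed.

(** The cyclomatic number, components plus edges minus vertices, starts at 0. An added edge either
    merges two components, changing neither this number nor the existence of cycles, or closes a
    cycle and raises it. *)
Lemma cyclic_count m n (f : edge_seq m n) :
  (n <= #|components (mgraph f)| + m)%N /\
  (cyclic (mgraph f) <-> (n < #|components (mgraph f)| + m)%N).
Proof.
elim: m f => [|m IH] f.
  have M0 x y : mgraph f x y = 0%N by rewrite mxE big_ord0.
  have c1 x : component (mgraph f) x = [set x].
    apply/setP => y; rewrite !inE; apply/idP/eqP => [|->]; last exact: connect0.
    by move=> /connectP[[|z p]] //=; rewrite /adj /= M0.
  have -> : #|components (mgraph f)| = n.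
    rewrite componentsE card_imset ?card_ord // => x y.
    by rewrite !c1 => /set1_inj.
  rewrite addn0 leqnn ltnn; split=> //; split=> // -[s /and3P[s0 _ cs]].
  case: s s0 cs => // x s _; move: (x :: s) (mem_head x s) => t xt /next_cycle/(_ xt).
  by rewrite /= M0; case: ifP.
have [g [[x y] ->]] : exists g p, f = edge_cons g p.
  exists [ffun j => f (lift ord0 j)], (f ord0); apply/ffunP => i.
  by rewrite ffunE; case: unliftP => [j ->|->] //; rewrite ffunE.
have [le1 iff1] := IH g; have := ncomp_edge_cons g x y; rewrite mgraph_edge_cons /=.
set k := #|components (add_edge _ _ _)|; set l := #|_|.
have Ms := mgraph_sym g.
have [yx|yx] := boolP (y \in component (mgraph g) x) => /= kl.
  split; first by move: le1; rewrite -/l; lia.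
  by split=> _; [move: le1; rewrite -/l; lia|exact: cyclic_add_in].
split; first by move: le1; rewrite -/l; lia.
have e : (n < k + m.+1)%N = (n < l + m)%N by rewrite -kl addn1 addSnnS.
rewrite e; split=> [[s cs]|/iff1[s cs]].
  by apply/iff1; exists s; apply: cyclic_add_out cs.
by exists s; apply: cyclic_le cs => u v; rewrite [leqRHS]mxE leq_addr.
Qed.

Lemma cyclic_connected m n (f : edge_seq m n) : connected_seq f ->
  cyclic (mgraph f) <-> (n <= m)%N.
Proof.
move=> cf; have [_ ->] := cyclic_count f.
by rewrite connected_components // cards1 add1n ltnS.
Qed.

Lemma is_cycle_map n a (emb : 'I_a -> 'I_n) (M : 'M[nat]_n) (M1 : 'M[nat]_a) t :
  injective emb -> (forall x y, M (emb x) (emb y) = M1 x y) ->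
  is_cycle M (map emb t) = is_cycle M1 t.
Proof.
move=> inj e; rewrite /is_cycle size_map map_inj_uniq // cycle_map.
by congr [&& _, _ & _]; apply: eq_cycle => x y /=; rewrite e.
Qed.

(** Cycles inside C are those of the connected graph cut off on C, to which [cyclic_connected]
    applies. *)
Lemma cyclic_component m n (f : edge_seq m n) C : C \in components (mgraph f) ->
  (exists2 s, is_cycle (mgraph f) s & {subset s <= C}) <-> (#|C| <= edges_inside f C)%N.
Proof.
move=> /componentsP[x CE]; subst C.
set S := component (mgraph f) x.
have xS : x \in S by exact: component_refl.
have [f1 [f2 fE]] := glue_surj (respects_component f x).
have c1 : connected_seq f1 by rewrite -(connected_glue f1 f2 xS) -fE.
have eS : edges_inside f S = #|[set e | (f e).1 \in S]|.
  apply: eq_card => e; rewrite [LHS]finset.in_set [RHS]finset.in_set /S.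
  by rewrite -mem_component_edge andbb.
rewrite eS -(cyclic_connected c1).
have emb_cyc t : is_cycle (mgraph f) (map enum_val t) = is_cycle (mgraph f1) t.
  apply: is_cycle_map; first exact: enum_val_inj.
  move=> u v; have e := mgraph_glueL f1 f2 u v.
  exact: etrans (congr1 (fun g : edge_seq m n => mgraph g _ _) fE) e.
split=> [[s cs sS]|[t ct]].
  have [t tE] : exists t : seq 'I_#|S|, s = map enum_val t.
    elim: s sS {cs} => [|y s IHs] sS; first by exists [::].
    have [|t ->] := IHs; first by move=> z zs; apply: sS; rewrite inE zs orbT.
    have [y' ->] := enum_valE (sS y (mem_head _ _)).
    by exists (y' :: t).
  by exists t; rewrite -emb_cyc -tE.
exists (map enum_val t); first by rewrite emb_cyc.
by move=> z /mapP[u _ ->]; exact: enum_valP.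
Qed.

Lemma no_acyclicE m n (f : edge_seq m n) : no_acyclic_component (mgraph f) <-> no_tree f.
Proof.
split=> [h|/'forall_implyP h C hC]; last by apply/cyclic_component => //; exact: h.
by apply/'forall_implyP => C hC; apply/cyclic_component => //; exact: h.
Qed.

End Cycles.

(** * From edge sequences to weighted multigraphs *)

Section Fibres.
Variable R : realType.

Definition kden n (M : 'M[nat]_n) : nat :=
  (\prod_(x < n) (2 ^ M x x * \prod_(y < n | x <= y) (M x y)`!))%N.

Lemma kden_gt0 n (M : 'M[nat]_n) : (0 < kden M)%N.
Proof.
rewrite prodn_gt0 // => x; rewrite muln_gt0 expn_gt0 /= prodn_gt0 // => y.
exact: fact_gt0.
Qed.

Lemma kden_add n (M : 'M[nat]_n) x y : (forall x y, M x y = M y x) ->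
  kden (add_edge M x y) = (kden M * ((M x y).+1 * 2 ^ (x == y)))%N.
Proof.
wlog xy : x y / (x <= y)%N => [hw Ms|Ms].
  have [xy|/ltnW yx] := leqP x y; first exact: hw.
  by rewrite add_edgeC hw // Ms eq_sym.
rewrite /kden !big_split /= [((M x y).+1 * _)%N]mulnC [RHS]mulnACA; congr (_ * _)%N; last first.
  transitivity (\prod_(u < n) ((\prod_(v < n | (u <= v)%N) (M u v)`!) *
     \prod_(v < n | (u <= v)%N) (if (u == x) && (v == y) then (M x y).+1 else 1)))%N.
    apply: eq_bigr => u _; rewrite -big_split; apply: eq_bigr => v uv; rewrite !mxE /=.
    have [/andP[/eqP-> /eqP->]|h1] := boolP ((u == x) && (v == y)).
      by rewrite addn1 factS mulnC.
    have [/andP[/eqP ux /eqP vy]|_] := boolP ((u == y) && (v == x));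
      last by rewrite addn0 muln1.
    have uv' : u = v by apply/val_inj/eqP; rewrite eqn_leq uv /= ux vy.
    by move: h1; rewrite -vy -ux uv' eqxx.
  rewrite big_split /=; congr (_ * _)%N.
  rewrite (bigD1 x) //= (bigD1 y) //= !eqxx /= big1 ?muln1; last first.
    by move=> v /andP[_ /negbTE ->].
  rewrite big1 ?muln1 // => u /negbTE ->; by rewrite big1.
transitivity (\prod_(u < n) (2 ^ M u u * 2 ^ ((x == y) && (u == x))))%N.
  apply: eq_bigr => u _; rewrite mxE expnD; congr (_ * 2 ^ nat_of_bool _)%N.
  rewrite [(u == y) && _]andbC orbb.
  by apply/andP/andP => [[/eqP <- ->]|[/eqP <- /eqP ->]]; rewrite eqxx.
rewrite big_split /=; congr (_ * _)%N.
rewrite (bigD1 x) //= eqxx andbT big1 ?muln1 // => u /negbTE ->.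
by rewrite andbF.
Qed.

Lemma kappa_add n (M : 'M[nat]_n) x y : (forall x y, M x y = M y x) ->
  kappa R M = kappa R (add_edge M x y) * ((M x y).+1 * 2 ^ (x == y))%:R.
Proof.
move=> Ms; rewrite {2}/kappa -/(kden (add_edge M x y)) kden_add // natrM invfM -mulrA mulVf
  ?mulr1 //.
Qed.

Lemma kappa_gt0 n (M : 'M[nat]_n) : 0 < kappa R M.
Proof. by rewrite invr_gt0 ltr0n; exact: kden_gt0. Qed.

Lemma edges_in_add n (N : 'M[nat]_n) x y :
  edges_in (add_edge N x y) [set: 'I_n]%SET = (edges_in N [set: 'I_n]%SET).+1.
Proof.
transitivity (edges_in N [set: 'I_n]%SET +
   \sum_(u in [set: 'I_n]%SET) \sum_(v in [set: 'I_n]%SET | (u <= v)%N) joins (x, y) u v)%N.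
  rewrite /edges_in -big_split; apply: eq_bigr => u _; rewrite -big_split.
  apply: eq_bigr => v _; rewrite mxE /joins !xpair_eqE.
  by rewrite ![x == _]eq_sym ![y == _]eq_sym [(u == y) && _]andbC.
by rewrite sum_hit !finset.in_setT addn1.
Qed.

Lemma sum_edges_in n (M : 'M[nat]_n) : (forall x y, M x y = M y x) ->
  (\sum_x \sum_y M x y * 2 ^ (x == y) = 2 * edges_in M [set: 'I_n]%SET)%N.
Proof.
move=> Ms.
have e1 : edges_in M [set: 'I_n]%SET = (\sum_(x < n) \sum_(y < n) (x <= y) * M x y)%N.
  rewrite /edges_in; apply: eq_big => x; first by rewrite finset.in_setT.
  move=> _; rewrite big_mkcond; apply: eq_bigr => y _; rewrite finset.in_setT /=.
  by case: (_ <= _)%N; rewrite ?mul1n.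
have e2 : edges_in M [set: 'I_n]%SET = (\sum_(x < n) \sum_(y < n) (y <= x) * M x y)%N.
  rewrite e1 exchange_big; apply: eq_bigr => x _; apply: eq_bigr => y _.
  by rewrite Ms.
rewrite mul2n -addnn {1}e1 e2 -big_split; apply: eq_bigr => x _.
rewrite -big_split; apply: eq_bigr => y _ /=.
have [->|xy] := eqVneq x y; first by rewrite leqnn mul1n muln2 addnn.
have [xy'|yx'] := leqP x y; last by rewrite ltnW // mul1n muln1.
rewrite leqNgt ltn_neqAle xy' andbT; move: xy; rewrite -val_eqE /= => ->.
by rewrite mul1n muln1 addn0.
Qed.

Definition del_edge n (M : 'M[nat]_n) (x y : 'I_n) : 'M[nat]_n :=
  \matrix_(i, j) (M i j - (((i == x) && (j == y)) || ((i == y) && (j == x))))%N.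

Lemma del_edgeK n (M : 'M[nat]_n) x y : (forall x y, M x y = M y x) ->
  (0 < M x y)%N -> add_edge (del_edge M x y) x y = M.
Proof.
move=> Ms h; apply/matrixP => i j; rewrite !mxE subnK //.
by case: (boolP (_ || _)) => // /orP[] /andP[/eqP-> /eqP->]; rewrite // Ms.
Qed.

Lemma add_edgeK n (M : 'M[nat]_n) x y : del_edge (add_edge M x y) x y = M.
Proof. by apply/matrixP => i j; rewrite !mxE addnK. Qed.

(** Induction on the first edge p of the sequence. Removing p from M multiplies [kappa] by the
    multiplicity of p, doubled for a loop; over all ordered pairs these factors sum to twice the
    number of edges. *)
Lemma card_fibre m n (M : 'M[nat]_n) : (forall x y, M x y = M y x) ->
  edges_in M [set: 'I_n]%SET = m ->
  \sum_(f : edge_seq m n) (mgraph f == M)%:R = (2 ^ m * m`!)%:R * kappa R M.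
Proof.
elim: m M => [|m IH] M Ms eM.
  have M0 : M = 0.
    apply/matrixP => x y; rewrite mxE; wlog xy : x y / (x <= y)%N.
      by have [xy|/ltnW yx] := leqP x y => hw; [exact: hw|rewrite Ms; exact: hw].
    move: eM => /eqP; rewrite sum_nat_eq0 => /forallP/(_ x); rewrite finset.in_setT /=.
    by rewrite sum_nat_eq0 => /forallP/(_ y); rewrite finset.in_setT xy => /eqP.
  have m0 (f : edge_seq 0 n) : mgraph f = M.
    by rewrite M0; apply/matrixP => x y; rewrite !mxE big_ord0.
  under eq_bigr do rewrite m0 eqxx.
  rewrite sumr_const card_ffun !card_ord !expn0 fact0 mul1r /kappa big1 ?invr1 //.
  by move=> x _; rewrite M0 mxE expn0 big1 // => y _; rewrite mxE.
rewrite sum_edge_cons exchange_big /=.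
transitivity (\sum_(p : 'I_n * 'I_n) (2 ^ m * m`!)%:R * kappa R M *
    (M p.1 p.2 * 2 ^ (p.1 == p.2))%:R).
  apply: eq_bigr => -[x y] _ /=; have [h|h] := posnP (M x y).
    rewrite h mul0n mulr0 big1 // => f _; rewrite mgraph_edge_cons /=.
    case: eqP => // e; move: h; rewrite -e mxE !eqxx /= addn1 //.
  set N := del_edge M x y.
  have NK : add_edge N x y = M by exact: del_edgeK.
  have Ns u v : N u v = N v u.
    by rewrite !mxE Ms orbC [(v == y) && _]andbC [(v == x) && _]andbC.
  have eN : edges_in N [set: 'I_n]%SET = m.
    by have := edges_in_add N x y; rewrite NK eM => -[].
  transitivity (\sum_(f : edge_seq m n) (mgraph f == N)%:R : R).
    apply: eq_bigr => f _; rewrite mgraph_edge_cons /=; congr _%:R; congr nat_of_bool.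
    by apply/eqP/eqP => [e|->//]; rewrite /N -e add_edgeK.
  rewrite IH // -mulrA; congr (_ * _); rewrite (kappa_add x y Ns) NK.
  have MN : M x y = (N x y).+1 by rewrite -[in LHS]NK [LHS]mxE !eqxx /= addn1.
  by rewrite MN.
rewrite -mulr_sumr -natr_sum mulrAC -natrM; congr (_%:R * _).
transitivity (2 ^ m * m`! * (2 * m.+1))%N; last by rewrite expnS factS; ring.
by congr (_ * _)%N; rewrite -eM -sum_edges_in // pair_bigA.
Qed.

(** Surjectivity by counting: [card_fibre] gives the fibre a nonzero size. *)
Lemma mgraph_surj n (M : 'M[nat]_n) : (forall x y, M x y = M y x) ->
  exists f : edge_seq (edges_in M [set: 'I_n]%SET) n, mgraph f = M.
Proof.
move=> Ms; have := card_fibre Ms erefl; set m := edges_in _ _ => h.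
have : \sum_(f : edge_seq m n) (mgraph f == M)%:R != 0 :> R.
  rewrite h; apply: mulf_neq0; last by rewrite gt_eqF ?kappa_gt0.
  by rewrite pnatr_eq0 -lt0n muln_gt0 expn_gt0 fact_gt0.
move=> /eqP nz; have [f /eqP fM|no] := pickP (fun f : edge_seq m n => mgraph f == M).
  by exists f.
by case: nz; rewrite big1 // => f _; rewrite no.
Qed.

(** The matrices of edge sequences enumerate the set A finitely; grouping the sequences by matrix
    brings in [kappa]. *)
Lemma fsum_kappa m n (A : set 'M[nat]_n) (g : 'M[nat]_n -> R) :
  (forall M, A M -> (forall x y, M x y = M y x) /\ edges_in M [set: 'I_n]%SET = m) ->
  \sum_(M \in A) kappa R M * g M =
  (\sum_(f : edge_seq m n | `[< A (mgraph f) >]) g (mgraph f)) / (2 ^ m * m`!)%:R.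
Proof.
move=> hA; set r := [seq M <- undup [seq mgraph f | f : edge_seq m n] | `[< A M >]].
have ur : uniq r by rewrite filter_uniq // undup_uniq.
have mem_r M : (M \in r) = `[< A M >].
  rewrite mem_filter; case: asboolP => //= AM; rewrite mem_undup.
  have [Ms eM] := hA M AM; move: eM; have [f fM] := mgraph_surj Ms => eM.
  by move: f fM; rewrite eM => f <-; apply/mapP; exists f; rewrite ?mem_enum.
have d0 : (2 ^ m * m`!)%:R != 0 :> R by rewrite pnatr_eq0 -lt0n muln_gt0 expn_gt0 fact_gt0.
rewrite (fsbigE r) //; last 2 first.
- by move=> M /= ; rewrite mem_r => /asboolP.
- by move=> M AM; rewrite mem_r => /asboolP.
transitivity (\sum_(M <- r) kappa R M * g M).
  rewrite big_seq_cond [RHS]big_seq; apply: eq_bigl => M.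
  by case: (boolP (M \in r)) => //=; rewrite mem_r => /asboolP h; rewrite mem_set.
transitivity (\sum_(M <- r) \sum_(f :
  edge_seq m n) (mgraph f == M)%:R * g M / (2 ^ m * m`!)%:R).
  apply: eq_big_seq => M; rewrite mem_r => /asboolP /hA[Ms eM].
  rewrite -!mulr_suml card_fibre // [RHS]mulrAC; congr (_ * _).
  by rewrite mulrAC divff // mul1r.
rewrite exchange_big mulr_suml [RHS]big_mkcond; apply: eq_bigr => f _ /=.
case: asboolP => Af.
  rewrite (bigD1_seq (mgraph f)) //=; last by rewrite mem_r; apply/asboolP.
  by rewrite eqxx mul1r big1 ?addr0 // => M; rewrite eq_sym => /negbTE ->; rewrite !mul0r.
rewrite big1_seq // => M /andP[_]; rewrite mem_r => /asboolP AM.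
by case: eqP => [fM|_]; [rewrite -fM in AM|rewrite !mul0r].
Qed.

Lemma kappa_simple n (M : 'M[nat]_n) : simple_graph M -> kappa R M = 1.
Proof.
move=> [h1 h2]; rewrite /kappa big1 ?invr1 // => x _.
rewrite h1 expn0 big1 // => y _.
by case: (M x y) (h2 x y) => [|[]].
Qed.

End Fibres.

Section Classes.
Variables (R : realType) (q : nat).

(** Sum edges and vertices over the components; one of excess j contributes j extra edges. *)
Lemma in_class_edges m n (f : edge_seq m n) c : supported q c -> in_class c f ->
  m = (n + total_excess q c)%N.
Proof.
move=> sc cf; have /andP[/'forall_implyP na /asboolP cc] := cf.
have Ms := mgraph_sym f.
have mE : m = (\sum_(C in components (mgraph f)) edges_inside f C)%N.
  transitivity (\sum_(e < m) 1)%N; first by rewrite sum1_card card_ord.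
  transitivity (\sum_(e < m) \sum_(C in components (mgraph f)) ((f e).1 \in C) && ((f e).2
    \in C))%N.
    apply: eq_bigr => e _; rewrite (bigD1 (component (mgraph f) (f e).1)) ?mem_components //=.
    rewrite -mem_component_edge component_refl big1 // => C /andP[hC Ce]; apply/eqP;
      rewrite eqb0.
    by apply: contra Ce => /andP[h _]; rewrite (components_mem Ms hC h).
  rewrite exchange_big; apply: eq_bigr => C _ /=;
    rewrite /edges_inside -sum1_card [RHS]big_mkcond /=.
  by apply: eq_bigr => e _; rewrite inE; case: (_ && _).
have nE : n = (\sum_(C in components (mgraph f)) #|C|)%N.
  transitivity (\sum_(x < n) 1)%N; first by rewrite sum1_card card_ord.
  transitivity (\sum_(x < n) \sum_(C in components (mgraph f)) (x \in C))%N.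
    apply: eq_bigr => x _; rewrite (bigD1 (component (mgraph f) x)) ?mem_components //=.
    rewrite component_refl big1 // => C /andP[hC Ce]; apply/eqP; rewrite eqb0.
    by apply: contra Ce => h; rewrite (components_mem Ms hC h).
  rewrite exchange_big; apply: eq_bigr => C _ /=; rewrite -sum1_card [RHS]big_mkcond /=.
  by apply: eq_bigr => e _; case: (_ \in _).
apply: (etrans mE).
transitivity ((\sum_(C in components (mgraph f)) #|C|) + total_excess q c)%N;
  last by rewrite -nE.
transitivity (\sum_(C in components (mgraph f)) (#|C| +
   \sum_(1 <= j < q.+1) j * (edges_inside f C == #|C| + j)))%N.
  apply: eq_bigr => C hC; have le := na C hC.
  pose k := (edges_inside f C - #|C|)%N.
  have ek j : (edges_inside f C == #|C| + j)%N = (j == k) by rewrite /k; apply/eqP/eqP; lia.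
  have eC : edges_inside f C = (#|C| + k)%N by rewrite subnKC.
  rewrite [LHS]eC; congr (_ + _)%N.
  under eq_bigr do rewrite ek.
  have [k0|k0] := posnP k.
    rewrite k0 big_nat big1 // => j /andP[j0 _]; by rewrite (gtn_eqF j0) muln0.
  have kq : (k <= q)%N.
    rewrite leqNgt; apply/negP => qk.
    have := cc k k0; rewrite sc // ncompE => /eqP; rewrite cards_eq0 => /eqP/setP/(_ C).
    by rewrite !inE hC ek eqxx.
  rewrite (bigD1_seq k) ?mem_index_iota ?iota_uniq ?k0 //= eqxx muln1 big1 ?addn0 //.
  by move=> j /negbTE ->; rewrite muln0.
rewrite big_split /=; congr (_ + _)%N; rewrite exchange_big /total_excess /=.
rewrite big_nat [RHS]big_nat; apply: eq_bigr => j /andP[j0 _].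
rewrite -big_distrr /= -cc // ncompE; congr (_ * _)%N.
rewrite -sum1_card [RHS]big_mkcond [LHS]big_mkcond /=; apply: eq_bigr => C _; rewrite inE.
by case: (C \in _) => //=; case: (_ == _).
Qed.

Lemma symP n (M : 'M[nat]_n) : M^T = M -> forall x y, M x y = M y x.
Proof. by move=> h x y; rewrite -{1}h mxE. Qed.

Lemma multigraphsE m n (f : edge_seq m n) (r : nat -> nat) :
  multigraphs n (fun j => (r j)%:Z) (mgraph f) <-> in_class r f.
Proof.
split=> [[_ h1 h2]|/andP[na /asboolP h]].
  apply/andP; split; first by apply/no_acyclicE.
  by apply/asboolP => j /h1 => -[].
split; last by apply/no_acyclicE.
  by apply/matrixP => x y; rewrite mxE mgraph_sym.
by move=> j /h ->.
Qed.

Lemma multigraphs_edges n (r : nat -> nat) M : supported q r ->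
  multigraphs n (fun j => (r j)%:Z) M ->
  (forall x y, M x y = M y x) /\ edges_in M [set: 'I_n]%SET = (n + total_excess q r)%N.
Proof.
move=> sr hM; have [/symP Ms _ _] := hM; split=> //.
have [f fM] := @mgraph_surj R _ _ Ms.
by apply: (@in_class_edges _ _ f) => //; apply/multigraphsE; rewrite fM.
Qed.

Lemma graphsE m n (f : edge_seq m n) (r : nat -> nat) :
  graphs n (fun j => (r j)%:Z) (mgraph f) <-> admissible true f && in_class r f.
Proof.
have sE : simple_graph (mgraph f) <-> simpleb f.
  split=> [[h1 h2]|/andP[/forallP h1 /'forall_forallP h2]].
    by apply/andP; split; [apply/forallP => x; rewrite h1|apply/'forall_forallP].
  by split=> // x; apply/eqP.
split=> [[/multigraphsE h1 /sE h2]|/andP[h2 h1]]; first by rewrite /admissible /= h1 h2.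
by split; [apply/multigraphsE|apply/sE].
Qed.

End Classes.

(** * Adding an edge *)

Section Transition.

(* The change of configuration when the new edge joins components of excess [a]
   and [b].  An edge inside a component of excess [a] has the same effect as
   joining it to a unicyclic one, hence [b = 0] in that case. *)
Definition merge_delta (a b j : nat) : int :=
  (j == (a + b).+1)%:Z - (j == a)%:Z - (j == b)%:Z.

Lemma merge_deltaC a b j : merge_delta a b j = merge_delta b a j.
Proof. by rewrite /merge_delta addnC addrAC. Qed.

(** The only positive entry sits at a + b + 1, so the sum is recovered first. This also settles
    pairs containing 0, an index that [eq_pos] does not see. *)
Lemma merge_delta_inj a b a' b' : eq_pos (merge_delta a b) (merge_delta a' b') ->
  (a = a' /\ b = b') \/ (a = b' /\ b = a').
Proof.
move=> h.
have s1 : (a + b <= a' + b')%N.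
  by have := h (a + b).+1 isT; rewrite /merge_delta; lia.
have s2 : (a' + b' <= a + b)%N.
  by have := h (a' + b').+1 isT; rewrite /merge_delta; lia.
have s : (a + b = a' + b')%N by lia.
have key c : (0 < c)%N -> (c == a) || (c == b) -> (c == a') || (c == b').
  move=> c0 hc; have := h c c0; rewrite /merge_delta -s.
  have -> : (c == (a + b).+1) = false by apply/eqP; case/orP: hc => /eqP ->; lia.
  by move: hc; case: (c == a); case: (c == b); case: (c == a'); case: (c == b').
have [a0|a0] := posnP a.
  have [b0|b0] := posnP b; first by lia.
  by have := key b b0; rewrite eqxx orbT => /(_ isT)/orP[]/eqP; lia.
by have := key a a0; rewrite eqxx => /(_ isT)/orP[]/eqP; lia.
Qed.

Lemma cards_sum (I : finType) (P : pred I) : #|[set x | P x]| = (\sum_x P x)%N.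
Proof. by rewrite -sum1_card big_mkcond; apply: eq_bigr => x _; rewrite inE; case: (P x). Qed.

Lemma edges_inside_edge_cons m n (f : edge_seq m n) p C :
  edges_inside (edge_cons f p) C = ((p.1 \in C) && (p.2 \in C) + edges_inside f C)%N.
Proof.
rewrite /edges_inside !cards_sum big_ord_recl edge_cons0; congr (_ + _)%N.
by apply: eq_bigr => e _; rewrite edge_cons_lift.
Qed.

Definition comp_excess m n (f : edge_seq m n) x :=
  (edges_inside f (component (mgraph f) x) - #|component (mgraph f) x|)%N.

Lemma comp_excessP m n (f : edge_seq m n) x : no_tree f ->
  edges_inside f (component (mgraph f) x) = (#|component (mgraph f) x| + comp_excess f x)%N.
Proof.
move=> /'forall_implyP/(_ _ (mem_components (mgraph f) x)) h.
by rewrite /comp_excess subnKC.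
Qed.

Lemma has_excess_comp_excess m n (f : edge_seq m n) x i : no_tree f ->
  has_excess f x i = (i == comp_excess f x).
Proof. by move=> h; rewrite /has_excess comp_excessP // eqn_add2l eq_sym. Qed.

(** With the untouched components D set aside, one new component is compared with one or two old
    ones. *)
Lemma ncomp_add m n (f : edge_seq m n) x y j : no_tree f -> (0 < j)%N ->
  (ncomp (mgraph (edge_cons f (x, y))) j)%:Z = (ncomp (mgraph f) j)%:Z +
    merge_delta (comp_excess f x) (if y \in component (mgraph f) x then 0%N else comp_excess
      f y) j.
Proof.
move=> na j0; have Ms := mgraph_sym f.
set cx := component (mgraph f) x; set cy := component (mgraph f) y.
pose D := components (mgraph f) :\ cx :\ cy.
have notinD C : C \in D -> [/\ C \in components (mgraph f), x \notin C & y \notin C].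
  rewrite !inE => /and3P[Cy Cx hC]; split=> //.
    by apply: contra Cx => /(components_mem Ms hC) ->.
  by apply: contra Cy => /(components_mem Ms hC) ->.
have BD : cx :|: cy \notin D.
  by apply/negP => /notinD[_]; rewrite inE component_refl.
have comps (P : {set 'I_n} -> bool) : #|[set C in components (mgraph f) | P C]| =
    (P cx + ((y \notin cx) && P cy) + #|[set C in D | P C]|)%N.
  rewrite !cards_sum (bigD1 cx) //= mem_components -addnA; congr (_ + _)%N.
  have [yx|yx] /= := boolP (y \in cx).
    rewrite add0n [RHS](bigD1 cx) //= /D !inE eqxx /= andbF add0n.
    apply: eq_bigr => C Cx; rewrite !inE Cx.
    by rewrite /cy (component_eq Ms yx) Cx.
  have cyx : cy != cx by rewrite (component_eqE Ms).
  rewrite (bigD1 cy) //= mem_components /=.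
  rewrite [in RHS](bigD1 cx) //= /D !inE eqxx /= andbF add0n.
  rewrite [in RHS](bigD1 cy) //= !inE eqxx /= add0n.
  congr (_ + _)%N.
  by apply: eq_bigr => C /andP[Cx Cy]; rewrite !inE Cx Cy.
have compsB (P : {set 'I_n} -> bool) : #|[set C in cx :|: cy |: D | P C]| =
    (P (cx :|: cy) + #|[set C in D | P C]|)%N.
  rewrite !cards_sum (bigD1 (cx :|: cy)) //= setU11 /=.
  rewrite [in RHS](bigD1 (cx :|: cy)) //= (negbTE BD) /= add0n.
  congr (_ + _)%N.
  by apply: eq_bigr => C /negbTE CB; rewrite finset.in_setU1 CB.
rewrite !ncompE comps mgraph_edge_cons /= components_add // -/cx -/cy -/D -/(cx :|: cy) compsB.
have -> : #|[set C in D | edges_inside (edge_cons f (x, y)) C == (#|C| + j)%N]| =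
          #|[set C in D | edges_inside f C == (#|C| + j)%N]|.
  apply: eq_card => C; rewrite [LHS]finset.in_set [RHS]finset.in_set.
  case hC : (C \in D) => //=.
  by have [_ xC _] := notinD _ hC; rewrite edges_inside_edge_cons /= (negbTE xC).
have xB : (x \in cx :|: cy) && (y \in cx :|: cy) by rewrite !finset.in_setU !component_refl
  orbT.
have -> : edges_inside (edge_cons f (x, y)) (cx :|: cy) =
  (1 + edges_inside f (cx :|: cy))%N by rewrite edges_inside_edge_cons xB.
have ex := comp_excessP x na; have ey := comp_excessP y na; rewrite -/cx in ex;
  rewrite -/cy in ey.
rewrite ex ey /merge_delta; have [yx|yx] /= := boolP (y \in cx).
  have -> : cx :|: cy = cx by rewrite /cy (component_eq Ms yx) finset.setUid.
  have -> : (1 + edges_inside f cx == #|cx| + j)%N =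
    (j == (comp_excess f x).+1) by apply/eqP/eqP; lia.
  have -> : (#|cx| + comp_excess f x == #|cx| + j)%N =
    (j == comp_excess f x) by apply/eqP/eqP; lia.
  rewrite (gtn_eqF j0) !addn0 !PoszD [Posz false]/(0 : int) subr0; ring.
have dis : [disjoint cx & cy].
  rewrite -setI_eq0; apply/eqP/setP => z; rewrite !finset.in_setI finset.in_set0.
  apply/negP => /andP[zx zy]; move: yx; rewrite /cx -(component_eq Ms zx) (component_eq Ms zy).
  by rewrite component_refl.
have cB : #|cx :|: cy| = (#|cx| + #|cy|)%N.
  by rewrite cardsU disjoint_setI0 // cards0 subn0.
have eB : edges_inside f (cx :|: cy) = (edges_inside f cx + edges_inside f cy)%N.
  rewrite /edges_inside !cards_sum -big_split /=; apply: eq_bigr => e _.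
  rewrite !finset.in_setU /cx /cy -!mem_component_edge !andbb -/cx -/cy.
  have h : ~~ (((f e).1 \in cx) && ((f e).1 \in cy)).
    by apply/negP => /andP[h1 h2]; move/disjointFr: dis => /(_ _ h1); rewrite h2.
  by move: h; case: (_ \in cx); case: (_ \in cy).
have -> : (1 + edges_inside f (cx :|: cy) == #|cx :|: cy| + j)%N =
  (j == (comp_excess f x + comp_excess f y).+1).
  by apply/eqP/eqP; lia.
have -> : (#|cx| + comp_excess f x == #|cx| + j)%N = (j == comp_excess f x) by apply/eqP/eqP;
  lia.
have -> : (#|cy| + comp_excess f y == #|cy| + j)%N = (j == comp_excess f y) by apply/eqP/eqP;
  lia.
by rewrite !PoszD; ring.
Qed.

End Transition.

(** * Counting ordered pairs by the effect of the new edge *)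

Section PairCounting.
Variables (R : realType) (s : bool) (q : nat).
Local Notation Y := (conn_series R s).

Definition num_pairs n (M : 'M[nat]_n) (c' : nat -> int) : nat :=
  #|[pred p : 'I_n * 'I_n | `[< has_config (add_edge M p.1 p.2) c' >]]|.

Lemma num_pairs_sum n (M : 'M[nat]_n) c' :
  num_pairs M c' = (\sum_x \sum_y `[< has_config (add_edge M x y) c' >])%N.
Proof. by rewrite pair_bigA /num_pairs -sum1_card big_mkcond; apply: eq_bigr => p _;
  rewrite inE; case: `[< _ >]. Qed.

Variables (r : nat -> nat) (delta : nat -> int).
Local Notation c' := (fun j => (r j)%:Z + delta j).

Lemma has_config_add m n (f : edge_seq m n) x y : in_class r f ->
  has_config (add_edge (mgraph f) x y) c' <->
  eq_pos delta (merge_delta (comp_excess f x) (if y \in component (mgraph f) x then 0%N else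
    comp_excess f y)).
Proof.
move=> /andP[na /asboolP rf].
have := fun j => @ncomp_add _ _ f x y j na; rewrite mgraph_edge_cons /= => h.
split=> hc j j0; have := hc j j0; rewrite h // rf //; first by move/addrI.
by move=> <-.
Qed.

Lemma num_pairs_eq0 m n (f : edge_seq m n) : (forall a b, ~ eq_pos delta (merge_delta a b)) ->
  in_class r f -> num_pairs (mgraph f) c' = 0%N.
Proof.
move=> no cf; apply: eq_card0 => p; rewrite inE; apply/asboolP.
by move/(has_config_add _ _ cf); exact: no.
Qed.

(** By [merge_delta_inj] the two excesses are a and b in some order. A pair inside one component
    acts like a merger with excess 0, which forces a = 0 as a <= b. Distinct components occur in
    both orders, which coincide when a = b. *)
Lemma num_pairsE a b m n (f : edge_seq m n) : (a <= b)%N -> eq_pos delta (merge_delta a b) ->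
  in_class r f -> (num_pairs (mgraph f) c')%:R =
    (a == 0%N)%:R * (\sum_x \sum_(y in component (mgraph f) x) (has_excess f x b)%:R) +
    \sum_x \sum_(y | y \notin component (mgraph f) x) (has_excess f x a && has_excess f y
      b)%:R +
    (a != b)%:R * \sum_x \sum_(y | y \notin component (mgraph f) x) (has_excess f x b &&
      has_excess f y a)%:R :> R.
Proof.
move=> ab dE cf; have /andP[na _] := cf.
rewrite num_pairs_sum natr_sum !mulr_sumr -!big_split /=; apply: eq_bigr => x _.
rewrite natr_sum (bigID (mem (component (mgraph f) x))) /= -addrA; congr (_ + _).
  rewrite mulr_sumr; apply: eq_bigr => y yx; rewrite -natrM mulnb; congr (nat_of_bool _)%:R.
  rewrite has_excess_comp_excess //;
    apply/asboolP/andP => [/(has_config_add _ _ cf)|[/eqP a0 /eqP bx]].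
    rewrite yx => h.
    have : eq_pos (merge_delta a b) (merge_delta (comp_excess f x) 0) by move=> j j0;
      rewrite -dE // h.
    by move/merge_delta_inj; case=> -[h1 h2]; split; apply/eqP; move: ab; lia.
  by apply/(has_config_add _ _ cf); rewrite yx -bx => j j0; rewrite dE // a0 merge_deltaC.
rewrite mulr_sumr -big_split; apply: eq_bigr => y yx /=.
rewrite -natrM mulnb -natrD !has_excess_comp_excess //; congr _%:R.
set A := comp_excess f x; set B := comp_excess f y.
have -> : `[< has_config (add_edge (mgraph f) x y) c' >] =
    ((a == A) && (b == B)) || ((b == A) && (a == B)).
  apply/asboolP/orP => [/(has_config_add _ _ cf)|h].
    rewrite (negbTE yx) => h.
    have : eq_pos (merge_delta a b) (merge_delta A B) by move=> j j0; rewrite -dE // h.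
    by move/merge_delta_inj => [[<- <-]|[<- <-]]; rewrite !eqxx; [left|right].
  apply/(has_config_add _ _ cf); rewrite (negbTE yx) -/A -/B => j j0; rewrite dE //.
  by case: h => /andP[/eqP -> /eqP ->] //; rewrite merge_deltaC.
have [<-|nab] /= := eqVneq a b; first by rewrite andbC orbb addn0 andbC.
have : ~~ (((a == A) && (b == B)) && ((b == A) && (a == B))).
  apply/negP => /andP[/andP[/eqP aA /eqP bB] /andP[/eqP bA /eqP aB]].
  by move: nab; rewrite aA bA eqxx.
by case: (a == A); case: (b == B); case: (b == A); case: (a == B).
Qed.

Lemma weighted_seriesD Phi Psi e : weighted_series (fun m n f =>
  Phi m n f + Psi m n f) e = weighted_series Phi e + weighted_series Psi e :> fps R.
Proof. by apply/funext => n; rewrite fpsD /weighted_series -normaliseD -big_split. Qed.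

Lemma weighted_seriesZ c Phi e : weighted_series (fun m n f =>
  c * Phi m n f) e = fpsC c * weighted_series Phi e :> fps R.
Proof. by apply/funext => n; rewrite fpsCM /weighted_series -normaliseM mulr_sumr. Qed.

Definition pair_series : fps R :=
  weighted_series (fun m n f =>
    (admissible s f && in_class r f)%:R * (num_pairs (mgraph f) c')%:R) (total_excess q r).

Lemma pair_series_eq0 : (forall a b, ~ eq_pos delta (merge_delta a b)) -> pair_series = 0.
Proof.
move=> no; apply: weighted_series_eq0 => m n f; have [/andP[_ cf]|_] := boolP (_ && _);
  last by rewrite mul0r.
by rewrite num_pairs_eq0 // mulr0.
Qed.

Definition diff_series a b : fps R := (can_dec r a)%:R * (theta (Y a.+1) *
    ((can_dec (dec_config r a) b)%:R * (theta (Y b.+1) *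
      class_series R s q (dec_config (dec_config r a) b)))).

Lemma pair_seriesE a b : supported q r -> (a <= b)%N -> eq_pos delta (merge_delta a b) ->
  pair_series = (a == 0%N)%:R * ((can_dec r b)%:R * (theta (theta (Y b.+1)) *
    class_series R s q (dec_config r b))) +
    diff_series a b + (a != b)%:R * diff_series b a.
Proof.
move=> sr ab dE; rewrite /diff_series -!stat_diff // -stat_same //.
rewrite -2!(rmorph_nat (@fpsC R)) -!weighted_seriesZ -!weighted_seriesD;
  apply: eq_weighted_series => m n f.
have [/andP[okf cf]|h] /= := boolP (admissible s f && in_class r f); last first.
  by rewrite !mul0r !big1 ?mulr0 ?addr0 // => x _; rewrite big1.
rewrite mul1r (num_pairsE ab dE cf).
by [].
Qed.

End PairCounting.

(** * Absent edges of a simple graph *)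

Section SimplePairs.
Variables (m n : nat) (f : edge_seq m n).
Hypothesis sf : simpleb f.
Let M := mgraph f.

Lemma sum_absent (P : 'I_n -> 'I_n -> bool) : (forall x y, P x y = P y x) ->
  (\sum_x \sum_y (admissible true (edge_cons f (x, y)) && P x y) =
   2 * #|[pred p : 'I_n * 'I_n | absent M p && P p.1 p.2]|)%N.
Proof.
move=> Ps.
have E : #|[pred p : 'I_n * 'I_n | absent M p && P p.1 p.2]| =
   (\sum_(x < n) \sum_(y < n) [&& (x < y)%N, M x y == 0%N & P x y])%N.
  rewrite pair_bigA -sum1_card big_mkcond; apply: eq_bigr => p _.
  by rewrite !inE -andbA; case: [&& _, _ & _].
rewrite mul2n -addnn {1}E E [X in (_ + X)%N]exchange_big -big_split; apply: eq_bigr => x _.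
rewrite -big_split; apply: eq_bigr => y _ /=.
rewrite /admissible /= simpleb_edge_cons sf /= [P y x]Ps /M [mgraph f y x]mgraph_sym.
have [xy|yx|/val_inj ->] := ltngtP x y; last by rewrite eqxx.
- by rewrite -val_eqE /= (ltn_eqF xy) addn0.
by rewrite -val_eqE /= (gtn_eqF yx) add0n.
Qed.

Lemma card_absent : (2 * #|absent M| + (n + 2 * m) = n ^ 2)%N.
Proof.
have := @card_admissible_edge_cons _ _ true f sf; rewrite mul1n => <-; congr (_ + _)%N.
have := @sum_absent (fun _ _ => true) (fun _ _ => erefl).
under eq_bigr do under eq_bigr do rewrite andbT.
move=> ->; congr (_ * _)%N; apply: eq_card => p.
by rewrite [RHS]inE andbT.
Qed.

Definition num_absent_pairs c' : nat := #|[pred p : 'I_n * 'I_n |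
      absent M p && `[< has_config (add_edge M p.1 p.2) c' >]]|.

(** At most the n + 2 m forbidden ordered pairs separate the two counts, so the simple model can
    share the count of all pairs. *)
Lemma num_pairs_absent c' :
  (2 * num_absent_pairs c' <= num_pairs M c' <= 2 * num_absent_pairs c' + (n + 2 * m))%N.
Proof.
have Ps x y : `[< has_config (add_edge M x y) c' >] = `[< has_config (add_edge M y x) c' >].
  by rewrite add_edgeC.
rewrite /num_absent_pairs -(sum_absent Ps) num_pairs_sum; apply/andP; split.
  by apply: leq_sum => x _; apply: leq_sum => y _; case: `[< _ >];
    rewrite ?andbT ?andbF // leq_b1.
have := @card_admissible_edge_cons _ _ true f sf; rewrite mul1n.
have -> : (n ^ 2 = \sum_(x < n) \sum_(y < n) 1)%N.
  by under eq_bigr do rewrite sum1_card card_ord; rewrite sum_nat_const card_ord.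
set u := (\sum_x \sum_y _)%N; set v := (\sum_x \sum_y _)%N; set w := (\sum_x \sum_y _)%N.
set t := (\sum_x \sum_y _)%N.
suff : (v + u <= t + w)%N by lia.
rewrite /u /v /w /t -!big_split; apply: leq_sum => x _; rewrite -!big_split.
apply: leq_sum => y _ /=.
by case: `[< _ >]; case: (simpleb _).
Qed.

End SimplePairs.

(** * Leading terms *)

Section Leads.
Variables (R : realType) (s : bool).
Local Notation Y := (conn_series R s).
Definition tree_series : fps R := theta (Y 0).
Local Notation T := tree_series.
Local Notation H := (geom T).

Lemma tree_series0 : T 0%N = 0. Proof. by rewrite /tree_series /theta mul0r. Qed.

Lemma tree_series_ge0 : nonneg T.
Proof. by move=> n; rewrite /tree_series /theta mulr_ge0 ?ler0n //; exact: conn_series_ge0. Qed.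

Lemma conn_series0E : 2 * Y 0 = 2 * T - T * T.
Proof. by rewrite -[T * T]conn_series0_rec -/tree_series; ring. Qed.

Lemma theta_two f : theta (2 * f) = 2 * theta f :> fps R.
Proof. by rewrite -(rmorph_nat (@fpsC R)) thetaCM. Qed.

Lemma two_inj (f g : fps R) : 2 * f = 2 * g -> f = g.
Proof.
move=> h; have e (k : fps R) : k = fpsC (1 / 2) * (2 * k).
  rewrite -(rmorph_nat (@fpsC R)) mulrA -rmorphM /=.
  have -> : 1 / 2 * 2%:R = 1 :> R by field.
  by rewrite rmorph1 mul1r.
by rewrite [LHS]e [RHS]e h.
Qed.

(** Applying theta to 2 W_(-1) = 2 T - T^2 gives (1 - T) theta T = T. *)
Lemma theta_tree_series : theta T = T * H.
Proof.
have h := congr1 (@theta R) conn_series0E.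
rewrite theta_two thetaB theta_two thetaM -/tree_series in h.
have e : (1 - T) * theta T = T by apply: two_inj; rewrite h; ring.
by rewrite -{2}e mulrAC geomP ?mul1r //; exact: tree_series0.
Qed.

Lemma tree_series1 : T 1%N = 1.
Proof. by rewrite /tree_series /theta mul1r conn_series0_1. Qed.

Lemma tree_series_geom : T * H = H - 1.
Proof. by have := geom_mulT tree_series0 0; rewrite expr1 expr0. Qed.

Lemma tree_series_le_geom n : T n <= H n.
Proof.
have -> : H = 1 + T + T * (T * H).
  by rewrite tree_series_geom mulrBr tree_series_geom; ring.
have h1 : 0 <= (1 : fps R) n by exact: nonneg1.
have h2 : 0 <= (T * (T * H)) n.
  by apply: nonnegM; [exact: tree_series_ge0|apply: nonnegM;
    [exact: tree_series_ge0|exact: geom_ge0 tree_series_ge0]].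
by rewrite !fpsD; lra.
Qed.

(** (n + 2) T_(n+2) is a coefficient of T H, at least T_1 H_(n+1) >= T_(n+1). *)
Lemma tree_series_gt0 n : (0 < n)%N -> 0 < T n.
Proof.
elim: n => // -[_ _|n IH _]; first by rewrite tree_series1.
have : 0 < n.+2%:R * T n.+2; last by rewrite pmulr_rgt0 ?ltr0n.
have -> : n.+2%:R * T n.+2 = (T * H) n.+2 by rewrite -theta_tree_series.
rewrite fpsM big_ord_recl tree_series0 mul0r add0r big_ord_recl ltr_pwDl //.
  by rewrite /bump /= tree_series1 mul1r; apply: lt_le_trans (IH isT) (tree_series_le_geom _).
apply: sumr_ge0 => i _; rewrite mulr_ge0 //; first exact: tree_series_ge0.
exact: geom_ge0 tree_series_ge0 _.
Qed.

Lemma theta_conn_series1 : 2 * theta (Y 1) = H * (T * H - s%:R * (T + T * T)).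
Proof.
have := @conn_series_rec R s 0; rewrite !mul0r addr0 -/tree_series theta_tree_series => h.
have e : (1 - T) * (2 * theta (Y 1)) = T * H - s%:R * (T + T * T).
  have h2 : T + T * T = 3 * T - 2 * Y 0 by rewrite conn_series0E; ring.
  rewrite mulrBl mul1r {1}h h2 !big_ord_recl big_ord0 /= /bump /= subn0 addn0 -/tree_series;
    ring.
by rewrite -e mulrA [H * _]mulrC geomP ?mul1r //; exact: tree_series0.
Qed.

(** Exactly, 2 theta W_0 = H^2 - H - s (2 H - 2 - T): the two models differ only in the O(H)
    remainder. *)
Lemma lead_theta_conn_series1 : lead T 2 (1 / 2) (theta (Y 1)).
Proof.
have e1 := tree_series_geom.
have O1 : geomO T 1 1 by apply: (geomO_weak tree_series0 tree_series_ge0 (leq0n 1));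
  have := geomOX tree_series_ge0 0; rewrite expr0.
have OH : geomO T 1 H by have := geomOX tree_series_ge0 1; rewrite expr1.
have OT : geomO T 1 T.
  by exists 1 => n; rewrite mul1r expr1 ger0_norm ?tree_series_le_geom //;
    exact: tree_series_ge0.
have h : theta (Y 1) = fpsC (1 / 2) * H ^+ 2 +
    (fpsC (- (1 / 2)) * H + fpsC (- (s%:R / 2)) * (2 * H - 2 - T)).
  apply: two_inj; rewrite theta_conn_series1.
  have e2 : H * (T + T * T) = 2 * H - 2 - T.
    transitivity (T * H + T * (T * H)); first by ring.
    by rewrite e1 mulrBr e1; ring.
  transitivity (H * (T * H) - s%:R * (H * (T + T * T))); first by ring.
  rewrite e1 e2 -[s%:R](rmorph_nat (@fpsC R)).
  have e3 : 2 * fpsC (1 / 2) = 1 :> fps R.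
    rewrite -(rmorph_nat (@fpsC R)) -rmorphM /= -(rmorph1 (@fpsC R)).
    by congr fpsC; field.
  have e4 : 2 * fpsC (- (s%:R / 2)) = - fpsC s%:R :> fps R.
    by rewrite -(rmorph_nat (@fpsC R)) -rmorphM -rmorphN /=; congr fpsC; field.
  have e5 : 2 * fpsC (- (1 / 2)) = -1 :> fps R by rewrite rmorphN mulrN e3.
  transitivity ((2 * fpsC (1 / 2)) * H ^+ 2 + (2 * fpsC (- (1 / 2))) * H +
     (2 * fpsC (- (s%:R / 2))) * (2 * H - 2 - T)); last by ring.
  rewrite e3 e4 e5; ring.
rewrite h; apply: lead_err.
  have := leadCM tree_series0 tree_series_ge0 (1 / 2) (leadX T 2); by rewrite mulr1.
apply: (geomOD); first exact: geomOCM.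
apply: geomOCM; apply: geomOB => //; apply: geomOB.
  by rewrite -(rmorph_nat (@fpsC R)); exact: geomOCM.
by rewrite -[2]mulr1 -(rmorph_nat (@fpsC R)); exact: geomOCM.
Qed.

(** The end terms of the sum in [conn_series_rec] are T theta W_(j+1); moved to the left they
    produce the factor 1 - T. *)
Lemma conn_series_eqn j : 2 * ((1 - T) * theta (Y j.+2) + j.+1%:R * Y j.+2) =
  theta (theta (Y j.+1)) - s%:R * (3 * theta (Y j.+1) + (2 * j)%:R * Y j.+1) +
  \sum_(p < j.+1) theta (Y p.+1) * theta (Y (j - p).+1).
Proof.
have := @conn_series_rec R s j.+1;
  rewrite big_ord_recl big_ord_recr /= subn0 subnn -/tree_series => h.
have e : (2 * j)%:R = 2 * j.+1%:R - 2 :> fps R by rewrite natrM -natr1; ring.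
rewrite e; transitivity (2 * (theta (Y j.+2) + j.+1%:R * Y j.+2) - 2 * T * theta (Y j.+2));
  first by ring.
rewrite h.
have -> : \sum_(i < j.+1) theta (Y (bump 0 i)) * theta (Y (j.+2 - bump 0 i)) =
  \sum_(p < j.+1) theta (Y p.+1) * theta (Y (j - p).+1).
  apply: eq_bigr => p _; rewrite /bump /= add1n subSS subSn //; exact: leq_ord.
by rewrite /bump /=; ring.
Qed.

(** W_j itself is expanded for j > 0 only, since W_0 is logarithmic in H. The coefficient is
    existential: later steps use its positivity and its value at j = 0. *)
Lemma lead_conn_series_exists j : exists a : R, [/\ 0 < a, lead T (3 * j).+2 a (theta (Y j.+1)),
  (0 < j)%N -> lead T (3 * j) (a / (3 * j)%:R) (Y j.+1) & j = 0%N -> a = 1 / 2].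
Proof.
elim/ltn_ind: j => -[|j] IH.
  by exists (1 / 2); split=> //; rewrite muln0; exact: lead_theta_conn_series1.
have [a0 [a0p l0 l0' _]] := IH j (ltnSn j).
have h (p : 'I_j.+1) : exists a : R, 0 < a /\ lead T (3 * p).+2 a (theta (Y p.+1)).
  by have [a [ap la _ _]] := IH p (ltn_ord p); exists a.
have [b hb] := choice h.
pose rj (p : 'I_j.+1) : 'I_j.+1 := rev_ord p.
(* Half the leading coefficient on the right of [conn_series_eqn]; the second theta acts on order 3
   j + 2 and brings out that factor. *)
pose c := 1 / 2 * ((3 * j).+2%:R * a0 + \sum_(p < j.+1) b p * b (rj p)).
have c0 : 0 < c.
  rewrite mulr_gt0 // ?divr_gt0 // ltr_pwDl ?mulr_gt0 ?ltr0n //.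
  by apply: sumr_ge0 => p _; rewrite mulr_ge0 // ltW //; case: (hb p); case: (hb (rj p)).
have lc : lead T (3 * j).+4 c ((1 - T) * theta (Y j.+2) + j.+1%:R * Y j.+2).
  have -> : (1 - T) * theta (Y j.+2) + j.+1%:R * Y j.+2 = fpsC (1 / 2) *
      (theta (theta (Y j.+1)) + \sum_(p < j.+1) theta (Y p.+1) * theta (Y (j - p).+1)
      + - fpsC s%:R * (fpsC 3 * theta (Y j.+1) + fpsC (2 * j)%:R * Y j.+1)).
    apply: two_inj; rewrite conn_series_eqn mulrA.
    have -> : 2 * fpsC (1 / 2) = 1 :> fps R.
      rewrite -(rmorph_nat (@fpsC R)) -rmorphM /= -(rmorph1 (@fpsC R)).
      by congr fpsC; field.
    by rewrite !rmorph_nat; ring.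
  apply: (leadCM tree_series0 tree_series_ge0).
  apply: lead_err.
    apply: leadD.
      by have hh := lead_theta tree_series0 tree_series_ge0 theta_tree_series l0.
    apply: lead_sum => p _.
    have [_ h1] := hb p; have [_ h2] := hb (rj p).
    have := leadM tree_series0 tree_series_ge0 h1 h2.
    have -> : ((3 * p).+2 + (3 * rj p).+2 = (3 * j).+4)%N.
      by rewrite /rj /=; have := ltn_ord p; lia.
    by rewrite /rj /= subSS.
  (* The corrections for simple graphs have order 3 j + 2, below the error order 3 j + 3; for j = 0
     the term with W_0 has coefficient 2 j = 0. *)
  rewrite mulNr; apply: geomON; apply: geomOCM; apply: geomOD.
    apply: geomOCM; apply: (geomO_weak tree_series0 tree_series_ge0 _ (lead_geomO
      tree_series0 tree_series_ge0 l0)); lia.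
  have [->|j0] := posnP j.
    by rewrite muln0 rmorph0 mul0r; exact: geomO0.
  apply: geomOCM; apply: (geomO_weak tree_series0 tree_series_ge0 _ (lead_geomO tree_series0
    tree_series_ge0 (l0' j0))); lia.
have lw : lead T (3 * j.+1) (c / (3 * j.+1)%:R) (Y j.+2).
  have e : (3 * j.+1 = (3 * j).+2.+1)%N by lia.
  rewrite e; apply: (lead_solve tree_series0 tree_series_ge0 theta_tree_series _ lc); lia.
exists c; split=> //.
have := lead_theta tree_series0 tree_series_ge0 theta_tree_series lw.
by rewrite mulrC divfK // pnatr_eq0.
Qed.

Definition acoef j : R := sval (cid (lead_conn_series_exists j)).
Definition bcoef j : R := acoef j / (3 * j)%:R.

Lemma acoef_gt0 j : 0 < acoef j.
Proof. by rewrite /acoef; case: cid => a []. Qed.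
Lemma lead_theta_conn_series j : lead T (3 * j).+2 (acoef j) (theta (Y j.+1)).
Proof. by rewrite /acoef; case: cid => a []. Qed.
Lemma lead_conn_series j : (0 < j)%N -> lead T (3 * j) (bcoef j) (Y j.+1).
Proof. by rewrite /bcoef /acoef; case: cid => a []. Qed.
Lemma acoef0 : acoef 0 = 1 / 2.
Proof. by rewrite /acoef; case: cid => a [_ _ _ h] /=; exact: h. Qed.
Lemma bcoef_gt0 j : (0 < j)%N -> 0 < bcoef j.
Proof. by move=> j0; rewrite divr_gt0 ?acoef_gt0 ?ltr0n; lia. Qed.

End Leads.

(** * Ratios of leading coefficients *)

Section Ratio.
Variables (R : realType) (s : bool) (q : nat).
Local Notation Y := (conn_series R s).
Local Notation T := (tree_series R s).

Local Notation Pi := (comp_prod R s q).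

Implicit Types c : nat -> nat.

Lemma lead_exp b d f k : lead T b d f -> lead T (b * k) (d ^+ k) (f ^+ k).
Proof.
move=> h; elim: k => [|k IH]; first by rewrite muln0 !expr0 /lead rmorph1.
by rewrite mulnS !exprS; have h' := leadM (@tree_series0 R s) (@tree_series_ge0 R s) h IH.
Qed.

Definition prod_coef c : R := \prod_(1 <= j < q.+1) ((c j)`!%:R^-1 * bcoef R s j ^+ c j).

Lemma lead_comp_prod c : lead T (3 * total_excess q c) (prod_coef c) (Pi c).
Proof.
rewrite /total_excess /prod_coef /comp_prod.
have : all (leq 1) (index_iota 1 q.+1) by apply/allP => j; rewrite mem_index_iota => /andP[].
elim: (index_iota 1 q.+1) => [|j l IH] /=.
  by move=> _; rewrite !big_nil muln0 /lead rmorph1.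
move=> /andP[j0 /IH h]; rewrite !big_cons mulnDr.
apply: (leadM (@tree_series0 R s) (@tree_series_ge0 R s)) => //;
  apply: (leadCM (@tree_series0 R s) (@tree_series_ge0 R s)).
by rewrite mulnA; apply: lead_exp; exact: lead_conn_series.
Qed.

Lemma prod_coef_gt0 c : 0 < prod_coef c.
Proof.
rewrite /prod_coef big_nat_cond; apply: prodr_gt0 => j /andP[/andP[j0 _] _].
by rewrite mulr_gt0 ?invr_gt0 ?ltr0n ?fact_gt0 // exprn_gt0 // bcoef_gt0.
Qed.

(** The leading coefficient, relative to [prod_coef], after pointing at a vertex in a component of
    excess a; 1/2 comes from theta W_0. *)
Definition point_coef c a : R := if a == 0%N then 1 / 2 else (3 * a * c a)%:R.

Lemma dec_config0 c : dec_config c 0 = c.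
Proof. by apply/funext => j; rewrite /dec_config. Qed.

(** The unknown [bcoef] cancels: [acoef] is 3 a times it, and lowering c a by one divides the
    product by it and multiplies by c a. *)
Lemma prod_coef_dec c a : supported q c ->
  (can_dec c a)%:R * (acoef R s a * prod_coef (dec_config c a)) = point_coef c a * prod_coef c.
Proof.
move=> sc; rewrite /point_coef; have [->|a0] := posnP a.
  by rewrite /can_dec /= dec_config0 acoef0 [LHS]mul1r.
have [oc|oc] := boolP (can_dec c a); last first.
  by move: oc; rewrite /can_dec (gtn_eqF a0) /= -leqNgt leqn0 => /eqP ->; rewrite muln0 !mul0r.
have aq := can_dec_le sc oc; rewrite mul1r /prod_coef.
rewrite (bigD1_seq a) ?mem_index_iota ?iota_uniq ?a0 //=.
rewrite [in RHS](bigD1_seq a) ?mem_index_iota ?iota_uniq ?a0 //=.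
have -> : \prod_(1 <= j < q.+1 | j != a) ((dec_config c a j)`!%:R^-1 *
  bcoef R s j ^+ dec_config c a j) =
   \prod_(1 <= j < q.+1 | j != a) ((c j)`!%:R^-1 * bcoef R s j ^+ c j).
  by apply: eq_bigr => j /negbTE ja; rewrite /dec_config ja andbF.
have ca : (0 < c a)%N by move: oc; rewrite /can_dec (gtn_eqF a0).
rewrite /dec_config a0 eqxx /= !mulrA; congr (_ * _).
have -> : acoef R s a = (3 * a)%:R * bcoef R s a.
  by rewrite /bcoef mulrC divfK // pnatr_eq0 muln_eq0 (gtn_eqF a0).
case: (c a) ca => // k _ /=; rewrite factS exprS !natrM invfM.
have k0 : k.+1%:R != 0 :> R by rewrite pnatr_eq0.
have f0 : k`!%:R != 0 :> R by rewrite pnatr_eq0 -lt0n fact_gt0.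
by move: (k.+1%:R : R) (k`!%:R : R) k0 f0 => u v u0 v0; field; rewrite u0 v0.
Qed.

Lemma lead0 b : lead T b.+1 0 0.
Proof. by apply: geomO_lead; exact: geomO0. Qed.

Lemma lead_single c a : supported q c ->
  lead T (3 * total_excess q c).+2 (point_coef c a * prod_coef c) ((can_dec c a)%:R *
    (theta (Y a.+1) * Pi (dec_config c a))).
Proof.
move=> sc; rewrite -prod_coef_dec //; have [oc|oc] := boolP (can_dec c a); last first.
  by rewrite !mul0r; exact: lead0.
rewrite !mul1r; have h := leadM (@tree_series0 R s) (@tree_series_ge0 R s)
  (@lead_theta_conn_series R s a) (lead_comp_prod (dec_config c a)).
by move: h; rewrite (total_excess_dec (can_dec_le sc oc) oc) !addSn -mulnDr.
Qed.

Lemma lead_same c a : supported q c ->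
  lead T (3 * total_excess q c).+4 ((3 * a + 2)%:R * point_coef c a * prod_coef c)
    ((can_dec c a)%:R * (theta (theta (Y a.+1)) * Pi (dec_config c a))).
Proof.
move=> sc; rewrite -mulrA -prod_coef_dec //; have [oc|oc] := boolP (can_dec c a); last first.
  by rewrite !mul0r mulr0; exact: lead0.
rewrite !mul1r.
have h1 := lead_theta (@tree_series0 R s) (@tree_series_ge0 R s) (@theta_tree_series R s)
  (@lead_theta_conn_series R s a).
have h := leadM (@tree_series0 R s) (@tree_series_ge0 R s) h1 (lead_comp_prod (dec_config c a)).
by move: h; rewrite (total_excess_dec (can_dec_le sc oc) oc) !addSn -mulnDr addn2 mulrA.
Qed.

Definition diff_factor c a b : fps R := (can_dec c a)%:R * (theta (Y a.+1) *
    ((can_dec (dec_config c a) b)%:R * (theta (Y b.+1) * Pi (dec_config (dec_config c a) b)))).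

Lemma lead_diff c a b : supported q c ->
  lead T (3 * total_excess q c).+4 (point_coef (dec_config c a) b * point_coef c a *
    prod_coef c) (diff_factor c a b).
Proof.
move=> sc; rewrite -mulrA -prod_coef_dec // /diff_factor;
  have [oc|oc] := boolP (can_dec c a); last first.
  by rewrite !mul0r mulr0; exact: lead0.
rewrite !mul1r.
have h := leadM (@tree_series0 R s) (@tree_series_ge0 R s) (@lead_theta_conn_series R s a)
  (lead_single b (supported_dec a sc)).
by move: h; rewrite (total_excess_dec (can_dec_le sc oc) oc) !addSn !addnS -mulnDr mulrCA.
Qed.

(** The terms mirror [num_pairsE]; 3 b + 2 comes from a second theta on order 3 b + 2. For a = b = 0
    this is 1 + 1/4. *)
Definition pair_coef c a b : R := (a == 0%N)%:R * ((3 * b + 2)%:R * point_coef c b) +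
   point_coef (dec_config c a) b * point_coef c a + (a != b)%:R *
     (point_coef (dec_config c b) a * point_coef c b).

Definition num_factor c a b : fps R :=
  (a == 0%N)%:R * ((can_dec c b)%:R * (theta (theta (Y b.+1)) * Pi (dec_config c b))) +
    diff_factor c a b + (a != b)%:R * diff_factor c b a.

Lemma lead_num_factor c a b : supported q c ->
  lead T (3 * total_excess q c).+4 (pair_coef c a b * prod_coef c) (num_factor c a b).
Proof.
move=> sc.
have h1 := leadCM (@tree_series0 R s) (@tree_series_ge0 R s) (a == 0%N)%:R (lead_same b sc).
have h2 := leadCM (@tree_series0 R s) (@tree_series_ge0 R s) (a != b)%:R (lead_diff b a sc).
have := leadD (leadD h1 (lead_diff a b sc)) h2.
rewrite !rmorph_nat; congr (lead _ _ _ _); rewrite /pair_coef; ring.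
Qed.

Definition den_factor c : fps R :=
  (theta (theta (Y 1)) + theta (Y 1) * theta (Y 1)) * Pi c +
  (fpsC 2 * (theta (Y 1) * theta (Pi c)) + theta (theta (Pi c))).

Lemma theta2_class_series c : supported q c ->
  theta (theta (class_series R s q c)) = unicyclic_series R s q * den_factor c.
Proof.
move=> sc; rewrite class_series_closed // thetaM theta_unicyclic_series thetaD !thetaM
  theta_unicyclic_series /den_factor.
by rewrite rmorph_nat; ring.
Qed.

(** With w the total excess, the terms contribute 1 + 1/4, 3 w and 3 w (3 w + 2), in total 9 w^2 + 9
    w + 5/4. *)
Lemma lead_den_factor c : lead T (3 * total_excess q c).+4
  (prod_coef c * ((3 * (total_excess q c)%:R + 1 / 2) * (3 *
    (total_excess q c)%:R + 5 / 2))) (den_factor c).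
Proof.
have L0 := @tree_series0 R s; have L1 := @tree_series_ge0 R s;
  have L2 := @theta_tree_series R s.
have hP := lead_comp_prod c.
have t1 := @lead_theta_conn_series1 R s.
have t2 := lead_theta L0 L1 L2 t1.
have p1 := lead_theta L0 L1 L2 hP.
have p2 := lead_theta L0 L1 L2 p1.
have a1 := leadM L0 L1 (leadD t2 (leadM L0 L1 t1 t1)) hP.
have a2 := leadCM L0 L1 2 (leadM L0 L1 t1 p1).
rewrite !addSn add0n in a1; rewrite !addSn add0n in a2.
have := leadD a1 (leadD a2 p2); congr (lead _ _ _ _).
by rewrite -addn2 natrD natrM; field.
Qed.

Lemma pair_ratio c f g : supported q c ->
  lead T (3 * total_excess q c).+4 (g * prod_coef c) f ->
  exists2 C : R, 0 <= C & exists N, forall n, (N <= n)%N ->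
   0 < theta (theta (class_series R s q c)) n /\
   `|(unicyclic_series R s q * f) n / theta (theta (class_series R s q c)) n -
     g / ((3 * (total_excess q c)%:R + 1 / 2) * (3 *
       (total_excess q c)%:R + 5 / 2))| <= C / Num.sqrt n%:R.
Proof.
move=> sc hf.
have d0 : 0 < (3 * (total_excess q c)%:R + 1 / 2) * (3 * (total_excess q c)%:R + 5 / 2) :> R.
  by rewrite mulr_gt0 // ltr_wpDl ?divr_gt0 // mulr_ge0 ?ler0n.
have h2 : geomO T 2 (theta (Y 1)).
  by have h := lead_geomO (@tree_series0 R s) (@tree_series_ge0 R s)
    (@lead_theta_conn_series1 R s).
have Fge : nonneg (unicyclic_series R s q) by exact: G_ge0.
have := @lead_ratio R T (@tree_series0 R s) (@tree_series_ge0 R s) (@theta_tree_series R s)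
  (unicyclic_series R s q) (theta (Y 1))
  Fge (unicyclic_series_0 R s q) (theta_unicyclic_series R s q) h2 (@tree_series_gt0 R s) (3
    * total_excess q c).+1 _ _ _ _
  (mulr_gt0 (prod_coef_gt0 c) d0) hf (lead_den_factor c).
move=> [C C0 [N hN]]; exists C => //; exists N => n /hN[h1 h3].
rewrite theta2_class_series //; split=> //.
have -> : g / ((3 * (total_excess q c)%:R + 1 / 2) * (3 * (total_excess q c)%:R + 5 / 2)) =
   g * prod_coef c / (prod_coef c * ((3 * (total_excess q c)%:R + 1 / 2) * (3 *
     (total_excess q c)%:R + 5 / 2))) :> R.
  have b0 := prod_coef_gt0 c; move: (_ * _) d0 => d d0.
  by field; rewrite ?gt_eqF.
exact: h3.
Qed.

End Ratio.

(** * Transition probabilities *)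

Lemma asymptotic_probability_bound (R : realType) (P : nat -> R) (p C : R) (N : nat) :
  0 <= C -> (forall n, (N <= n)%N -> `|P n - p| <= C / Num.sqrt n%:R) ->
  asymptotic_probability P p.
Proof.
move=> C0 hP; split.
  apply/cvgrPdist_lt => e e0.
  exists (maxn N.+1 (Num.truncn ((C / e) ^+ 2)).+1) => // n /=; rewrite geq_max => /andP[Nn hn].
  rewrite distrC; apply: le_lt_trans (hP n (ltnW Nn)) _.
  have n0 : 0 < Num.sqrt n%:R :> R by rewrite sqrtr_gt0 ltr0n; lia.
  rewrite ltr_pdivrMr // mulrC -ltr_pdivrMr //.
  rewrite -[ltLHS]ger0_norm ?divr_ge0 ?(ltW e0) // -sqrtr_sqr ltr_sqrt.
    by apply: lt_le_trans (truncnS_gt _) _; rewrite ler_nat.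
  by rewrite ltr0n; lia.
(* The constant has to be positive, and C may be 0. *)
apply/eqO_exP; exists (C + 1); first by rewrite ltr_wpDl.
exists N => // n /= Nn; rewrite [X in _ * X]ger0_norm ?invr_ge0 ?sqrtr_ge0 //.
apply: le_trans (hP n Nn) _; rewrite ler_wpM2r ?invr_ge0 ?sqrtr_ge0 //.
by rewrite lerDl.
Qed.

Section Transfer.
Variables (R : realType) (q : nat) (r : nat -> nat).
Hypothesis sr : supported q r.
Variable delta : nat -> int.
Local Notation cr := (fun j => (r j)%:Z).
Local Notation c' := (fun j => (r j)%:Z + delta j).
Local Notation w := (total_excess q r).

Definition class_sum (s : bool) n (g : 'M[nat]_n -> R) : R :=
  \sum_(f : edge_seq (n + w) n) (admissible s f && in_class r f)%:R * g (mgraph f).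

Arguments class_sum : clear implicits.

Lemma multigraphs_class_sum n (g : 'M[nat]_n -> R) :
  \sum_(M \in multigraphs n cr) kappa R M * g M =
  class_sum false n g / (2 ^ (n + w) * (n + w)`!)%:R.
Proof.
rewrite (@fsum_kappa _ (n + w)) => [|M hM]; last exact: (multigraphs_edges R sr hM).
congr (_ / _); rewrite big_mkcond; apply: eq_bigr => f _ /=.
case: asboolP => [/multigraphsE -> |h]; first by rewrite mul1r.
by case: (boolP (in_class r f)) => [/multigraphsE//|_]; rewrite mul0r.
Qed.

Lemma graphs_class_sum n (g : 'M[nat]_n -> R) :
  \sum_(M \in graphs n cr) g M = class_sum true n g / (2 ^ (n + w) * (n + w)`!)%:R.
Proof.
transitivity (\sum_(M \in graphs n cr) kappa R M * g M).
  by apply: eq_fsbigr => M; rewrite inE => -[_ /kappa_simple ->]; rewrite mul1r.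
rewrite (@fsum_kappa _ (n + w)) => [|M [hM _]]; last exact: (multigraphs_edges R sr hM).
congr (_ / _); rewrite big_mkcond; apply: eq_bigr => f _ /=.
case: asboolP => [/graphsE -> |h]; first by rewrite mul1r.
by case: (boolP (admissible true f && in_class r f)) => [/graphsE//|_]; rewrite mul0r.
Qed.

(** Two thetas multiply the coefficient by n^2, the number of ordered pairs, and the normalisations
    cancel. *)
Lemma class_sum_ratio s n : (0 < n)%N ->
  (pair_series R s q r delta) n / theta (theta (class_series R s q r)) n =
  class_sum s n (fun M => (num_pairs M c')%:R / (n ^ 2)%:R) / class_sum s n (fun=> 1).
Proof.
move=> n0; rewrite /theta /class_series /G /pair_series /weighted_series /normalise.
have -> : class_sum s n (fun M => (num_pairs M c')%:R / (n ^ 2)%:R) =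
    (\sum_(f : edge_seq (n + w) n) (admissible s f && in_class r f)%:R *
      (num_pairs (mgraph f) c')%:R) / (n ^ 2)%:R.
  by rewrite mulr_suml; apply: eq_bigr => f _; rewrite mulrA.
have -> : class_sum s n (fun=> 1) = \sum_(f :
  edge_seq (n + w) n) (admissible s f && in_class r f)%:R.
  by apply: eq_bigr => f _; rewrite mulr1.
have d0 := @normalise_den_neq0 R (n + w) n;
  have n0' : n%:R != 0 :> R by rewrite pnatr_eq0 -lt0n.
rewrite natrX; set a := (\sum_f _); set b := (\sum_f _).
(* For an empty class both sides are 0 by the convention on division. *)
move: (_%:R) d0 => d d0; have [->|b0] := eqVneq b 0;
  first by rewrite !mul0r !mulr0 !invr0 !mulr0.
by field; rewrite n0' b0 d0.
Qed.

Lemma class_sum_close s n (g h : 'M[nat]_n -> R) e : 0 <= e ->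
  (forall f : edge_seq (n + w) n, admissible s f -> in_class r f ->
    `|g (mgraph f) - h (mgraph f)| <= e) ->
  `|class_sum s n g / class_sum s n (fun=> 1) - class_sum s n h / class_sum s n (fun=> 1)| <= e.
Proof.
move=> e0 gh; have Z0 : 0 <= class_sum s n (fun=> 1 : R).
  by apply: sumr_ge0 => f _; rewrite mulr1 ler0n.
rewrite -mulrBl normrM normfV (ger0_norm Z0).
move: Z0; rewrite le_eqVlt => /orP[/eqP <-|Z0]; first by rewrite invr0 mulr0.
rewrite ler_pdivrMr // /class_sum -sumrB mulr_sumr; apply: le_trans (ler_norm_sum _ _ _) _.
apply: ler_sum => f _; rewrite -mulrBr mulr1.
have [/andP[okf cf]|_] := boolP (_ && _); last by rewrite !mul0r mulr0 normr0.
by rewrite mul1r mulr1 gh.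
Qed.

Lemma multigraph_transitionE n : (0 < n)%N ->
  multigraph_transition R cr c' n =
  (pair_series R false q r delta) n / theta (theta (class_series R false q r)) n.
Proof.
move=> n0; rewrite class_sum_ratio // /multigraph_transition multigraphs_class_sum.
have -> : \sum_(M \in multigraphs n cr) kappa R M = \sum_(M \in multigraphs n cr) kappa R M * 1.
  by apply: eq_fsbigr => M _; rewrite mulr1.
rewrite multigraphs_class_sum -mulf_div divff ?mulr1 //.
Qed.

(** Here 2 A = n^2 - eta and K - eta <= 2 B <= K, with eta = 3 n + 2 w forbidden pairs. The
    numerator of the difference is at most eta n^2, and n >= 2 w + 8 gives eta <= 4 n <= n^2 / 2, so
    the error is at most 2 eta / n^2 <= 8 / n. *)
Lemma graph_step_close n (f : edge_seq (n + w) n) : simpleb f -> (2 * w + 8 <= n)%N ->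
  `|graph_step R (mgraph f) c' - (num_pairs (mgraph f) c')%:R / (n ^ 2)%:R| <= 8 / Num.sqrt
    n%:R.
Proof.
move=> sf hn; have hA := card_absent sf; have := num_pairs_absent sf c'.
rewrite /graph_step -/(num_absent_pairs f c'); set A := #|_| in hA *;
  set B := num_absent_pairs _ _.
set K := num_pairs _ _ => /andP[h1 h2].
have hK : (K <= n ^ 2)%N.
  by apply: leq_trans (max_card _) _; rewrite card_prod card_ord -mulnn.
set eta := (n + 2 * (n + w))%N in hA h2.
have he : (eta <= 4 * n)%N by rewrite /eta; lia.
have hn2 : (8 * n <= n ^ 2)%N by rewrite -mulnn leq_mul2r; apply/orP; right; lia.
have q0 : 0 < n%:R :> R by rewrite ltr0n; lia.
have s0 : 0 < Num.sqrt n%:R :> R by rewrite sqrtr_gt0.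
have hs : Num.sqrt n%:R <= n%:R :> R.
  rewrite -[leRHS]ger0_norm ?ler0n // -sqrtr_sqr ler_sqrt ?exprn_ge0 ?ler0n //.
  by rewrite expr2 -{1}[n%:R]mul1r ler_pM2r // ler1n; lia.
have e1 : (2 * A)%:R = n%:R ^+ 2 - eta%:R :> R.
  by rewrite -natrX -hA natrD addrK.
have r1 : (2 * B)%:R <= K%:R :> R by rewrite ler_nat.
have r2 : K%:R <= (2 * B)%:R + eta%:R :> R by rewrite -natrD ler_nat.
have r3 : K%:R <= n%:R ^+ 2 :> R by rewrite -natrX ler_nat.
have r4 : eta%:R <= 4 * n%:R :> R by rewrite -natrM ler_nat.
have r5 : 8 * n%:R <= n%:R ^+ 2 :> R by rewrite -natrX -natrM ler_nat.
have r0 : 0 <= eta%:R :> R by rewrite ler0n.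
have rB : 0 <= K%:R :> R by rewrite ler0n.
have A0 : 0 < n%:R ^+ 2 - eta%:R :> R by nra.
apply: le_trans (_ : 8 / n%:R <= _); last by rewrite ler_wpM2l // lef_pV2 ?posrE.
have -> : B%:R / A%:R = (2 * B)%:R / (n%:R ^+ 2 - eta%:R) :> R.
  have A1 : A%:R != 0 :> R.
    by move: A0; rewrite -e1 ltr0n muln_gt0 /= => A1; rewrite pnatr_eq0 -lt0n.
  by rewrite -e1 !natrM; field.
rewrite natrX; move: (2 * B)%:R K%:R eta%:R (n%:R) r1 r2 r3 r4 r5 r0 rB A0 q0 => b k e x.
move=> r1 r2 r3 r4 r5 r0 rB A0 q0.
have -> : b / (x ^+ 2 - e) - k / x ^+ 2 =
  (b * x ^+ 2 - k * (x ^+ 2 - e)) / ((x ^+ 2 - e) * x ^+ 2).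
  by field; rewrite ?gt_eqF //.
have D0 : 0 < (x ^+ 2 - e) * x ^+ 2 by rewrite mulr_gt0 // exprn_gt0.
rewrite normrM normfV (gtr0_norm D0) ler_pdivrMr //.
have -> : 8 / x * ((x ^+ 2 - e) * x ^+ 2) = 8 * x * (x ^+ 2 - e) by field; rewrite gt_eqF.
have m1 : e * x ^+ 2 <= 8 * x * (x ^+ 2 - e).
  have : e <= x ^+ 2 / 2 by lra.
  move=> h; apply: le_trans (_ : 4 * x * x ^+ 2 <= _);
    first by rewrite ler_wpM2r // exprn_ge0 // ltW.
  have : x ^+ 2 / 2 <= x ^+ 2 - e by lra.
  move=> h'; have := ler_wpM2l (ltW (mulr_gt0 (ltr0n R 8) q0)) h'; lra.
apply: le_trans m1; rewrite ler_norml; apply/andP; split.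
  have : (b + e - k) * x ^+ 2 >= 0 by rewrite mulr_ge0 ?exprn_ge0 ?(ltW q0) //; lra.
  have : 0 <= k * e by rewrite mulr_ge0.
  lra.
have : (k - b) * x ^+ 2 >= 0 by rewrite mulr_ge0 ?exprn_ge0 ?(ltW q0) //; lra.
have : 0 <= (x ^+ 2 - k) * e by rewrite mulr_ge0 //; lra.
lra.
Qed.

Lemma graph_transition_close n : (2 * w + 8 <= n)%N ->
  `|graph_transition R cr c' n -
    (pair_series R true q r delta) n / theta (theta (class_series R true q r)) n| <= 8 /
      Num.sqrt n%:R.
Proof.
move=> hn; rewrite class_sum_ratio; last by lia.
rewrite /graph_transition !graphs_class_sum -mulf_div divff ?mulr1.
  apply: class_sum_close; first by rewrite divr_ge0 ?sqrtr_ge0.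
  by move=> f sf _; apply: graph_step_close.
by rewrite invr_eq0 pnatr_eq0 -lt0n muln_gt0 expn_gt0 fact_gt0.
Qed.

Lemma transition_close (P : nat -> R) :
  P = graph_transition R cr c' \/ P = multigraph_transition R cr c' ->
  exists s : bool, forall n, (2 * w + 8 <= n)%N ->
    `|P n - (pair_series R s q r delta) n / theta (theta (class_series R s q r)) n| <= 8 /
      Num.sqrt n%:R.
Proof.
case=> ->; first by exists true => n; exact: graph_transition_close.
exists false => n hn; rewrite multigraph_transitionE; last by lia.
by rewrite subrr normr0 divr_ge0 // sqrtr_ge0.
Qed.

Lemma transition_limit (P : nat -> R) a b : (a <= b)%N -> eq_pos delta (merge_delta a b) ->
  P = graph_transition R cr c' \/ P = multigraph_transition R cr c' ->
  asymptotic_probability P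
    (pair_coef R r a b / ((3 * w%:R + 1 / 2) * (3 * w%:R + 5 / 2))).
Proof.
move=> ab dE /transition_close[s hP].
have [C C0 [N hN]] := pair_ratio sr (lead_num_factor R s a b sr).
have nE : unicyclic_series R s q * num_factor R s q r a b = pair_series R s q r delta.
  rewrite (pair_seriesE R s sr ab dE) /num_factor /diff_factor /diff_series
    !class_series_closed //; try by do ?apply: supported_dec.
  by ring.
apply: (@asymptotic_probability_bound _ _ _ (8 + C) (maxn N (2 * w + 8))).
  by rewrite addr_ge0.
move=> n; rewrite geq_max => /andP[/hN[_ h1] /hP h2].
rewrite nE in h1; rewrite [(8 + C) / _]mulrDl.
by apply: le_trans (ler_distD _ _ _) _; apply: (lerD h2 h1).
Qed.

Lemma transition_limit0 (P : nat -> R) : (forall a b, ~ eq_pos delta (merge_delta a b)) ->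
  P = graph_transition R cr c' \/ P = multigraph_transition R cr c' ->
  asymptotic_probability P 0.
Proof.
move=> no /transition_close[s hP].
apply: (@asymptotic_probability_bound _ _ _ 8 (2 * w + 8)) => // n /hP.
by rewrite pair_series_eq0 // fps0 mul0r.
Qed.

End Transfer.

(** * The four kinds of merger *)

Lemma eq_pos_trans d d1 d2 : eq_pos d1 d2 -> eq_pos d d1 <-> eq_pos d d2.
Proof. by move=> e; split=> h j j0; rewrite h // e. Qed.

Lemma case1_merge_delta : eq_pos [eta (fun=> 0) with 1%N |-> 1] (merge_delta 0 0).
Proof. by move=> j j0; rewrite /merge_delta /= (gtn_eqF j0) /= !subr0; case: eqP. Qed.

Lemma case2_merge_delta j : (0 < j)%N ->
  eq_pos [eta (fun=> 0) with j |-> -1, j.+1 |-> 1] (merge_delta 0 j).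
Proof.
move=> j0 k k0; rewrite /merge_delta /= add0n (gtn_eqF k0) subr0.
have [->|kj] := eqVneq k j; first by rewrite ltn_eqF.
by case: ifP => _; rewrite ?subr0.
Qed.

Lemma case3_merge_delta j : (0 < j)%N ->
  eq_pos [eta (fun=> 0) with j |-> - 2%:Z, (2 * j).+1 |-> 1] (merge_delta j j).
Proof.
move=> j0 k k0; rewrite /merge_delta /= addnn -mul2n.
have [->|kj] := eqVneq k j; first by have -> : (j == (2 * j).+1) = false by lia.
by case: ifP => _; rewrite ?subr0.
Qed.

Lemma case4_merge_delta j k : (0 < j < k)%N ->
  eq_pos [eta (fun=> 0) with j |-> -1, k |-> -1, (j + k).+1 |-> 1] (merge_delta j k).
Proof.
move=> /andP[j0 jk] i i0; rewrite /merge_delta /=.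
have [->|ij] := eqVneq i j.
  by rewrite (ltn_eqF jk); have -> : (j == (j + k).+1) = false by lia.
have [->|ik] := eqVneq i k; first by have -> : (k == (j + k).+1) = false by lia.
by case: ifP => _; rewrite ?subr0.
Qed.

Theorem theorem9 (R : realType) (q : nat) (r : nat -> nat) (rtot : nat)
    (r_q : forall j : nat, (q < j)%N -> r j = 0%N)
    (r_tot : (\sum_(1 <= j < q.+1) j * r j)%N = rtot)
    (delta : nat -> int) (m : nat)
    (delta_m : forall j : nat, (m < j)%N -> delta j = 0)
    (delta_sum : \sum_(1 <= j < m.+1) j%:Z * delta j = 1)
    (P : nat -> R)
    (P_model :
      P = graph_transition R (fun j => (r j)%:Z) (fun j => (r j)%:Z + delta j)
      \/
      P = multigraph_transition R (fun j => (r j)%:Z)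
            (fun j => (r j)%:Z + delta j)) :
  let D : R := (3 * rtot%:R + 1 / 2) * (3 * rtot%:R + 5 / 2) in
  [/\ case1 delta -> asymptotic_probability P (5 / 4 / D),
      forall j : nat, case2 delta j ->
        asymptotic_probability P (9 * j%:R * (j%:R + 1) * (r j)%:R / D),
      forall j : nat, case3 delta j ->
        asymptotic_probability P
          (9 * j%:R ^+ 2 * (r j)%:R * ((r j)%:R - 1) / D),
      forall j k : nat, case4 delta j k ->
        asymptotic_probability P
          (18 * j%:R * k%:R * (r j)%:R * (r k)%:R / D)
    & ~ case1 delta -> (forall j : nat, ~ case2 delta j) ->
      (forall j : nat, ~ case3 delta j) ->
      (forall j k : nat, ~ case4 delta j k) ->
        asymptotic_probability P 0].
Proof.
move=> D.
have lim a b g : (a <= b)%N -> eq_pos delta (merge_delta a b) -> pair_coef R r a b = g ->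
    asymptotic_probability P (g / D).
  by move=> ab dE <-; have := transition_limit r_q ab dE P_model; rewrite /total_excess r_tot.
split.
- move=> /(eq_pos_trans _ case1_merge_delta) dE; apply: (lim 0%N 0%N) => //.
  by rewrite /pair_coef /point_coef /=; field.
- move=> j [j0 /(eq_pos_trans _ (case2_merge_delta j0)) dE]; apply: (lim 0%N j) => //.
  rewrite /pair_coef /point_coef /dec_config eqxx /= (gtn_eqF j0) (ltn_eqF j0) /= !natrM
    natrD natrM.
  by field.
- move=> j [j0 hd].
  have dE : eq_pos delta (merge_delta j j) by apply/(eq_pos_trans _ (case3_merge_delta j0)).
  apply: (lim j j) => //.
  rewrite /pair_coef /point_coef /dec_config !(gtn_eqF j0) eqxx j0 /= !natrM.
  (* If r_j = 0, the truncated predecessor in [dec_config] differs from r_j - 1, but it is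
     multiplied by r_j. *)
  by case: (r j) => [|k]; rewrite ?mulr0 ?mul0r /= -?natr1; ring.
- move=> j k [jk /(eq_pos_trans _ (case4_merge_delta jk)) dE]; have /andP[j0 jk'] := jk.
  have k0 : (0 < k)%N by apply: leq_trans jk'.
  apply: (lim j k) => //; first exact: ltnW.
  rewrite /pair_coef /point_coef /dec_config !(gtn_eqF j0) !(gtn_eqF k0) (ltn_eqF jk')
    (gtn_eqF jk') j0 k0 /= !natrM.
  by ring.
(* Every merger falls under one of the four cases, so here no pair of vertices leads to the
   target. *)
move=> n1 n2 n3 n4; apply: (transition_limit0 r_q _ P_model) => a b.
wlog ab : a b / (a <= b)%N.
  have [ab|/ltnW ba] := leqP a b => hw; first exact: hw.
  by move=> dE; apply: (hw b a) => // j j0; rewrite dE // merge_deltaC.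
move=> dE; have [a0|a0] := posnP a; have [b0|b0] := posnP b.
- by subst a b; apply: n1; apply/(eq_pos_trans _ case1_merge_delta).
- by subst a; apply: (n2 b); split=> //; apply/(eq_pos_trans _ (case2_merge_delta b0)).
- by move: ab; rewrite b0 leqNgt a0.
move: ab; rewrite leq_eqVlt => /orP[/eqP e|ab].
  by subst b; apply: (n3 a); split=> //; apply/(eq_pos_trans _ (case3_merge_delta a0)).
have ab' : (0 < a < b)%N by rewrite a0.
by apply: (n4 a b); split=> //; apply/(eq_pos_trans _ (case4_merge_delta ab')).
Qed.
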